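(* Let $\Sigma_2$ be the closed orientable surface of genus $2$ and let $\rho:\pi_1(\Sigma_2)\to\mathrm{PSL}(2,\mathbb{R})$ be a representation with Euler class $\pm1$. Then there exists an essential (i.e. non-contractible) simple closed curve $\gamma\in\pi_1(\Sigma_2)$ such that $|\mathrm{tr}(\rho(\gamma))|\le2$.
   Context: For an element of $\mathrm{PSL}(2,\mathbb{R})$, $|\mathrm{tr}|$ denotes the absolute value of the trace of either lift to $\mathrm{SL}(2,\mathbb{R})$. The Euler class of $\rho$ is the Euler number of the associated flat oriented circle bundle ($\mathbb{RP}^1$-bundle) over $\Sigma_2$. *)

(* Defs.v *)
From HB Require Import structures.
From mathcomp Require Import all_boot all_order all_algebra generic_quotient.
From mathcomp Require Import all_classical all_reals all_analysis.
From mathcomp Require Import homotopy.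
From mathcomp Require Import lra.

Set Implicit Arguments.
Unset Strict Implicit.
Unset Printing Implicit Defensive.

Import Order.TTheory GRing.Theory Num.Theory numFieldNormedType.Exports.
Local Open Scope classical_set_scope.
Local Open Scope ring_scope.
Local Open Scope quotient_scope.

Definition I01 (R : realType) : Type := set_type `[0%R, 1%R : R].

Section unit_interval.
Context {R : realType}.

HB.instance Definition _ := Topological.copy (I01 R) (set_type `[0%R, 1%R : R]).

Lemma clamp_subproof (x : R) : Num.max 0 (Num.min 1 x) \in `[0%R, 1%R : R]%classic.
Proof.
apply/mem_set; rewrite /= in_itv /= le_max lexx /=.
by rewrite ge_max ler01 /= ge_min lexx.
Qed.

(* Retraction of R onto [0, 1]; it lets formulas in a real parameter be used on
   the subtype [I01 R]. *)
Definition clamp (x : R) : I01 R :=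
  exist (fun y => y \in `[0%R, 1%R : R]%classic) _ (clamp_subproof x).

Definition I01_val (t : I01 R) : R := set_val t.

Lemma I01_ge0 (t : I01 R) : 0 <= I01_val t.
Proof. by have := set_valP t; rewrite /= in_itv /= => /andP[]. Qed.

Lemma I01_le1 (t : I01 R) : I01_val t <= 1.
Proof. by have := set_valP t; rewrite /= in_itv /= => /andP[]. Qed.

Lemma I01_val_inj : injective I01_val.
Proof. exact: val_inj. Qed.

Lemma clampE (x : R) : 0 <= x <= 1 -> I01_val (clamp x) = x.
Proof.
move=> /andP[x0 x1]; rewrite /I01_val set_valE /=.
by rewrite (min_idPr x1) (max_idPr x0).
Qed.

Lemma I01_valK (t : I01 R) : clamp (I01_val t) = t.
Proof. by apply: I01_val_inj; rewrite clampE // I01_ge0 I01_le1. Qed.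

Lemma I01_val0 : I01_val (clamp 0) = 0.
Proof. by rewrite clampE // lexx ler01. Qed.

Lemma I01_val1 : I01_val (clamp 1) = 1.
Proof. by rewrite clampE // lexx ler01. Qed.

Lemma clamp_neq01 : clamp 0 != clamp 1.
Proof.
apply/eqP => /(congr1 I01_val); rewrite I01_val0 I01_val1 => /eqP.
by rewrite eq_sym oner_eq0.
Qed.

HB.instance Definition _ := isBiPointed.Build (I01 R) clamp_neq01.

Lemma I01_zeroE : I01_val zero = 0. Proof. exact: I01_val0. Qed.

Lemma I01_oneE : I01_val one = 1. Proof. exact: I01_val1. Qed.

Lemma I01_val_continuous : continuous I01_val.
Proof. exact: initial_continuous. Qed.

Lemma clamp_continuous : continuous clamp.
Proof.
apply: continuous_comp_initial => x; rewrite /comp /=.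
apply: continuous_max; first exact: cst_continuous.
by apply: continuous_min; [exact: cst_continuous|exact: cvg_id].
Qed.

End unit_interval.

Lemma continuous_clamp_comp {R : realType} {W T : topologicalType}
    (h : W -> R) (f : I01 R -> T) :
  continuous f -> continuous h -> continuous (fun w => f (clamp (h w))).
Proof.
move=> cf ch w; apply: (@continuous_comp _ _ _ (fun w => clamp (h w)) f).
  apply: (@continuous_comp _ _ _ h clamp); first exact: ch.
  exact: clamp_continuous.
exact: cf.
Qed.

Section continuity.
Context {R : realType} {W : topologicalType}.
Implicit Types f g : W -> R.

Lemma continuous_add f g :
  continuous f -> continuous g -> continuous (fun w => f w + g w).
Proof. by move=> cf cg w; apply: cvgD; [exact: cf|exact: cg]. Qed.

Lemma continuous_sub f g :
  continuous f -> continuous g -> continuous (fun w => f w - g w).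
Proof. by move=> cf cg w; apply: cvgB; [exact: cf|exact: cg]. Qed.

Lemma continuous_mul f g :
  continuous f -> continuous g -> continuous (fun w => f w * g w).
Proof. by move=> cf cg w; apply: cvgM; [exact: cf|exact: cg]. Qed.

Lemma continuous_maxr f g :
  continuous f -> continuous g -> continuous (fun w => Num.max (f w) (g w)).
Proof. by move=> cf cg w; apply: continuous_max; [exact: cf|exact: cg]. Qed.

Lemma continuous_minr f g :
  continuous f -> continuous g -> continuous (fun w => Num.min (f w) (g w)).
Proof. by move=> cf cg w; apply: continuous_min; [exact: cf|exact: cg]. Qed.

Lemma continuous_const (c : R) : continuous (fun _ : W => c).
Proof. by move=> w; exact: cvg_cst. Qed.

Lemma continuous_pair {U V : topologicalType} (f : W -> U) (g : W -> V) :
  continuous f -> continuous g -> continuous (fun w => (f w, g w)).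
Proof. by move=> cf cg w; apply: cvg_pair; [exact: cf|exact: cg]. Qed.

Lemma continuous_compf {U V : topologicalType} (f : W -> U) (g : U -> V) :
  continuous g -> continuous f -> continuous (fun w => g (f w)).
Proof. by move=> cg cf w; apply: (@continuous_comp _ _ _ f g); [exact: cf|exact: cg]. Qed.

Lemma continuous_I01 (f : W -> I01 R) :
  continuous f -> continuous (fun w => I01_val (f w)).
Proof. by apply: continuous_compf; exact: I01_val_continuous. Qed.

End continuity.

Ltac cts := repeat lazymatch goal with
  | |- forall x, continuous_at x (fun _ => ?c) => exact: continuous_const
  | |- forall x, continuous_at x (fun w => w) => exact: (fun _ => cvg_id)
  | |- forall x, continuous_at x (fun w => fst w) => exact: (fun _ => cvg_fst)
  | |- forall x, continuous_at x (fun w => snd w) => exact: (fun _ => cvg_snd)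
  | |- forall x, continuous_at x fst => exact: (fun _ => cvg_fst)
  | |- forall x, continuous_at x snd => exact: (fun _ => cvg_snd)
  | |- forall x, continuous_at x I01_val => exact: I01_val_continuous
  | |- forall x, continuous_at x (fun w => I01_val w) =>
      exact: I01_val_continuous
  | |- forall x, continuous_at x (fun w => I01_val _) => apply: continuous_I01
  | |- forall x, continuous_at x (fun w => _ - _) => apply: continuous_sub
  | |- forall x, continuous_at x (fun w => _ + _) => apply: continuous_add
  | |- forall x, continuous_at x (fun w => _ * _) => apply: continuous_mul
  | |- forall x, continuous_at x (fun w => Num.max _ _) =>
      apply: continuous_maxr
  | |- forall x, continuous_at x (fun w => Num.min _ _) =>
      apply: continuous_minr
  end.

Section pasting.
Context {R : realType} {W T : topologicalType}.

Lemma pasting (h : W -> R) (c : R) (f g : W -> T) :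
  continuous h -> continuous f -> continuous g ->
  (forall w, h w = c -> f w = g w) ->
  continuous (fun w => if h w <= c then f w else g w).
Proof.
move=> ch cf cg fg; set k := (fun w => _).
have cA : closed (h @^-1` [set x | x <= c]).
  by apply: closed_comp => [x _|]; [exact: ch|exact: closed_le].
have cB : closed (h @^-1` [set x | c <= x]).
  by apply: closed_comp => [x _|]; [exact: ch|exact: closed_ge].
apply/continuous_subspace_setT.
have -> : [set: W] = h @^-1` [set x | x <= c] `|` h @^-1` [set x | c <= x].
  by apply/seteqP; split => // w _ /=; case: (leP (h w) c) => [|/ltW]; [left|right].
apply: withinU_continuous => //.
- apply: (@subspace_eq_continuous _ _ _ f); last exact: continuous_subspaceT.
  by move=> w /set_mem /= hw; rewrite /from_subspace /k hw.
- apply: (@subspace_eq_continuous _ _ _ g); last exact: continuous_subspaceT.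
  move=> w /set_mem /= hw; rewrite /from_subspace /k; case: leP => // hw'.
  by apply/esym/fg/le_anti/andP.
Qed.

End pasting.

Section paths.
Context {R : realType} {T : topologicalType}.
Implicit Types x y z w : T.
Local Notation I := (I01 R).

Lemma path_val0 x y (p : {path I from x to y}) : p (clamp 0) = x.
Proof. exact: path_zero. Qed.

Lemma path_val1 x y (p : {path I from x to y}) : p (clamp 1) = y.
Proof. exact: path_one. Qed.

Lemma path_cts x y (p : {path I from x to y}) : continuous p.
Proof. exact: cts_fun. Qed.

Definition concat_fun (f g : I -> T) (t : I) : T :=
  if I01_val t <= 2^-1 then f (clamp (2 * I01_val t))
  else g (clamp (2 * I01_val t - 1)).

Section concat.
Context {x y z : T} (p : {path I from x to y}) (q : {path I from y to z}).

Lemma concat_continuous : continuous (concat_fun p q).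
Proof.
apply: pasting.
- exact: I01_val_continuous.
- by apply: continuous_clamp_comp; [exact: path_cts|cts].
- by apply: continuous_clamp_comp; [exact: path_cts|cts].
- by move=> t ->; rewrite divff ?pnatr_eq0// subrr path_val0 path_val1.
Qed.

Lemma concat_zero : concat_fun p q zero = x.
Proof. by rewrite /concat_fun I01_zeroE mulr0 invr_ge0 ler0n path_val0. Qed.

Lemma concat_one : concat_fun p q one = z.
Proof.
rewrite /concat_fun I01_oneE ifF; last by lra.
by rewrite mulr1 (_ : 2 - 1 = 1) ?path_val1//; lra.
Qed.

Definition path_concat : {path I from x to z} :=
  mk_path concat_continuous concat_zero concat_one.

Lemma path_concatE t : path_concat t =
  if I01_val t <= 2^-1 then p (clamp (2 * I01_val t))
  else q (clamp (2 * I01_val t - 1)).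
Proof. by []. Qed.

End concat.

Section reverse.
Context {x y : T} (p : {path I from x to y}).

Definition reverse_fun (t : I) : T := p (clamp (1 - I01_val t)).

Lemma reverse_continuous : continuous reverse_fun.
Proof.
apply: (@continuous_clamp_comp _ _ _ (fun t => 1 - I01_val t) p).
  exact: path_cts.
by cts.
Qed.

Lemma reverse_zero : reverse_fun zero = y.
Proof. by rewrite /reverse_fun I01_zeroE subr0 path_val1. Qed.

Lemma reverse_one : reverse_fun one = x.
Proof. by rewrite /reverse_fun I01_oneE subrr path_val0. Qed.

Definition path_reverse : {path I from y to x} :=
  mk_path reverse_continuous reverse_zero reverse_one.

Lemma path_reverseE t : path_reverse t = p (clamp (1 - I01_val t)).
Proof. by []. Qed.

End reverse.

Definition path_cst x : {path I from x to x} := @cst I T x.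

Definition path_homotopic x y (p q : {path I from x to y}) : Prop :=
  exists H : I * I -> T, [/\ continuous H,
    forall t, H (t, zero) = p t, forall t, H (t, one) = q t,
    forall s, H (zero, s) = x & forall s, H (one, s) = y].

Lemma path_homotopic_refl x y (p : {path I from x to y}) : path_homotopic p p.
Proof.
exists (fun u => p u.1); split => // [|s|s]; rewrite ?path_zero ?path_one//.
by apply: continuous_compf; [exact: path_cts|cts].
Qed.

Lemma path_homotopic_sym x y (p q : {path I from x to y}) :
  path_homotopic p q -> path_homotopic q p.
Proof.
move=> [H [cH H0 H1 Hx Hy]]; exists (fun u => H (u.1, clamp (1 - I01_val u.2))).
split => //= [|t|t].
- apply: continuous_compf => //; apply: continuous_pair; first by cts.
  by apply: continuous_compf; [exact: clamp_continuous|cts].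
- by rewrite I01_zeroE subr0 H1.
- by rewrite I01_oneE subrr H0.
Qed.

Lemma path_homotopic_trans x y (p q r : {path I from x to y}) :
  path_homotopic p q -> path_homotopic q r -> path_homotopic p r.
Proof.
move=> [H [cH H0 H1 Hx Hy]] [K [cK K0 K1 Kx Ky]].
exists (fun u => if I01_val u.2 <= 2^-1 then H (u.1, clamp (2 * I01_val u.2))
          else K (u.1, clamp (2 * I01_val u.2 - 1))); split => /= [|t|t|s|s].
- apply: (@pasting _ _ _ (fun u : I * I => I01_val u.2)); first by cts.
  + apply: continuous_compf => //; apply: continuous_pair; first by cts.
    by apply: continuous_compf; [exact: clamp_continuous|cts].
  + apply: continuous_compf => //; apply: continuous_pair; first by cts.
    by apply: continuous_compf; [exact: clamp_continuous|cts].
  + by move=> w ->; rewrite divff ?pnatr_eq0// subrr H1 K0.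
- by rewrite I01_zeroE mulr0 invr_ge0 ler0n H0.
- rewrite I01_oneE ifF; last by lra.
  by rewrite mulr1 (_ : 2 - 1 = 1) ?K1//; lra.
- by case: ifP.
- by case: ifP.
Qed.

Lemma path_concat_homotopic x y z (p p' : {path I from x to y})
    (q q' : {path I from y to z}) :
  path_homotopic p p' -> path_homotopic q q' ->
  path_homotopic (path_concat p q) (path_concat p' q').
Proof.
move=> [H [cH H0 H1 Hx Hy]] [K [cK K0 K1 Kx Ky]].
exists (fun u => if I01_val u.1 <= 2^-1 then H (clamp (2 * I01_val u.1), u.2)
          else K (clamp (2 * I01_val u.1 - 1), u.2)); split => /= [|t|t|s|s].
- apply: (@pasting _ _ _ (fun u : I * I => I01_val u.1)); first by cts.
  + apply: continuous_compf => //; apply: continuous_pair; last by cts.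
    by apply: continuous_compf; [exact: clamp_continuous|cts].
  + apply: continuous_compf => //; apply: continuous_pair; last by cts.
    by apply: continuous_compf; [exact: clamp_continuous|cts].
  + by move=> w ->; rewrite divff ?pnatr_eq0// subrr Hy Kx.
- by rewrite H0 K0.
- by rewrite H1 K1.
- by rewrite I01_zeroE mulr0 invr_ge0 ler0n Hx.
- rewrite I01_oneE ifF; last by lra.
  by rewrite mulr1 (_ : 2 - 1 = 1) ?Ky//; lra.
Qed.

Lemma path_reverse_homotopic x y (p p' : {path I from x to y}) :
  path_homotopic p p' -> path_homotopic (path_reverse p) (path_reverse p').
Proof.
move=> [H [cH H0 H1 Hx Hy]]; exists (fun u => H (clamp (1 - I01_val u.1), u.2)).
split => /= [|t|t|s|s].
- apply: continuous_compf => //; apply: continuous_pair; last by cts.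
  by apply: continuous_compf; [exact: clamp_continuous|cts].
- exact: H0.
- exact: H1.
- by rewrite I01_zeroE subr0 Hy.
- by rewrite I01_oneE subrr Hx.
Qed.

Lemma reparam_homotopic x y (f : I -> T) (a b : I -> R)
    (p q : {path I from x to y}) :
  continuous f -> continuous a -> continuous b ->
  (forall t, p t = f (clamp (a t))) -> (forall t, q t = f (clamp (b t))) ->
  a zero = b zero -> a one = b one -> path_homotopic p q.
Proof.
move=> cf ca cb pE qE ab0 ab1.
exists (fun u => f (clamp ((1 - I01_val u.2) * a u.1 + I01_val u.2 * b u.1))).
split => /= [|t|t|s|s].
- apply: continuous_clamp_comp => //; cts; apply: continuous_compf => //; cts.
- by rewrite I01_zeroE subr0 mul1r mul0r addr0 pE.
- by rewrite I01_oneE subrr mul1r mul0r add0r qE.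
- by rewrite -ab0 -mulrDl subrK mul1r -pE path_zero.
- by rewrite -ab1 -mulrDl subrK mul1r -pE path_one.
Qed.

Lemma clamp_le0 (c : R) : c <= 0 -> clamp c = clamp 0.
Proof.
move=> c0; apply: I01_val_inj; rewrite I01_val0 /I01_val set_valE /=.
have -> : Num.min 1 c = c by apply/min_idPr; lra.
exact/max_idPl.
Qed.

Lemma clamp_ge1 (c : R) : 1 <= c -> clamp c = clamp 1.
Proof.
move=> c1; apply: I01_val_inj; rewrite I01_val1 /I01_val set_valE /=.
have -> : Num.min 1 c = 1 by apply/min_idPl.
exact/max_idPr/ler01.
Qed.

Lemma path_concat1p x y (p : {path I from x to y}) :
  path_homotopic (path_concat (path_cst x) p) p.
Proof.
apply: (@reparam_homotopic _ _ p (fun t => I01_val (clamp (2 * I01_val t - 1)))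
          I01_val) => [||| t | t | |].
- exact: path_cts.
- by cts; apply: continuous_compf; [exact: clamp_continuous|cts].
- by cts.
- rewrite I01_valK path_concatE; case: ifPn => // t2.
  by rewrite /path_cst/= clamp_le0 ?path_val0//; lra.
- by rewrite I01_valK.
- by rewrite I01_zeroE mulr0 clamp_le0 ?I01_val0//; lra.
- by rewrite I01_oneE mulr1 clamp_ge1 ?I01_val1//; lra.
Qed.

Lemma path_concatp1 x y (p : {path I from x to y}) :
  path_homotopic (path_concat p (path_cst y)) p.
Proof.
apply: (@reparam_homotopic _ _ p (fun t => I01_val (clamp (2 * I01_val t)))
          I01_val) => [||| t | t | |].
- exact: path_cts.
- by cts; apply: continuous_compf; [exact: clamp_continuous|cts].
- by cts.
- rewrite I01_valK path_concatE; case: ifPn => // t2.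
  by rewrite /path_cst/= clamp_ge1 ?path_val1//; lra.
- by rewrite I01_valK.
- by rewrite I01_zeroE mulr0 I01_val0.
- by rewrite I01_oneE mulr1 clamp_ge1 ?I01_val1//; lra.
Qed.

Lemma path_concatpV x y (p : {path I from x to y}) :
  path_homotopic (path_concat p (path_reverse p)) (path_cst x).
Proof.
apply: (@reparam_homotopic _ _ p
  (fun t => Num.min (2 * I01_val t) (2 - 2 * I01_val t)) (fun=> 0))
  => [||| t | t | |].
- exact: path_cts.
- by cts.
- by cts.
- have t0 := I01_ge0 t; have t1 := I01_le1 t.
  rewrite path_concatE; case: ifPn => t2.
    by congr (p (clamp _)); apply/esym/min_idPl; lra.
  rewrite path_reverseE clampE; last by apply/andP; split; lra.
  have -> : Num.min (2 * I01_val t) (2 - 2 * I01_val t) = 2 - 2 * I01_val t.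
    by apply/min_idPr; lra.
  by congr (p (clamp _)); lra.
- by rewrite path_val0.
- by rewrite I01_zeroE mulr0 subr0; apply/min_idPl.
- by rewrite I01_oneE mulr1 subrr; apply/min_idPr.
Qed.

Lemma path_reverseK x y (p : {path I from x to y}) :
  path_reverse (path_reverse p) = p.
Proof.
apply/path_eqP => t; have t0 := I01_ge0 t; have t1 := I01_le1 t.
rewrite !path_reverseE clampE; last by apply/andP; split; lra.
by rewrite subKr I01_valK.
Qed.

Lemma path_concatVp x y (p : {path I from x to y}) :
  path_homotopic (path_concat (path_reverse p) p) (path_cst y).
Proof. by rewrite -{2}(path_reverseK p); exact: path_concatpV. Qed.

Lemma path_concatA x y z w (p : {path I from x to y}) (q : {path I from y to z})
    (r : {path I from z to w}) :
  path_homotopic (path_concat p (path_concat q r))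
                 (path_concat (path_concat p q) r).
Proof.
apply: (@reparam_homotopic _ _ (path_concat (path_concat p q) r)
  (fun t => Num.max (I01_val t * 2^-1)
     (Num.max (I01_val t - 4^-1) (2 * I01_val t - 1))) I01_val)
  => [||| t | t | |].
- exact: path_cts.
- by cts.
- by cts.
- have t0 := I01_ge0 t; have t1 := I01_le1 t.
  set u := I01_val t in t0 t1 *; rewrite !path_concatE -/u.
  have [t2|t2] := leP u 2^-1.
    have -> : Num.max (u * 2^-1) (Num.max (u - 4^-1) (2 * u - 1)) = u * 2^-1.
      by apply/max_idPl; rewrite ge_max; apply/andP; split; lra.
    rewrite clampE; last by apply/andP; split; lra.
    rewrite ifT; last by lra.
    rewrite clampE; last by apply/andP; split; lra.
    by rewrite ifT; [congr (p (clamp _)); lra|lra].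
  rewrite clampE; last by apply/andP; split; lra.
  have [t3|t3] := leP u (3 / 4).
    rewrite ifT; last by lra.
    have -> : Num.max (u * 2^-1) (Num.max (u - 4^-1) (2 * u - 1)) = u - 4^-1.
      have -> : Num.max (u - 4^-1) (2 * u - 1) = u - 4^-1.
        by apply/max_idPl; lra.
      by apply/max_idPr; lra.
    rewrite clampE; last by apply/andP; split; lra.
    rewrite ifT; last by lra.
    rewrite clampE; last by apply/andP; split; lra.
    rewrite ifF; last by lra.
    by congr (q (clamp _)); lra.
  rewrite ifF; last by lra.
  have -> : Num.max (u * 2^-1) (Num.max (u - 4^-1) (2 * u - 1)) = 2 * u - 1.
    have -> : Num.max (u - 4^-1) (2 * u - 1) = 2 * u - 1.
      by apply/max_idPr; lra.
    by apply/max_idPr; lra.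
  rewrite clampE; last by apply/andP; split; lra.
  by rewrite ifF; [|lra].
- by rewrite I01_valK.
- by rewrite I01_zeroE mul0r; apply/max_idPl; rewrite ge_max; apply/andP; split; lra.
- rewrite I01_oneE mulr1 mul1r; have -> : Num.max (1 - 4^-1) (2 - 1 : R) = 1.
    by rewrite (_ : 2 - 1 = 1); [apply/max_idPr; lra|lra].
  by apply/max_idPr; lra.
Qed.

End paths.

Section fundamental_group.
Context (R : realType) {T : topologicalType} (x0 : T).
Local Notation loop := {path (I01 R) from x0 to x0}.

Definition loop_rel (p q : loop) : bool := `[< path_homotopic p q >].

Lemma loop_rel_refl : reflexive loop_rel.
Proof. by move=> p; apply/asboolP; exact: path_homotopic_refl. Qed.

Lemma loop_rel_sym : symmetric loop_rel.
Proof. by move=> p q; apply/asboolP/asboolP; exact: path_homotopic_sym. Qed.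

Lemma loop_rel_trans : transitive loop_rel.
Proof.
move=> q p r /asboolP pq /asboolP qr.
by apply/asboolP; exact: path_homotopic_trans qr.
Qed.

Canonical loop_equiv :=
  EquivRel loop_rel loop_rel_refl loop_rel_sym loop_rel_trans.

Definition fundamental_group := {eq_quot loop_equiv}.

HB.instance Definition _ := Choice.on fundamental_group.
HB.instance Definition _ := Quotient.on fundamental_group.

Definition loop_class (p : loop) : fundamental_group := \pi_fundamental_group p.

Lemma loop_classP (p q : loop) :
  loop_class p = loop_class q <-> path_homotopic p q.
Proof. by split=> [/eqmodP/asboolP|pq]; last exact/eqmodP/asboolP. Qed.

Lemma loop_class_repr (a : fundamental_group) : loop_class (repr a) = a.
Proof. exact: reprK. Qed.

Definition pi1_mul (a b : fundamental_group) : fundamental_group :=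
  loop_class (path_concat (repr a) (repr b)).

Definition pi1_inv (a : fundamental_group) : fundamental_group :=
  loop_class (path_reverse (repr a)).

Definition pi1_one : fundamental_group := loop_class (path_cst x0).

Lemma pi1_mulE (p q : loop) :
  pi1_mul (loop_class p) (loop_class q) = loop_class (path_concat p q).
Proof.
by apply/loop_classP/path_concat_homotopic; apply/loop_classP/loop_class_repr.
Qed.

Lemma pi1_invE (p : loop) : pi1_inv (loop_class p) = loop_class (path_reverse p).
Proof.
by apply/loop_classP/path_reverse_homotopic/loop_classP/loop_class_repr.
Qed.

Lemma pi1_mulA : associative pi1_mul.
Proof.
move=> a b c; rewrite -(loop_class_repr a) -(loop_class_repr b).
rewrite -(loop_class_repr c) !pi1_mulE.
by apply/loop_classP; exact: path_concatA.
Qed.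

Lemma pi1_mul1 : left_id pi1_one pi1_mul.
Proof.
move=> a; rewrite -(loop_class_repr a) pi1_mulE.
by apply/loop_classP; exact: path_concat1p.
Qed.

Lemma pi1_mulr1 : right_id pi1_one pi1_mul.
Proof.
move=> a; rewrite -(loop_class_repr a) pi1_mulE.
by apply/loop_classP; exact: path_concatp1.
Qed.

Lemma pi1_mulV : left_inverse pi1_one pi1_inv pi1_mul.
Proof.
move=> a; rewrite -(loop_class_repr a) pi1_invE pi1_mulE.
by apply/loop_classP; exact: path_concatVp.
Qed.

Lemma pi1_mulrV : right_inverse pi1_one pi1_inv pi1_mul.
Proof.
move=> a; rewrite -(loop_class_repr a) pi1_invE pi1_mulE.
by apply/loop_classP; exact: path_concatpV.
Qed.

HB.instance Definition _ := isGroup.Build fundamental_group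
  pi1_mulA pi1_mul1 pi1_mulr1 pi1_mulV pi1_mulrV.

Lemma loop_classM (p q : loop) :
  (loop_class p * loop_class q)%g = loop_class (path_concat p q).
Proof. exact: pi1_mulE. Qed.

Lemma loop_class1 : loop_class (path_cst x0) = 1%g.
Proof. by []. Qed.

Lemma loop_classV (p : loop) : ((loop_class p)^-1)%g = loop_class (path_reverse p).
Proof. exact: pi1_invE. Qed.

(* Class of the loop that follows p and returns along q. *)
Definition path_quotient {x : T} (p q : {path (I01 R) from x0 to x}) :
  fundamental_group := loop_class (path_concat p (path_reverse q)).

Lemma path_quotient1 x (p : {path (I01 R) from x0 to x}) :
  path_quotient p p = 1%g.
Proof. by apply/loop_classP; exact: path_concatpV. Qed.

Lemma path_quotientM x (p q r : {path (I01 R) from x0 to x}) :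
  (path_quotient p q * path_quotient q r)%g = path_quotient p r.
Proof.
rewrite loop_classM; apply/loop_classP.
apply: path_homotopic_trans (path_homotopic_sym (path_concatA _ _ _)) _.
apply: path_concat_homotopic; first exact: path_homotopic_refl.
apply: path_homotopic_trans (path_concatA _ _ _) _.
apply: path_homotopic_trans (path_concat1p _).
apply: path_concat_homotopic; last exact: path_homotopic_refl.
exact: path_concatVp.
Qed.

Lemma path_quotientV x (p q : {path (I01 R) from x0 to x}) :
  ((path_quotient p q)^-1)%g = path_quotient q p.
Proof.
apply: (mulgI (path_quotient p q)).
by rewrite path_quotientM path_quotient1 mulgV.
Qed.

End fundamental_group.

Section PSL2.
Context (R : realType).

Definition SL2 := {A : 'M[R]_2 | \det A == 1}.

HB.instance Definition _ := Choice.on SL2.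
HB.instance Definition _ := SubType.on SL2.

Lemma SL2_det (A : SL2) : \det (val A) = 1.
Proof. by case: A => A /= /eqP. Qed.

Lemma SL2_mul_subproof (A B : SL2) : \det (val A *m val B) == 1.
Proof. by rewrite det_mulmx !SL2_det mul1r. Qed.

Lemma SL2_inv_subproof (A : SL2) : \det (invmx (val A)) == 1.
Proof. by rewrite det_inv SL2_det invr1. Qed.

Lemma SL2_one_subproof : \det (1%:M : 'M[R]_2) == 1.
Proof. by rewrite det1. Qed.

Definition SL2_mul (A B : SL2) : SL2 := 
  exist (fun M : 'M[R]_2 => \det M == 1) _ (SL2_mul_subproof A B).
Definition SL2_inv (A : SL2) : SL2 := 
  exist (fun M : 'M[R]_2 => \det M == 1) _ (SL2_inv_subproof A).
Definition SL2_one : SL2 := 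
  exist (fun M : 'M[R]_2 => \det M == 1) _ SL2_one_subproof.

Definition sign_rel (A B : SL2) : bool :=
  (val A == val B) || (val A == - val B).

Lemma sign_rel_refl : reflexive sign_rel.
Proof. by move=> A; rewrite /sign_rel eqxx. Qed.

Lemma sign_rel_sym : symmetric sign_rel.
Proof.
by move=> A B; congr (_ || _); rewrite eq_sym// eqr_oppLR.
Qed.

Lemma sign_rel_trans : transitive sign_rel.
Proof.
move=> B A C; rewrite /sign_rel => /orP[]/eqP -> /orP[]/eqP ->;
  by rewrite ?opprK eqxx ?orbT.
Qed.

Canonical sign_equiv := EquivRel sign_rel sign_rel_refl sign_rel_sym sign_rel_trans.

Definition PSL2 := {eq_quot sign_equiv}.

HB.instance Definition _ := Choice.on PSL2.
HB.instance Definition _ := Quotient.on PSL2.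

Definition PSL2_class (A : SL2) : PSL2 := \pi_PSL2 A.

Lemma PSL2_classP (A B : SL2) :
  PSL2_class A = PSL2_class B <-> val A = val B \/ val A = - val B.
Proof.
split=> [/eqmodP/orP[/eqP|/eqP]|AB]; [by left|by right|].
by apply/eqmodP/orP; case: AB => ->; [left|right].
Qed.

Lemma PSL2_class_repr (a : PSL2) : PSL2_class (repr a) = a.
Proof. exact: reprK. Qed.

Definition PSL2_mul (a b : PSL2) : PSL2 := PSL2_class (SL2_mul (repr a) (repr b)).
Definition PSL2_inv (a : PSL2) : PSL2 := PSL2_class (SL2_inv (repr a)).
Definition PSL2_one : PSL2 := PSL2_class SL2_one.

Lemma PSL2_mulE (A B : SL2) :
  PSL2_mul (PSL2_class A) (PSL2_class B) = PSL2_class (SL2_mul A B).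
Proof.
have /PSL2_classP hA := PSL2_class_repr (PSL2_class A).
have /PSL2_classP hB := PSL2_class_repr (PSL2_class B).
apply/PSL2_classP; rewrite /=.
by case: hA => ->; case: hB => ->; rewrite ?mulNmx ?mulmxN ?opprK;
  [left|right|right|left].
Qed.

Lemma SL2_unit (A : SL2) : val A \in unitmx.
Proof. by rewrite unitmxE SL2_det unitr1. Qed.

Lemma PSL2_mulA : associative PSL2_mul.
Proof.
move=> a b c; rewrite -(PSL2_class_repr a) -(PSL2_class_repr b).
rewrite -(PSL2_class_repr c) !PSL2_mulE; congr PSL2_class.
by apply: val_inj; rewrite /= mulmxA.
Qed.

Lemma PSL2_mul1 : left_id PSL2_one PSL2_mul.
Proof.
move=> a; rewrite -(PSL2_class_repr a) PSL2_mulE; congr PSL2_class.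
by apply: val_inj; rewrite /= mul1mx.
Qed.

Lemma PSL2_mulr1 : right_id PSL2_one PSL2_mul.
Proof.
move=> a; rewrite -(PSL2_class_repr a) PSL2_mulE; congr PSL2_class.
by apply: val_inj; rewrite /= mulmx1.
Qed.

Lemma PSL2_mulV : left_inverse PSL2_one PSL2_inv PSL2_mul.
Proof.
move=> a; rewrite -{2}(PSL2_class_repr a) PSL2_mulE; congr PSL2_class.
by apply: val_inj; rewrite /= mulVmx// SL2_unit.
Qed.

Lemma PSL2_mulrV : right_inverse PSL2_one PSL2_inv PSL2_mul.
Proof.
move=> a; rewrite -{1}(PSL2_class_repr a) PSL2_mulE; congr PSL2_class.
by apply: val_inj; rewrite /= mulmxV// SL2_unit.
Qed.

HB.instance Definition _ := isGroup.Build PSL2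
  PSL2_mulA PSL2_mul1 PSL2_mulr1 PSL2_mulV PSL2_mulrV.

Lemma PSL2_classM (A B : SL2) :
  (PSL2_class A * PSL2_class B)%g = PSL2_class (SL2_mul A B).
Proof. exact: PSL2_mulE. Qed.

Lemma PSL2_class1 : PSL2_class SL2_one = 1%g.
Proof. by []. Qed.

(* The representative is one of the two lifts; see [abs_trE]. *)
Definition abs_tr (a : PSL2) : R := `|\tr (val (repr a))|.

Lemma abs_trE (A : SL2) : abs_tr (PSL2_class A) = `|\tr (val A)|.
Proof.
have /PSL2_classP := PSL2_class_repr (PSL2_class A).
by rewrite /abs_tr; case=> ->; rewrite ?raddfN ?normrN.
Qed.

End PSL2.

Section projective_line.
Context (R : realType).

(* RP^1 is the space of lines of R^2, with the quotient topology of R^2 \ {0}. *)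
Definition nonzero_vector := set_type [set v : 'cV[R]_2 | v != 0].

HB.instance Definition _ := Topological.on nonzero_vector.

Definition vec (v : nonzero_vector) : 'cV[R]_2 := set_val v.

Lemma vec_neq0 (v : nonzero_vector) : vec v != 0.
Proof. by have := set_valP v. Qed.

Definition mk_vec (v : 'cV[R]_2) (v0 : v != 0) : nonzero_vector :=
  exist (fun w => w \in [set v : 'cV[R]_2 | v != 0]) v (mem_set v0).

Lemma vec_inj : injective vec.
Proof. exact: val_inj. Qed.

Definition proportional (v w : nonzero_vector) : bool :=
  `[< exists2 c : R, c != 0 & vec v = c *: vec w >].

Lemma proportional_refl : reflexive proportional.
Proof.
by move=> v; apply/asboolP; exists 1; rewrite ?scale1r// oner_neq0.
Qed.

Lemma proportional_sym : symmetric proportional.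
Proof.
suff h v w : proportional v w -> proportional w v by move=> v w; apply/idP/idP; exact: h.
move=> /asboolP[c c0 vw]; apply/asboolP; exists c^-1; first by rewrite invr_neq0.
by rewrite vw scalerA mulVf// scale1r.
Qed.

Lemma proportional_trans : transitive proportional.
Proof.
move=> v u w /asboolP[c c0 uv] /asboolP[d d0 vw]; apply/asboolP.
by exists (c * d); rewrite ?mulf_neq0// uv vw scalerA.
Qed.

Canonical proportional_equiv :=
  EquivRel proportional proportional_refl proportional_sym proportional_trans.

Definition RP1 := quotient_topology {eq_quot proportional_equiv}.

HB.instance Definition _ := Topological.on RP1.
HB.instance Definition _ := Quotient.on RP1.

Definition line (v : nonzero_vector) : RP1 := \pi_RP1 v.

Lemma lineP (v w : nonzero_vector) :
  line v = line w <-> exists2 c : R, c != 0 & vec v = c *: vec w.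
Proof. by split=> [/eqmodP/asboolP|vw]; last exact/eqmodP/asboolP. Qed.

Lemma line_repr (l : RP1) : line (repr l) = l.
Proof. exact: reprK. Qed.

Lemma SL2_act_subproof (A : SL2 R) (v : nonzero_vector) : val A *m vec v != 0.
Proof.
apply: contra (vec_neq0 v) => /eqP Av0.
by rewrite -(mulKmx (SL2_unit A) (vec v)) Av0 mulmx0.
Qed.

Definition SL2_act (A : SL2 R) (v : nonzero_vector) : nonzero_vector :=
  mk_vec (SL2_act_subproof A v).

Definition PSL2_act (a : PSL2 R) (l : RP1) : RP1 := line (SL2_act (repr a) (repr l)).

Lemma PSL2_actE (A : SL2 R) (v : nonzero_vector) :
  PSL2_act (PSL2_class A) (line v) = line (SL2_act A v).
Proof.
have /PSL2_classP hA := PSL2_class_repr (PSL2_class A).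
have /lineP[c c0 hv] := line_repr (line v).
apply/lineP; rewrite /vec !set_valE /= -!/(vec _) hv -scalemxAr.
case: hA => ->; first by exists c.
by exists (- c); rewrite ?oppr_eq0// mulNmx scalerN scaleNr.
Qed.

Lemma PSL2_act1 (l : RP1) : PSL2_act 1%g l = l.
Proof.
rewrite -(line_repr l) -PSL2_class1 PSL2_actE; congr line.
by apply: vec_inj; rewrite /vec set_valE /= mul1mx.
Qed.

Lemma PSL2_actM (a b : PSL2 R) (l : RP1) :
  PSL2_act (a * b)%g l = PSL2_act a (PSL2_act b l).
Proof.
rewrite -(line_repr l) -(PSL2_class_repr a) -(PSL2_class_repr b).
rewrite PSL2_classM !PSL2_actE; congr line.
by apply: vec_inj; rewrite /vec !set_valE /= -mulmxA.
Qed.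

Definition angle_vec (theta : R) : 'cV[R]_2 :=
  \col_i (if i == 0 then cos theta else sin theta).

Lemma angle_vec_neq0 (theta : R) : angle_vec theta != 0.
Proof.
apply/eqP => /colP v0; have := cos2Dsin2 theta.
have := v0 0; have := v0 1; rewrite !mxE /= => -> ->.
by rewrite expr0n addr0 => /eqP; rewrite eq_sym oner_eq0.
Qed.

(* R -> RP^1, theta |-> the line of angle theta: the universal covering, with
   deck group generated by theta |-> theta + pi. It orients RP^1. *)
Definition angle_line (theta : R) : RP1 := line (mk_vec (angle_vec_neq0 theta)).

End projective_line.

Section genus2_surface.
Context (R : realType).

(* The surface is an octagon with sides identified in pairs. The octagon is
   modelled by the closed unit disc, the k-th side being the arc of boundary
   points of parameter in [k, k + 1], for k = 0, ..., 7, in counterclockwise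
   order. *)
Definition disc := set_type [set u : R * R | u.1 ^+ 2 + u.2 ^+ 2 <= 1].

HB.instance Definition _ := Topological.on disc.

Definition disc_val (u : disc) : R * R := set_val u.

Definition mk_disc (u : R * R) (hu : u.1 ^+ 2 + u.2 ^+ 2 <= 1) : disc :=
  exist (fun u => u \in [set u : R * R | u.1 ^+ 2 + u.2 ^+ 2 <= 1]) u (mem_set hu).

Lemma disc_val_inj : injective disc_val.
Proof. exact: val_inj. Qed.

Lemma disc_valP (u : disc) : (disc_val u).1 ^+ 2 + (disc_val u).2 ^+ 2 <= 1.
Proof. by have := set_valP u. Qed.

Lemma disc_center_subproof : (0 : R * R).1 ^+ 2 + (0 : R * R).2 ^+ 2 <= 1.
Proof. by rewrite /= expr0n addr0 ler01. Qed.

Definition disc_center : disc := mk_disc disc_center_subproof.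

Definition boundary_fun (t : R) : R * R := (cos (t * (pi / 4)), sin (t * (pi / 4))).

Lemma boundary_subproof (t : R) :
  (boundary_fun t).1 ^+ 2 + (boundary_fun t).2 ^+ 2 <= 1.
Proof. by rewrite /= cos2Dsin2. Qed.

Definition boundary_point (t : R) : disc := mk_disc (boundary_subproof t).

(* Side k is glued to side k + 2 with reversed direction for k = 0, 1, 4, 5, so
   the boundary word is a b a^-1 b^-1 c d c^-1 d^-1. *)
Inductive glued : disc -> disc -> Prop :=
| glued_side (k : nat) (s : R) of k \in [:: 0; 1; 4; 5]%N & 0 <= s <= 1 :
    glued (boundary_point (k%:R + s)) (boundary_point (k%:R + 3 - s))
| glued_refl u : glued u u
| glued_sym u v : glued u v -> glued v u
| glued_trans u v w : glued u v -> glued v w -> glued u w.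

Definition glue_rel (u v : disc) : bool := `[< glued u v >].

Lemma glue_rel_refl : reflexive glue_rel.
Proof. by move=> u; apply/asboolP; exact: glued_refl. Qed.

Lemma glue_rel_sym : symmetric glue_rel.
Proof. by move=> u v; apply/asboolP/asboolP; exact: glued_sym. Qed.

Lemma glue_rel_trans : transitive glue_rel.
Proof.
move=> v u w /asboolP uv /asboolP vw.
by apply/asboolP; exact: glued_trans vw.
Qed.

Canonical glue_equiv :=
  EquivRel glue_rel glue_rel_refl glue_rel_sym glue_rel_trans.

Definition Sigma2 := quotient_topology {eq_quot glue_equiv}.

HB.instance Definition _ := Topological.on Sigma2.
HB.instance Definition _ := Quotient.on Sigma2.

Definition proj (u : disc) : Sigma2 := \pi_Sigma2 u.

Lemma projP (u v : disc) : proj u = proj v <-> glued u v.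
Proof. by split=> [/eqmodP/asboolP|uv]; last exact/eqmodP/asboolP. Qed.

Lemma proj_continuous : continuous proj.
Proof. exact: pi_continuous. Qed.

Definition base : Sigma2 := proj disc_center.

(* The 1-skeleton of the cell structure given by the octagon: a wedge of four
   circles. *)
Definition skeleton : set Sigma2 := [set proj (boundary_point t) | t in setT].

Definition scale_fun (t : I01 R) (u : disc) : R * R :=
  (I01_val t * (disc_val u).1, I01_val t * (disc_val u).2).

Lemma scale_subproof t u : (scale_fun t u).1 ^+ 2 + (scale_fun t u).2 ^+ 2 <= 1.
Proof.
rewrite /= !exprMn -mulrDr mulr_ile1 ?disc_valP ?addr_ge0 ?sqr_ge0//.
by rewrite expr_le1// ?I01_ge0 ?I01_le1.
Qed.

Definition scale (t : I01 R) (u : disc) : disc := mk_disc (scale_subproof t u).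

(* The image in the surface of the radius of the disc that ends at u. *)
Section ray.
Context (u : disc) (x : Sigma2) (ux : proj u = x).

Definition ray_fun (t : I01 R) : Sigma2 := proj (scale t u).

Lemma ray_continuous : continuous ray_fun.
Proof.
apply: continuous_compf; first exact: proj_continuous.
apply: continuous_comp_initial; apply: (@continuous_pair (I01 R)); cts.
Qed.

Lemma ray_zero : ray_fun zero = base.
Proof.
congr proj; apply: disc_val_inj; rewrite /disc_val !set_valE /= /scale_fun.
by rewrite I01_zeroE !mul0r.
Qed.

Lemma ray_one : ray_fun one = x.
Proof.
rewrite -ux; congr proj; apply: disc_val_inj.
rewrite [LHS]/disc_val set_valE /= /scale_fun I01_oneE !mul1r.
by case: (disc_val u).
Qed.

Definition ray : {path (I01 R) from base to x} :=
  mk_path ray_continuous ray_zero ray_one.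

End ray.

End genus2_surface.

Section flat_bundle.
Context {R : realType}.
Variable rho : {multiplicative fundamental_group R (base R) -> PSL2 R}.

(* Let S~ be the universal cover, i.e. the homotopy classes of paths that start
   at the base point. The flat bundle associated with rho is the quotient of
   S~ x RP^1 identifying (g p, rho(g) l) with (p, l) for every loop class g.
   The rays give a lift of the octagon to S~, so the same bundle is the quotient
   of disc x RP^1 by the identifications induced on that lift: if u and v are
   glued, then ray u = g (ray v) with g = path_quotient (ray u) (ray v), and
   (u, rho(g) l) is identified with (v, l). *)
Definition flat_glued (a b : disc R * RP1 R) : Prop :=
  exists (x : Sigma2 R) (ax : proj a.1 = x) (bx : proj b.1 = x),
    a.2 = PSL2_act (rho (path_quotient (ray ax) (ray bx))) b.2.

Lemma rho1 : rho 1%g = 1%g.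
Proof.
apply: (mulgI (rho 1%g)).
by rewrite -[LHS](@gmulfM _ _ rho) !mulg1.
Qed.

Definition flat_rel a b : bool := `[< flat_glued a b >].

Lemma flat_rel_refl : reflexive flat_rel.
Proof.
move=> a; apply/asboolP; exists (proj a.1), erefl, erefl.
by rewrite path_quotient1 rho1 PSL2_act1.
Qed.

Lemma flat_rel_sym : symmetric flat_rel.
Proof.
suff h a b : flat_rel a b -> flat_rel b a by move=> a b; apply/idP/idP; exact: h.
move=> /asboolP[x [ax [bx ab]]]; apply/asboolP; exists x, bx, ax.
by rewrite ab -PSL2_actM -[X in PSL2_act X]gmulfM path_quotientM path_quotient1 rho1 PSL2_act1.
Qed.

Lemma flat_rel_trans : transitive flat_rel.
Proof.
move=> b a c /asboolP[x [ax [bx ab]]] /asboolP[y [ey [cy bc]]].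
have xy : x = y by rewrite -bx.
case: _ / xy ey cy bc => ey cy bc; apply/asboolP; exists x, ax, cy.
rewrite ab bc -PSL2_actM -[X in PSL2_act X]gmulfM (Prop_irrelevance ey bx).
by rewrite path_quotientM.
Qed.

Canonical flat_equiv :=
  EquivRel flat_rel flat_rel_refl flat_rel_sym flat_rel_trans.

Definition flat_bundle := quotient_topology {eq_quot flat_equiv}.

HB.instance Definition _ := Topological.on flat_bundle.
HB.instance Definition _ := Quotient.on flat_bundle.

Definition flat_point (u : disc R) (l : RP1 R) : flat_bundle :=
  \pi_flat_bundle (u, l).

Definition flat_proj (e : flat_bundle) : Sigma2 R := proj (repr e).1.

Lemma flat_projE u l : flat_proj (flat_point u l) = proj u.
Proof.
rewrite /flat_proj /flat_point; case: piP => a /eqmodP/asboolP[x [ux [ax _]]].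
by rewrite ax -ux.
Qed.

(* s is total, but only its values on K matter. *)
Definition section_on (K : set (Sigma2 R)) (s : Sigma2 R -> flat_bundle) : Prop :=
  {within K, continuous s} /\ {in K, cancel s flat_proj}.

(* [flat_point] trivializes the pullback of the bundle to the octagon. In this
   trivialization the section s gives a map from the boundary circle to RP^1;
   theta is a lift of this map to the universal covering of RP^1, and e is the
   degree of the map. *)
Definition boundary_degree (s : Sigma2 R -> flat_bundle) (e : int) : Prop :=
  exists theta : R -> R, [/\ {within `[0, 8], continuous theta},
    forall t, t \in `[0, 8] ->
      s (proj (boundary_point t)) = flat_point (boundary_point t) (angle_line (theta t)) &
    theta 8 - theta 0 = e%:~R * pi].

(* Obstruction-theoretic definition: the Euler number is the degree, on the
   boundary of the only 2-cell, of any section over the 1-skeleton, with respect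
   to the counterclockwise orientation of the octagon and the orientation of
   RP^1 by increasing angle. *)
Definition euler_number (e : int) : Prop :=
  exists s, section_on (@skeleton R) s /\ boundary_degree s e.

End flat_bundle.

Definition simple_loop {R : realType} {T : topologicalType} {x : T}
    (p : {path (I01 R) from x to x}) : Prop :=
  {in [pred t | t != one] &, injective p}.

Definition simple_closed_curve {R : realType} {T : topologicalType} {x : T}
    (g : fundamental_group R x) : Prop :=
  exists p : {path (I01 R) from x to x}, loop_class p = g /\ simple_loop p.

(* Main.v *)
(** Suppose that rho maps every simple closed curve that it does not kill to a hyperbolic
    element. Since the Euler number is odd, the images of the standard generators lift to
    A, B, C, D in SL(2, R) with [A, B] [C, D] = -1, and the same holds after applying any
    homeomorphism of the surface; two symmetries of the octagon and two Dehn twists, built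
    by hand, are enough. Let K = |tr [A, B]|. The Markov type equations satisfied by the
    traces of a handle allow one to reduce (A, B) and (C, D). The images of d^-1 a under the
    half twists about the curve [c, d] have traces f_j with f_{j+1} + f_{j-1} = K f_j, and
    comparing two such sequences shows that, for some j, the Dehn twist about the j-th image
    replaces K by some K' <= K - 1. This cannot be repeated forever. *)

From HB Require Import structures.
From mathcomp Require Import all_boot all_order all_algebra generic_quotient.
From mathcomp Require Import all_classical all_reals all_analysis.
From mathcomp Require Import homotopy.
From mathcomp Require Import ring lra zify.
Require Import Defs.

Set Implicit Arguments.
Unset Strict Implicit.
Unset Printing Implicit Defensive.

Import Order.TTheory GRing.Theory Num.Theory numFieldNormedType.Exports.
Local Open Scope classical_set_scope.
Local Open Scope ring_scope.

(** * Inequalities on traces *)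

(** The sign in [A, B] [C, D] = -1 appears because a direction carried once around the octagon turns
    by pi or -pi and comes back as its opposite. Hence tr [C, D] = - tr [A, B], and the handles
    behave differently. Where the trace is K > 2, trace reduction ends on a pair of pants whose
    boundary traces exceed 2 in absolute value, which forces K > 18. Where it is -K, it ends on a
    curve whose squared trace is at most K - 2.

    Up to sign, f_j is a multiple of cosh ((j - phase) L) with 2 cosh L = K. The twist can fail to
    reduce K for every j only if the phase is close to an integer. The second sequence comes from
    another boundary curve of the pants, and the boundary traces keep the difference of the two
    phases away from the integers: one of the two sequences succeeds.

    That a simple curve is not contractible is only ever deduced from its image under rho being
    non-trivial. So the curves used must be shown not to be killed; if one were, the relation would
    force some curve that is simple as well to have trace 0, which neither a killed nor a hyperbolic
    curve has. *)

Lemma descent (R : archiRealFieldType) (T : Type) (P Q : T -> Prop) (mu : T -> R) (e : R) :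
  0 < e -> (forall t, P t -> 0 <= mu t) ->
  (forall t, P t -> Q t \/ exists2 t', P t' & mu t' <= mu t - e) ->
  forall t, P t -> exists2 t', P t' & Q t'.
Proof.
move=> e0 mu0 step t Pt.
have [n] : exists n : nat, mu t < n%:R * e.
  exists (Num.bound (mu t / e)); rewrite -ltr_pdivrMr//.
  by rewrite archi_boundP// divr_ge0 ?mu0// ltW.
elim: n t Pt => [|n IHn] t Pt; first by rewrite mul0r ltNge mu0.
rewrite -natr1 mulrDl mul1r => hn.
have [Qt|[t' Pt' ht']] := step t Pt; first by exists t.
by apply: (IHn t') => //; lra.
Qed.

Section real_inequalities.
Context {R : realFieldType}.
Implicit Types (a b c x y z K : R).

(** Here x, y, z are the absolute values of the traces of a, b, ab, when the product of these traces
    is positive, and K is the trace of [a, b]. The Vieta jump from z to x y - z gains a definite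
    amount because the discriminant (2 z - x y)^2 = (x^2 - 4) (y^2 - 4) + 4 (K - 2) is bounded
    below. *)
Lemma markov_gap_pos x y z K : 2 < x -> 2 < y -> x <= z -> y <= z ->
  x ^+ 2 + y ^+ 2 + z ^+ 2 - x * y * z - 2 = K -> 2 < K ->
  `|x * y - z| <= z - Num.min 1 (K - 2).
Proof.
wlog xy : x y / x <= y => [hw|] hx hy xz yz hK K2.
  have [xy|/ltW yx] := leP x y; first exact: hw.
  by rewrite (mulrC x y); apply: hw => //; rewrite -hK; ring.
set e := Num.min _ _.
have e0 : 0 < e by rewrite lt_min ltr01 subr_gt0.
have e1 : e <= 1 by rewrite ge_min lexx.
have eK : e <= K - 2 by rewrite ge_min lexx orbT.
have sqE : (2 * z - x * y) ^+ 2 = (x ^+ 2 - 4) * (y ^+ 2 - 4) + 4 * (K - 2).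
  by rewrite -hK; ring.
have pos : 0 < 2 * z - x * y.
  rewrite ltNge; apply/negP => hz.
  have h1 : 0 <= (z - y) * (x * y - z - y) by apply: mulr_ge0; lra.
  have h2 : 0 <= (x - 2) * ((y - x) * (y + x)) by rewrite !mulr_ge0//; lra.
  have h4 : 0 <= (x - 2) * (x * x) by rewrite !mulr_ge0//; lra.
  have h5 : 0 <= (x - 2) * (x - 2) * (x + 1) by rewrite !mulr_ge0//; lra.
  lra.
have sq_ge : 4 * e <= (2 * z - x * y) ^+ 2.
  have : 0 <= (x - 2) * (x + 2) * ((y - 2) * (y + 2)) by rewrite !mulr_ge0//; lra.
  by rewrite sqE; lra.
have gap : e <= 2 * z - x * y.
  rewrite leNgt; apply/negP => h.
  have : 0 <= (e - (2 * z - x * y)) * (e + (2 * z - x * y)) by rewrite !mulr_ge0//; lra.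
  have : 0 <= e * (1 - e) by rewrite !mulr_ge0//; lra.
  lra.
have : 0 <= (x - 2) * (y - 2) by rewrite !mulr_ge0//; lra.
by move=> ?; rewrite ler_norml; apply/andP; split; lra.
Qed.

(** The same jump for a commutator of trace -K. The discriminant is now (x^2 - 4) (y^2 - 4) - 4 (K +
    2), and what keeps it away from 0 is that x^2 and y^2 both exceed K - 2; when one does not, a
    short curve has been found. *)
Lemma markov_gap_neg x y z K : x <= z -> y <= z -> 2 < x -> 2 < y ->
  x ^+ 2 + y ^+ 2 + z ^+ 2 - x * y * z - 2 = - K -> 18 <= K ->
  K - 2 < x ^+ 2 -> K - 2 < y ^+ 2 ->
  `|x * y - z| <= z - 1.
Proof.
wlog xy : x y / x <= y => [hw|] xz yz hx hy hK K18 xK yK.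
  have [xy|/ltW yx] := leP x y; first exact: (hw x y).
  by rewrite (mulrC x y); apply: hw => //; rewrite -hK; ring.
have sqE : (2 * z - x * y) ^+ 2 = (x ^+ 2 - 4) * (y ^+ 2 - 4) - 4 * (K + 2).
  rewrite (_ : K = - (x ^+ 2 + y ^+ 2 + z ^+ 2 - x * y * z - 2)); first by ring.
  by rewrite hK opprK.
(* As for a positive trace, 2 z <= x y would give x^2 (x - 3) <= K - 2 < x^2, hence x < 4, whereas
   x^2 > K - 2 >= 16. *)
have pos : 0 < 2 * z - x * y.
  rewrite ltNge; apply/negP => hz.
  have h1 : 0 <= (z - y) * (x * y - z - y) by apply: mulr_ge0; lra.
  have h2 : 0 <= (x - 2) * ((y - x) * (y + x)) by rewrite !mulr_ge0//; lra.
  have h3 : x ^+ 2 * (x - 3) <= K - 2 by lra.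
  have x4 : 4 < x.
    rewrite ltNge; apply/negP => x4.
    have : 0 <= (4 - x) * (x + 4) by rewrite !mulr_ge0//; lra.
    lra.
  have : 0 <= x * x * (x - 4) by rewrite !mulr_ge0//; lra.
  lra.
have sq_ge : 1 <= (2 * z - x * y) ^+ 2.
  have : 0 <= (x ^+ 2 - (K - 2)) * (y ^+ 2 - (K - 2)) by rewrite mulr_ge0//; lra.
  have : 0 <= (K - 6) * (x ^+ 2 - (K - 2)) by rewrite mulr_ge0//; lra.
  have : 0 <= (K - 6) * (y ^+ 2 - (K - 2)) by rewrite mulr_ge0//; lra.
  have : 0 <= (K - 18) * (K + 2) by rewrite mulr_ge0//; lra.
  rewrite sqE; lra.
have gap : 1 <= 2 * z - x * y.
  rewrite leNgt; apply/negP => h.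
  have : 0 < (1 - (2 * z - x * y)) * (1 + (2 * z - x * y)) by rewrite mulr_gt0//; lra.
  lra.
have : 0 <= (x - 2) * (y - 2) by rewrite !mulr_ge0//; lra.
by move=> ?; rewrite ler_norml; apply/andP; split; lra.
Qed.

End real_inequalities.

(** * Two-sided sequences with f_{j+1} + f_{j-1} = K f_j, and their comparison *)

Section linear_recurrence.
Context {R : realType}.
Implicit Types (K : R) (f F : int -> R).

Definition recurrent K f := forall j, f (j + 1 + 1) = K * f (j + 1) - f j.

Lemma recurrent_back K f j : recurrent K f -> f (j - 1) = K * f j - f (j + 1).
Proof. by move=> rf; have := rf (j - 1); rewrite subrK => ->; ring. Qed.

Lemma recurrent_norm K f : recurrent K f -> (forall j, 0 < f j * f (j + 1)) ->
  recurrent K (fun j => `|f j|).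
Proof.
move=> rf f0 j; have := f0 (j + 1); have := f0 j; rewrite rf.
have [y0|y0] := ltP 0 (f (j + 1)).
  by rewrite pmulr_lgt0// pmulr_rgt0// => x0 z0; rewrite !gtr0_norm.
have {}y0 : f (j + 1) < 0.
  by rewrite lt_neqAle y0 andbT; apply/eqP => y00; have := f0 j; rewrite y00 mulr0 ltxx.
rewrite nmulr_lgt0// nmulr_rgt0// => x0 z0.
by rewrite !ltr0_norm// mulrN opprB opprK addrC.
Qed.

(** A monotone solution would decay geometrically in one direction, which the lower bound 2 forbids.
    The descent is on the sum of two consecutive terms: as long as there is no local minimum, the
    term uphill exceeds K - 1 times the middle one, so a step downhill loses more than 1. *)
Lemma recurrent_min K F : recurrent K F -> (forall j, 2 < F j) -> 18 <= K ->
  exists i, F (i + 1) <= F i /\ F (i + 1) <= F (i + 1 + 1).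
Proof.
move=> rF F2 K18.
pose Q (j : int) := exists i, F (i + 1) <= F i /\ F (i + 1) <= F (i + 1 + 1).
suff [j _ []] : exists2 j : int, True & Q j by move=> i; exists i.
apply: (@descent R int (fun=> True) Q (fun j => F j + F (j + 1)) 1 ltr01 _ _ 0) => //.
- by move=> j _; have := F2 j; have := F2 (j + 1); lra.
- move=> j _; have {}K18 := K18; have h0 := F2 j; have h1 := F2 (j + 1).
  have k0 : 0 <= (K - 18) * F j by rewrite mulr_ge0//; lra.
  have k1 : 0 <= (K - 18) * F (j + 1) by rewrite mulr_ge0//; lra.
  have [le|lt] := leP (F (j + 1)) (F j).
    have [le'|lt'] := leP (F (j + 1)) (F (j + 1 + 1)); first by left; exists j.
    by right; exists (j + 1) => //; move: lt'; rewrite rF; lra.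
  have [le'|lt'] := leP (F j) (F (j - 1)).
    by left; exists (j - 1); rewrite subrK; split => //; exact: ltW.
  by right; exists (j - 1) => //; rewrite subrK; move: lt'; rewrite (recurrent_back _ rF); lra.
Qed.

End linear_recurrence.

Section twist_inequality.
Context {R : realType}.
Implicit Types (a b c y K p q r s : R).

(** p and q are consecutive terms of a sequence for which the twist does not reduce K
    ([handle_bound]). Then (K - 2 + y^2) (K + 2 - a^2) is smaller than (2 K / 3 - 1) p q, which
    keeps the ratio p / q away from 1. *)
Lemma unbalanced a y K p q : 18 <= K -> 4 < a ^+ 2 -> a ^+ 2 <= K + 2 -> y ^+ 2 <= K - 2 ->
  K * (p * q) = p ^+ 2 + q ^+ 2 + (K - 2 + y ^+ 2) * (K + 2 - a ^+ 2) ->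
  2 * K - 1 + y ^+ 2 - a ^+ 2 < p * q ->
  (K / 3 + 1) * (p * q) < p ^+ 2 + q ^+ 2.
Proof.
move=> K18 a4 aK yK E pq.
have y0 := sqr_ge0 y.
have h1 : 0 < (2 * K - 3) * (p * q - (2 * K - 1 + y ^+ 2 - a ^+ 2)).
  by rewrite mulr_gt0//; lra.
(* The expression is affine in y^2 and in a^2. At the corner y^2 = K - 2, a^2 = 4 its terms in K^2
   cancel and it equals K - 3: this corner dictates the fraction K / 3. *)
have h2 : 0 <= (2 * K - 3) * (2 * K - 1 + y ^+ 2 - a ^+ 2)
   - 3 * ((K - 2 + y ^+ 2) * (K + 2 - a ^+ 2)).
  set u := y ^+ 2 in y0 yK *; set v := a ^+ 2 in a4 aK *.
  have : 0 <= (v - 4) * (K - 2 - u) by rewrite mulr_ge0//; lra.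
  have : 0 <= (v - 4) * u by rewrite mulr_ge0//; lra.
  have : 0 <= (K - 18) * u by rewrite mulr_ge0//; lra.
  have : 0 <= (K - 18) * (K - 2 - u) by rewrite mulr_ge0//; lra.
  have : 0 <= (K - 18) * (v - 4) by rewrite mulr_ge0//; lra.
  have : 0 <= (K - 18) * (K - 18) by rewrite mulr_ge0//; lra.
  lra.
lra.
Qed.

(** Let q be a local minimum of the absolute values. By [unbalanced] both neighbours exceed K q / 3,
    and they add up to K q, so both are also below 2 K q / 3. *)
Lemma min_ratio (f : int -> R) a y K : 18 <= K ->
  4 < a ^+ 2 -> a ^+ 2 <= K + 2 -> y ^+ 2 <= K - 2 ->
  recurrent K f -> (forall j, 2 < `|f j|) ->
  (forall j, K * (f j * f (j + 1)) =
     f j ^+ 2 + f (j + 1) ^+ 2 + (K - 2 + y ^+ 2) * (K + 2 - a ^+ 2)) ->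
  (forall j, 2 * K - 1 + y ^+ 2 - a ^+ 2 < f j * f (j + 1)) ->
  exists i r, [/\ f (i + 1) = r * f i, K / 3 < r & r < 2 * K / 3].
Proof.
move=> K18 a4 aK yK rf f2 fq bad.
have fpos j : 0 < f j * f (j + 1).
  by apply: lt_trans (bad j); have := sqr_ge0 y; lra.
have rF := recurrent_norm rf fpos.
have [i [h1 h2]] := recurrent_min rF f2 K18.
have un j : (K / 3 + 1) * (`|f j| * `|f (j + 1)|) < `|f j| ^+ 2 + `|f (j + 1)| ^+ 2.
  rewrite -normrM gtr0_norm// !real_normK ?num_real//.
  exact: (unbalanced K18 a4 aK yK).
have p0 := f2 i; have q0 := f2 (i + 1); have r0 := f2 (i + 1 + 1).
have key p q : 2 < q -> q <= p -> (K / 3 + 1) * (p * q) < p ^+ 2 + q ^+ 2 -> K / 3 * q < p.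
  move=> q2 qp h; have h3 : 0 <= q * (p - q) by rewrite mulr_ge0//; lra.
  have : 0 < p * (p - K / 3 * q) by lra.
  by rewrite pmulr_rgt0; lra.
have kp := key _ _ q0 h1 (un i).
have kr : K / 3 * `|f (i + 1)| < `|f (i + 1 + 1)|.
  by apply: (key _ _ q0 h2); have := un (i + 1); lra.
have E : `|f (i + 1 + 1)| = K * `|f (i + 1)| - `|f i| by exact: rF.
have q00 : f (i + 1) != 0 by rewrite -normr_gt0; lra.
have rE : f (i + 1 + 1) / f (i + 1) = `|f (i + 1 + 1)| / `|f (i + 1)|.
  rewrite -normf_div gtr0_norm// -(pmulr_lgt0 _ (x := f (i + 1) ^+ 2)).
    by rewrite expr2 mulrA divfK// mulrC.
  by rewrite exprn_even_gt0.
exists (i + 1), (f (i + 1 + 1) / f (i + 1)); split; first by rewrite divfK.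
  by rewrite rE ltr_pdivlMr//; lra.
by rewrite rE ltr_pdivrMr//; lra.
Qed.

End twist_inequality.

Section twist_inequality.
Context {R : realType}.
Implicit Types (a b c y K p q r s : R).

(** The quotient of the left side by the product on the right, before squaring, is twice the cosh of
    the phase difference of two sequences with ratios r and s. With p = r - K / 2, q = s - K / 2, P
    = K^2 / 4 - 1 it is 2 (P - p q) / sqrt ((P - p^2) (P - q^2)), at most 2 (P + m) / (P - m) for m
    = K^2 / 36. At K = 18 one has P = 80 and m = 9, which gives 178 / 71, rounded up to 251 /
    100. *)
Lemma aligned K r s : 18 <= K -> K / 3 < r -> r < 2 * K / 3 -> K / 3 < s -> s < 2 * K / 3 ->
  (K * (r + s) - 2 - 2 * (r * s)) ^+ 2 <=
  (251 / 100) ^+ 2 * ((K * r - 1 - r ^+ 2) * (K * s - 1 - s ^+ 2)).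
Proof.
move=> K18 r1 r2 s1 s2.
pose m := K ^+ 2 / 36; pose P := K ^+ 2 / 4 - 1.
pose p := r - K / 2; pose q := s - K / 2.
have -> : K * (r + s) - 2 - 2 * (r * s) = 2 * (P - p * q) by rewrite /P /p /q; field.
have -> : K * r - 1 - r ^+ 2 = P - p ^+ 2 by rewrite /P /p; field.
have -> : K * s - 1 - s ^+ 2 = P - q ^+ 2 by rewrite /P /q; field.
have Pm : 80 / 9 * m <= P.
  have : 0 <= (K - 18) * (K + 18) by rewrite mulr_ge0//; lra.
  by rewrite /m /P; lra.
have m0 : 0 <= m by have := sqr_ge0 K; rewrite /m; lra.
have pm : p ^+ 2 <= m.
  have : 0 <= (K / 6 - p) * (K / 6 + p) by rewrite mulr_ge0//; rewrite /p; lra.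
  by rewrite /m; lra.
have qm : q ^+ 2 <= m.
  have : 0 <= (K / 6 - q) * (K / 6 + q) by rewrite mulr_ge0//; rewrite /q; lra.
  by rewrite /m; lra.
have pq : `|p * q| <= m.
  rewrite ler_norml; have := sqr_ge0 (p - q); have := sqr_ge0 (p + q).
  by move=> *; apply/andP; split; lra.
clearbody p q m P; move: pq; rewrite ler_norml => /andP[pq1 pq2].
have h1 : (2 * (P - p * q)) ^+ 2 <= (251 / 100 * (P - m)) ^+ 2.
  by rewrite ler_sqr ?nnegrE; lra.
apply: le_trans h1 _; rewrite exprMn ler_pM2l; last by apply: exprn_gt0; lra.
by rewrite expr2 ler_pM//; lra.
Qed.

(** Q is K + 2, and Q c + 2 a b is, up to a common factor, the smallest value of [beta] over all
    shifts. By the inequality of arithmetic and geometric means (Q - a^2) (Q - b^2) <= h^2. If c >=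
    251 / 100 the term Q c suffices; otherwise Q <= 35, and a^2, b^2, a b, each larger than 4, make
    up the difference. *)
Lemma separated Q a b c : 2 < a -> 2 < b -> a <= c -> b <= c ->
  Q = a ^+ 2 + b ^+ 2 + c ^+ 2 + a * b * c ->
  (251 / 100) ^+ 2 * ((Q - a ^+ 2) * (Q - b ^+ 2)) < (Q * c + 2 * (a * b)) ^+ 2.
Proof.
move=> ha hb ac bc QE.
have a2 : 0 < (a - 2) * (a + 2) by rewrite mulr_gt0//; lra.
have b2 : 0 < (b - 2) * (b + 2) by rewrite mulr_gt0//; lra.
have c2 : 0 < (c - 2) * (c + 2) by rewrite mulr_gt0//; lra.
have ab2 : 0 < (a - 2) * (b - 2) by rewrite mulr_gt0//; lra.
have abc : 0 < a * b * c by rewrite !mulr_gt0//; lra.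
pose h := Q - (a ^+ 2 + b ^+ 2) / 2.
have lin : 251 / 100 * h < Q * c + 2 * (a * b).
  rewrite /h; have [hc|hc] := leP (251 / 100) c.
    have : 0 <= Q * (c - 251 / 100) by apply: mulr_ge0; lra.
    lra.
  have : 0 <= Q * (c - 2) by apply: mulr_ge0; lra.
  suff : Q <= 35 by lra.
  have : 0 <= (c - a) * (c + a) by apply: mulr_ge0; lra.
  have : 0 <= (c - b) * (c + b) by apply: mulr_ge0; lra.
  have : 0 <= (251 / 100 - c) * (251 / 100 + c) by apply: mulr_ge0; lra.
  have h1 : 0 <= (251 / 100 - a) * (b * c) by apply: mulr_ge0; [lra|apply: mulr_ge0; lra].
  have h2 : 0 <= (251 / 100 - b) * c by apply: mulr_ge0; lra.
  lra.
have h0 : 0 < h by rewrite /h; lra.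
apply: (@le_lt_trans _ _ ((251 / 100 * h) ^+ 2)); last by rewrite ltr_sqr// nnegrE; lra.
rewrite [leRHS]exprMn ler_pM2l; last by apply: exprn_gt0; lra.
have := sqr_ge0 (a ^+ 2 - b ^+ 2); rewrite /h; lra.
Qed.

(* beta f i (f j) is, up to a positive constant, cosh of the distance between
   the phases of the two sequences, hence the invariance under a common shift. *)
Definition beta K (f g : int -> R) (i j : int) : R :=
  K * (f i * g (j + 1) + f (i + 1) * g j) - 2 * (f i * g j) - 2 * (f (i + 1) * g (j + 1)).

Lemma beta_shift K (f g : int -> R) i j : recurrent K f -> recurrent K g ->
  beta K f g (i + 1) (j + 1) = beta K f g i j.
Proof. by move=> rf rg; rewrite /beta rf rg; ring. Qed.

Lemma beta_diff K (f g : int -> R) i j : recurrent K f -> recurrent K g ->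
  beta K f g i j = beta K f g 0 (j - i).
Proof.
move=> rf rg; elim/int_rec: i j => [|n IHn|n IHn] j; first by rewrite subr0.
  by rewrite -{1}(subrK 1 j) -addn1 PoszD beta_shift// IHn; congr (beta _ _ _ _ _); ring.
rewrite -(beta_shift _ _ rf rg) -addn1 PoszD opprD subrK IHn.
by congr (beta _ _ _ _ _); ring.
Qed.

(** In the second argument [beta] solves the recurrence again. The hypotheses give w(-2) >= w(-1) <=
    w(0) <= w(1), and a non-negative solution that starts to grow keeps growing, in both
    directions. *)
Lemma beta_ge K (f g : int -> R) k : recurrent K f -> recurrent K g -> 2 <= K ->
  0 <= beta K f g 0 (-1) -> beta K f g 0 (-1) <= beta K f g 0 0 ->
  beta K f g 0 0 <= (K - 1) * beta K f g 0 (-1) ->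
  beta K f g 0 (-1) <= beta K f g 0 k.
Proof.
move=> rf rg K2 w0; pose w := beta K f g 0; rewrite -!/(w _) in w0 *.
have rw : recurrent K w by move=> j; rewrite /w /beta !rg; ring.
have up (u : nat -> R) : (forall n, u n.+2 = K * u n.+1 - u n) -> 0 <= u 0 -> u 0 <= u 1 ->
    forall n, u 0 <= u n.
  move=> ru u0 u1 n; suff : u 0 <= u n /\ u n <= u n.+1 by case.
  elim: n => [//|n [h1 h2]]; split; first exact: le_trans h1 h2.
  have h3 : 0 <= (K - 2) * u n.+1 by rewrite mulr_ge0//; lra.
  by rewrite ru; lra.
move=> h1 h2; case: k => n.
  apply: (le_trans h1); apply: (up (fun n => w n%:Z)) => [m||].
  - by have := rw m%:Z; rewrite -!PoszD !addn1.
  - exact: le_trans w0 h1.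
  - have hK : 0 <= (K - 2) * w 0 by rewrite mulr_ge0//; [lra|exact: le_trans h1].
    suff : w 0 <= w 1 by []; have := rw (-1); rewrite addNr add0r => ->; lra.
rewrite NegzE; apply: (up (fun n => w (- n.+1%:Z))) => [m|//|].
- have := rw (- m.+3%:Z); rewrite (_ : - m.+3%:Z + 1 = - m.+2%:Z); last by lia.
  by rewrite (_ : - m.+2%:Z + 1 = - m.+1%:Z); [move=> ->; ring|lia].
- have := rw (- 2%:Z); rewrite (_ : - 2%:Z + 1 = -1)// addNr => e; suff : w (-1) <= w (- 2%:Z) by []; lra.
Qed.

(** f and g belong to two boundary curves, of traces a and b, of a pair of pants whose third trace
    is -c. If no twist reduces K, then [min_ratio] and [aligned] make [beta] small at the local
    minima i and j of the two sequences, while [beta_ge] bounds it below by its value at shift -1,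
    which is too large by [separated]. *)
Lemma twist_contradiction (f g : int -> R) K y a b c : 18 <= K ->
  2 < a -> 2 < b -> a <= c -> b <= c ->
  K + 2 = a ^+ 2 + b ^+ 2 + c ^+ 2 + a * b * c ->
  4 < y ^+ 2 -> y ^+ 2 <= K - 2 ->
  recurrent K f -> recurrent K g -> (forall j, 2 < `|f j|) -> (forall j, 2 < `|g j|) ->
  (forall j, K * (f j * f (j + 1)) =
     f j ^+ 2 + f (j + 1) ^+ 2 + (K - 2 + y ^+ 2) * (K + 2 - a ^+ 2)) ->
  (forall j, K * (g j * g (j + 1)) =
     g j ^+ 2 + g (j + 1) ^+ 2 + (K - 2 + y ^+ 2) * (K + 2 - b ^+ 2)) ->
  beta K f g 0 0 = (K - 2 + y ^+ 2) * ((K + 2) * c + K * (a * b)) ->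
  beta K f g 0 (-1) = (K - 2 + y ^+ 2) * ((K + 2) * c + 2 * (a * b)) ->
  (forall j, 2 * K - 1 + y ^+ 2 - a ^+ 2 < f j * f (j + 1)) ->
  (forall j, 2 * K - 1 + y ^+ 2 - b ^+ 2 < g j * g (j + 1)) -> False.
Proof.
move=> K18 a2 b2 ac bc KE y4 yK rf rg f2 g2 fq gq w0 w1 badf badg.
have a4 : 0 < (a - 2) * (a + 2) by rewrite mulr_gt0//; lra.
have b4 : 0 < (b - 2) * (b + 2) by rewrite mulr_gt0//; lra.
have abc : 0 < a * b * c by rewrite !mulr_gt0//; lra.
have ab0 : 0 < a * b by rewrite !mulr_gt0//; lra.
have c0 := sqr_ge0 c.
have [||i [r [fi r1 r2]]] := min_ratio (a := a) K18 _ _ yK rf f2 fq badf; [lra|lra|].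
have [||j [s [gj s1 s2]]] := min_ratio (a := b) K18 _ _ yK rg g2 gq badg; [lra|lra|].
pose G := K - 2 + y ^+ 2.
have G0 : 0 < G by rewrite /G; lra.
have [K20 K21] : 0 < K - 2 /\ 0 < K + 2 by split; lra.
have c0' : 0 < c by apply: lt_le_trans ac; lra.
have Kc := mulr_gt0 K21 c0'.
have Kab0 := mulr_gt0 K20 ab0; have Kab1 := mulr_gt0 K20 Kc.
have Gab := mulr_gt0 G0 ab0; have GKab := mulr_gt0 G0 Kab0; have GKc := mulr_gt0 G0 Kab1.
have GS : 0 <= G * ((K + 2) * c + 2 * (a * b)).
  by apply: mulr_ge0; [exact: ltW|move: Kc ab0; clear; lra].
have le_w : beta K f g 0 (-1) <= beta K f g i j.
  rewrite (beta_diff i j rf rg); apply: beta_ge => //; rewrite ?w0 ?w1 -/G //; first by lra.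
  - by move: GKab; clear; lra.
  - by move: GKab GKc; clear; lra.
have low : (G * ((K + 2) * c + 2 * (a * b))) ^+ 2 <= beta K f g i j ^+ 2.
  have w0' : 0 <= beta K f g 0 (-1) by rewrite w1.
  by rewrite -/G in w1; rewrite -w1 ler_sqr ?nnegrE//; exact: le_trans le_w.
have wE : beta K f g i j = f i * g j * (K * (r + s) - 2 - 2 * (r * s)).
  by rewrite /beta fi gj; ring.
have fE : f i ^+ 2 * (K * r - 1 - r ^+ 2) = G * (K + 2 - a ^+ 2).
  by have := fq i; rewrite fi -/G; clear; lra.
have gE : g j ^+ 2 * (K * s - 1 - s ^+ 2) = G * (K + 2 - b ^+ 2).
  by have := gq j; rewrite gj -/G; clear; lra.
have al := aligned K18 r1 r2 s1 s2.
have up : beta K f g i j ^+ 2 <=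
    G ^+ 2 * ((251 / 100) ^+ 2 * ((K + 2 - a ^+ 2) * (K + 2 - b ^+ 2))).
  have : (f i * g j) ^+ 2 * (K * (r + s) - 2 - 2 * (r * s)) ^+ 2 <= (f i * g j) ^+ 2 *
    ((251 / 100) ^+ 2 * ((K * r - 1 - r ^+ 2) * (K * s - 1 - s ^+ 2))).
    by rewrite ler_wpM2l// sqr_ge0.
  rewrite -exprMn -wE => /le_trans; apply.
  rewrite [leLHS](_ : _ = (251 / 100) ^+ 2 * ((f i ^+ 2 * (K * r - 1 - r ^+ 2)) *
    (g j ^+ 2 * (K * s - 1 - s ^+ 2)))); last by ring.
  by rewrite fE gE; clear; lra.
move: low; rewrite exprMn => /le_trans/(_ up); rewrite ler_pM2l ?exprn_gt0//.
by rewrite leNgt (separated a2 b2 ac bc KE).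
Qed.

End twist_inequality.

(** * Traces in SL(2, R) *)

Section matrix2.
Context {R : comPzRingType}.
Implicit Types X Y P Q : 'M[R]_2.

Lemma mxtrace2 X : \tr X = X 0 0 + X 1 1.
Proof. by rewrite /mxtrace !big_ord_recl big_ord0 addr0; congr (_ + X _ _); apply: val_inj. Qed.

Lemma mulmx2 X Y i j : (X *m Y) i j = X i 0 * Y 0 j + X i 1 * Y 1 j.
Proof.
rewrite mxE !big_ord_recl big_ord0 addr0.
by congr (_ + X _ _ * Y _ _); apply: val_inj.
Qed.

Lemma det2 X : \det X = X 0 0 * X 1 1 - X 0 1 * X 1 0.
Proof.
rewrite (expand_det_row _ 0) !big_ord_recl big_ord0 addr0 /cofactor !det_mx11 !mxE /=.
rewrite expr0 expr1 mul1r mulN1r mulrN; congr (_ * X _ _ - X _ _ * X _ _); exact: val_inj.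
Qed.

Lemma matrix2P X Y : X 0 0 = Y 0 0 -> X 0 1 = Y 0 1 -> X 1 0 = Y 1 0 -> X 1 1 = Y 1 1 -> X = Y.
Proof.
move=> h00 h01 h10 h11; apply/matrixP.
suff E (i : 'I_2) : i = 0 \/ i = 1.
  by move=> i j; case: (E i) => ->; case: (E j) => ->.
by case: i => [[|[|//]]] hi; [left|right]; apply: val_inj.
Qed.

Lemma Cayley_Hamilton2 X : X *m ((\tr X)%:M - X) = (\det X)%:M.
Proof.
by apply: matrix2P; rewrite mulmx2 !mxE mxtrace2 det2 /= ?mulr1n ?mulr0n; ring.
Qed.

(** With [Fricke_product]: tr (XPQ) and tr (XQP) are the two roots of a quadratic equation whose
    coefficients are polynomials in the other traces and the determinants. *)
Lemma Fricke_sum X P Q : \tr (X *m P *m Q) + \tr (X *m Q *m P) =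
  \tr X * \tr (P *m Q) + \tr P * \tr (X *m Q) + \tr Q * \tr (X *m P) - \tr X * \tr P * \tr Q.
Proof. by rewrite !mxtrace2 !mulmx2; ring. Qed.

Lemma Fricke_product X P Q : \tr (X *m P *m Q) * \tr (X *m Q *m P) =
  (\tr X) ^+ 2 * \det P * \det Q + (\tr P) ^+ 2 * \det X * \det Q +
  (\tr Q) ^+ 2 * \det X * \det P + (\tr (X *m P)) ^+ 2 * \det Q +
  (\tr (X *m Q)) ^+ 2 * \det P + (\tr (P *m Q)) ^+ 2 * \det X
  - \tr X * \tr P * \tr (X *m P) * \det Q - \tr X * \tr Q * \tr (X *m Q) * \det P
  - \tr P * \tr Q * \tr (P *m Q) * \det X
  + \tr (X *m P) * \tr (X *m Q) * \tr (P *m Q) - 4 * \det X * \det P * \det Q.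
Proof. by rewrite !mxtrace2 !mulmx2 !det2; ring. Qed.

Lemma det_add2 X Y : \det (X + Y) = \det X + \det Y + \tr X * \tr Y - \tr (X *m Y).
Proof. by rewrite !det2 !mxtrace2 !mulmx2 !mxE; ring. Qed.

(** Elimination of tr (XQP) between [Fricke_sum] and [Fricke_product]. The determinant of X is kept
    as a variable so that the identity is homogeneous of degree two in X and can be polarized. *)
Lemma four_holed_sphere X P Q y K :
  \det P = 1 -> \det Q = 1 -> \tr P = y -> \tr Q = y -> \tr (P *m Q) = - K ->
  \tr (X *m P *m Q) = - \tr X ->
  K * (\tr (X *m Q) * \tr (X *m P)) = (\tr (X *m Q)) ^+ 2 + (\tr (X *m P)) ^+ 2
    + (K - 2 + y ^+ 2) * ((K + 2) * \det X - (\tr X) ^+ 2).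
Proof.
move=> dP dQ tP tQ tPQ tX.
have := Fricke_product X P Q; have := Fricke_sum X P Q.
rewrite dP dQ tP tQ tPQ tX => s p.
have e : \tr (X *m Q *m P) = \tr X + \tr X * (- K) + y * \tr (X *m Q) + y * \tr (X *m P)
  - \tr X * y * y by rewrite -[LHS](addKr (- \tr X)) s; ring.
move: p; rewrite e => /eqP; rewrite -subr_eq0 => /eqP p.
apply/eqP; rewrite -subr_eq0; apply/eqP; rewrite -[RHS]p; ring.
Qed.

(* four_holed_sphere is quadratic in X: this is its polarization. *)
Lemma four_holed_sphere_polar X Y P Q y K :
  \det P = 1 -> \det Q = 1 -> \tr P = y -> \tr Q = y -> \tr (P *m Q) = - K ->
  \tr (X *m P *m Q) = - \tr X -> \tr (Y *m P *m Q) = - \tr Y ->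
  K * (\tr (X *m Q) * \tr (Y *m P) + \tr (X *m P) * \tr (Y *m Q))
    - 2 * (\tr (X *m Q) * \tr (Y *m Q)) - 2 * (\tr (X *m P) * \tr (Y *m P)) =
  (K - 2 + y ^+ 2) * ((K + 2) * (\tr X * \tr Y - \tr (X *m Y)) - 2 * (\tr X * \tr Y)).
Proof.
move=> dP dQ tP tQ tPQ tX tY.
have hX := four_holed_sphere dP dQ tP tQ tPQ tX.
have hY := four_holed_sphere dP dQ tP tQ tPQ tY.
have : \tr ((X + Y) *m P *m Q) = - \tr (X + Y) by rewrite !mulmxDl !mxtraceD tX tY; ring.
move/(four_holed_sphere dP dQ tP tQ tPQ); rewrite !mulmxDl !mxtraceD det_add2.
set a := \tr (X *m Q) in hX *; set b := \tr (X *m P) in hX *.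
set c := \tr (Y *m Q) in hY *; set d := \tr (Y *m P) in hY *.
move=> h; have -> : K * (a * d + b * c) = K * ((a + c) * (b + d)) - K * (a * b) - K * (c * d)
  by ring.
by rewrite h hX hY; ring.
Qed.

End matrix2.

(* Locked, so that ring and lra compare traces of words syntactically. *)
HB.lock Definition tr (R : realType) (A : SL2 R) : R := \tr (val A).

Lemma trE (R : realType) (A : SL2 R) : tr A = \tr (val A).
Proof. by rewrite tr.unlock. Qed.

Section SL2_group.
Context (R : realType).

Lemma SL2_mulA : associative (@SL2_mul R).
Proof. by move=> A B C; apply: val_inj; rewrite /= mulmxA. Qed.

Lemma SL2_mul1 : left_id (@SL2_one R) (@SL2_mul R).
Proof. by move=> A; apply: val_inj; rewrite /= mul1mx. Qed.

Lemma SL2_mulr1 : right_id (@SL2_one R) (@SL2_mul R).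
Proof. by move=> A; apply: val_inj; rewrite /= mulmx1. Qed.

Lemma SL2_mulV : left_inverse (@SL2_one R) (@SL2_inv R) (@SL2_mul R).
Proof. by move=> A; apply: val_inj; rewrite /= mulVmx// SL2_unit. Qed.

Lemma SL2_mulrV : right_inverse (@SL2_one R) (@SL2_inv R) (@SL2_mul R).
Proof. by move=> A; apply: val_inj; rewrite /= mulmxV// SL2_unit. Qed.

HB.instance Definition _ := isGroup.Build (SL2 R)
  SL2_mulA SL2_mul1 SL2_mulr1 SL2_mulV SL2_mulrV.

Lemma SL2_opp_subproof (A : SL2 R) : \det (- val A) == 1.
Proof. by rewrite -scaleN1r detZ SL2_det mulr1 sqrrN expr1n. Qed.

Definition SL2_opp (A : SL2 R) : SL2 R :=
  exist (fun M : 'M[R]_2 => \det M == 1) _ (SL2_opp_subproof A).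

Implicit Types A B C D X : SL2 R.

Lemma val_SL2M A B : val (A * B)%g = val A *m val B.
Proof. by []. Qed.

Lemma val_SL2V A : val (A^-1)%g = (tr A)%:M - val A.
Proof.
rewrite tr.unlock -[RHS](mulKmx (SL2_unit A)) Cayley_Hamilton2 SL2_det mulmx1.
by [].
Qed.

Lemma SL2_oppK : involutive SL2_opp.
Proof. by move=> A; apply: val_inj; rewrite /= opprK. Qed.

Lemma SL2_mulNg A B : (SL2_opp A * B)%g = SL2_opp (A * B)%g.
Proof. by apply: val_inj; rewrite /= mulNmx. Qed.

Lemma SL2_mulgN A B : (A * SL2_opp B)%g = SL2_opp (A * B)%g.
Proof. by apply: val_inj; rewrite /= mulmxN. Qed.

Lemma SL2_invN A : ((SL2_opp A)^-1)%g = SL2_opp (A^-1)%g.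
Proof. by apply: (mulgI (SL2_opp A)); rewrite mulgV SL2_mulNg SL2_mulgN SL2_oppK mulgV. Qed.

Lemma tr_mulC A B : tr (A * B)%g = tr (B * A)%g.
Proof. by rewrite tr.unlock !val_SL2M mxtrace_mulC. Qed.

Lemma trN A : tr (SL2_opp A) = - tr A.
Proof. by rewrite tr.unlock raddfN. Qed.

Lemma trV A : tr (A^-1)%g = tr A.
Proof. by rewrite {1}tr.unlock val_SL2V raddfB /= mxtrace_scalar -mulr_natr tr.unlock; ring. Qed.

Lemma tr1 : tr 1%g = 2.
Proof. by rewrite tr.unlock mxtrace1. Qed.

Lemma tr_mulV A B : tr (A * B^-1)%g = tr A * tr B - tr (A * B)%g.
Proof.
by rewrite trE val_SL2M val_SL2V mulmxBr raddfB /= mul_mx_scalar mxtraceZ mulrC !trE.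
Qed.

Lemma tr_conj A B : tr (A * B * A^-1)%g = tr B.
Proof. by rewrite tr_mulC mulgA mulVg mul1g. Qed.

Definition comm {G : groupType} (x y : G) : G := (x * y * x^-1 * y^-1)%g.

Lemma tr_comm A B : tr (comm A B) =
  tr A ^+ 2 + tr B ^+ 2 + tr (A * B)%g ^+ 2 - tr A * tr B * tr (A * B)%g - 2.
Proof.
rewrite /comm tr_mulV tr_conj.
have -> : tr (A * B * A^-1 * B)%g = tr (B * A * B * A^-1)%g by rewrite tr_mulC !mulgA.
rewrite tr_mulV; have := tr_mulV (B * A)%g B; rewrite tr_conj.
have := tr_mulV (B * A)%g (B * A)^-1%g; rewrite invgK trV mulgV tr1 mulgA.
by rewrite (tr_mulC B A) => e1 e2; have -> : tr (B * A * B)%g = tr (A * B)%g * tr B - tr A; lra.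
Qed.
End SL2_group.

(** * The descent on tr [A, B] *)

Section orbit.
Context (R : realType).
Local Notation G := (SL2 R).

(** This isolates from the topology what the descent uses. [orbit_slide] and [orbit_handle] come
    from the Dehn twists about b and d^-1 a, [orbit_reflect] and [orbit_swap] from symmetries of the
    octagon, and [orbit_opp] is a change of lift. *)
Record hyperbolic_orbit (O : G -> G -> G -> G -> Prop) : Prop := {
  orbit_rel : forall a b c d, O a b c d -> (comm a b * comm c d)%g = SL2_opp 1%g;
  orbit_slide : forall a b c d, O a b c d -> O (a * b)%g b c d;
  orbit_slideV : forall a b c d, O a b c d -> O (a * b^-1)%g b c d;
  orbit_reflect : forall a b c d, O a b c d -> O b a d c;
  orbit_swap : forall a b c d, O a b c d -> O c d a b;
  orbit_handle : forall a b c d, O a b c d -> O a (d^-1 * a * b)%g (d^-1 * a * c)%g d;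
  orbit_opp : forall a b c d, O a b c d -> O (SL2_opp a) b c d;
  orbit_tr : forall a b c d, O a b c d -> 2 < `|tr a|;
  orbit_tr_comm : forall a b c d, O a b c d -> 2 < `|tr (comm a b)|;
  orbit_tr_bridge : forall a b c d, O a b c d -> 2 < `|tr (d^-1 * a)%g|
}.

Lemma commN (a b : G) : comm (SL2_opp a) b = comm a b.
Proof. by rewrite /comm SL2_invN !(SL2_mulNg, SL2_mulgN) SL2_oppK. Qed.

Lemma commNr (a b : G) : comm a (SL2_opp b) = comm a b.
Proof. by rewrite /comm SL2_invN !(SL2_mulNg, SL2_mulgN) SL2_oppK. Qed.

Lemma comm_slide (a b : G) : comm (a * b)%g b = comm a b.
Proof. by rewrite /comm invgM !mulgA mulgK. Qed.

Lemma comm_slideV (a b : G) : comm (a * b^-1)%g b = comm a b.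
Proof. by rewrite /comm invgM invgK !mulgA mulgVK. Qed.

Lemma comm_rot (a b : G) : comm (a * b)%g a^-1 = comm a b.
Proof. by rewrite /comm invgM invgK !mulgA mulgVK. Qed.

Lemma comm_rotV (a b : G) : comm b^-1%g (b * a)%g = comm a b.
Proof. by rewrite /comm invgM invgK !mulgA mulVg mul1g. Qed.

Section closure.
Context (O : G -> G -> G -> G -> Prop) (HO : hyperbolic_orbit O).
Implicit Types a b c d : G.

Lemma orbit_rot a b c d : O a b c d -> O (a * b)%g a^-1%g c d.
Proof.
move/(orbit_slide HO)/(orbit_reflect HO)/(orbit_slideV HO)/(orbit_reflect HO).
by rewrite invgM mulgA mulgV mul1g.
Qed.

Lemma orbit_rotV a b c d : O a b c d -> O b^-1%g (b * a)%g c d.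
Proof.
move/(orbit_reflect HO)/(orbit_slide HO)/(orbit_reflect HO)/(orbit_slideV HO).
by rewrite invgM mulgA mulgV mul1g.
Qed.

Lemma orbit_oppr a b c d : O a b c d -> O a (SL2_opp b) c d.
Proof. by move/(orbit_reflect HO)/(orbit_opp HO)/(orbit_reflect HO). Qed.

Lemma orbit_tr2 a b c d : O a b c d -> 2 < `|tr b|.
Proof. by move/(orbit_reflect HO)/(orbit_tr HO). Qed.

Lemma orbit_trM a b c d : O a b c d -> 2 < `|tr (a * b)%g|.
Proof. by move/(orbit_slide HO)/(orbit_tr HO). Qed.

Definition tr_norm (p : G * G) : R := `|tr p.1| + `|tr p.2| + `|tr (p.1 * p.2)%g|.
Definition tr_prod (p : G * G) : R := tr p.1 * tr p.2 * tr (p.1 * p.2)%g.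

(** The move (a, b) -> (a b, a^-1) fixes [a, b] and permutes the traces of a, b, a b cyclically, so
    that any of the three can be brought to the last place. *)
Lemma markov_sort c d (e : G) p : O p.1 p.2 c d -> comm p.1 p.2 = e ->
  exists q, [/\ O q.1 q.2 c d, comm q.1 q.2 = e, tr_norm q = tr_norm p,
    tr_prod q = tr_prod p & `|tr q.1| <= `|tr (q.1 * q.2)%g| /\ `|tr q.2| <= `|tr (q.1 * q.2)%g| ].
Proof.
have rotE (q : G * G) : O q.1 q.2 c d -> comm q.1 q.2 = e -> exists q',
   [/\ O q'.1 q'.2 c d, comm q'.1 q'.2 = e, tr_norm q' = tr_norm q, tr_prod q' = tr_prod q &
    [/\ tr q'.1 = tr (q.1 * q.2)%g, tr q'.2 = tr q.1 & tr (q'.1 * q'.2)%g = tr q.2]].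
  move=> Oq eq; exists (q.1 * q.2, q.1^-1)%g.
  rewrite /tr_norm /tr_prod /= trV tr_conj comm_rot; split => //; first exact: orbit_rot.
    by ring.
  by ring.
move=> Op ep.
have [q [Oq eq Nq Pq [q1 q2 q3]]] := rotE p Op ep.
have [r [Or er Nr Pr [r1 r2 r3]]] := rotE q Oq eq.
have [h1|h1] := leP `|tr p.1| `|tr (p.1 * p.2)%g|.
  have [h2|h2] := leP `|tr p.2| `|tr (p.1 * p.2)%g|; first by exists p.
  exists q; split => //; rewrite q1 q2 q3; split; first exact: ltW.
  exact/ltW/(le_lt_trans h1).
have [h2|h2] := leP `|tr p.2| `|tr p.1|.
  exists r; split; rewrite ?Nr ?Pr ?Nq ?Pq//.
  by rewrite r1 r2 r3 q1 q2 q3; split => //; exact: ltW.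
exists q; split => //; rewrite q1 q2 q3; split; apply: ltW => //.
exact: lt_trans h2.
Qed.

Lemma norm_prod_sub (x y z : R) : 0 < x * y * z -> `|x * y - z| = `| `|x| * `|y| - `|z| |.
Proof.
move=> h; rewrite -normrM; have [z0|z0|z0] := ltrgt0P z.
- by move: h; rewrite pmulr_lgt0// => h; rewrite (gtr0_norm h).
- by move: h; rewrite nmulr_lgt0// => h; rewrite (ltr0_norm h) opprK -normrN opprB addrC.
- by move: h; rewrite z0 mulr0 ltxx.
Qed.

Lemma sqr_normr (x : R) : `|x| ^+ 2 = x ^+ 2.
Proof. by rewrite real_normK ?num_real. Qed.

(** Replacing a by a b^-1 turns the triple of traces (x, y, z) into (x y - z, y, x). The sign
    condition allows x y - z to be computed from absolute values. *)
Lemma markov_step c d (e : G) p (eps : R) : O p.1 p.2 c d -> comm p.1 p.2 = e ->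
  0 < tr_prod p -> `| `|tr p.1| * `|tr p.2| - `|tr (p.1 * p.2)%g| | <= `|tr (p.1 * p.2)%g| - eps ->
  exists2 q, O q.1 q.2 c d /\ comm q.1 q.2 = e & tr_norm q <= tr_norm p - eps.
Proof.
move=> Op ep pos; rewrite -norm_prod_sub// => h.
exists (p.1 * p.2^-1, p.2)%g; first by rewrite /= comm_slideV; split => //; exact: orbit_slideV.
rewrite /tr_norm /= mulgVK tr_mulV; lra.
Qed.

(** As long as the product of the three traces is positive, a Vieta jump decreases the sum of their
    absolute values by at least min (1, K - 2). So the reduction stops at a negative product, the
    sign pattern of a pair of pants bounded by a', b' and a' b'; changes of lift then make the first
    two traces positive. *)
Lemma pants_pos a b c d K : O a b c d -> tr (comm a b) = K -> 2 < K ->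
  exists a' b', [/\ O a' b' c d, comm a' b' = comm a b, 2 < tr a' /\ 2 < tr b',
    tr (a' * b')%g < -2 & tr a' <= - tr (a' * b')%g /\ tr b' <= - tr (a' * b')%g].
Proof.
move=> h0 K0 K2.
pose P p := O p.1 p.2 c d /\ comm p.1 p.2 = comm a b.
have [||||] := @descent R (G * G) P (fun p => tr_prod p < 0) tr_norm (Num.min 1 (K - 2)) _ _ _ (a, b).
- by rewrite lt_min ltr01 subr_gt0.
- by move=> p _; rewrite /tr_norm !addr_ge0.
- move=> p [Op ep]; have [neg|pos|z] := ltrgt0P (tr_prod p).
  + right; have [q [Oq eq <- Pq [q1 q2]]] := markov_sort Op ep.
    apply: (markov_step Oq eq); rewrite ?Pq//.
    apply: markov_gap_pos => //; rewrite ?(orbit_tr HO Oq) ?(orbit_tr2 Oq)//.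
    rewrite -K0 -eq tr_comm !sqr_normr -!normrM gtr0_norm//.
    by move: neg; rewrite -Pq.
  + by left.
  + move/eqP: z; rewrite /tr_prod !mulf_eq0 -!orbA => /or3P[]/eqP z.
    - by have := orbit_tr HO Op; rewrite z normr0; lra.
    - by have := orbit_tr2 Op; rewrite z normr0; lra.
    - by have := orbit_trM Op; rewrite z normr0; lra.
- by split.
move=> p [Op ep] neg.
have [q [Oq eq _ Pq [q1 q2]]] := markov_sort Op ep.
rewrite -Pq in neg.
have [a' [Oa ea an am ap]] : exists a', [/\ O a' q.2 c d, comm a' q.2 = comm a b, tr a' = `|tr q.1|,
    `|tr (a' * q.2)%g| = `|tr (q.1 * q.2)%g| & tr a' * tr (a' * q.2)%g = tr q.1 * tr (q.1 * q.2)%g].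
  have [x0|x0] := leP 0 (tr q.1); first by exists q.1; rewrite ger0_norm.
  exists (SL2_opp q.1); rewrite commN SL2_mulNg !trN mulrNN normrN ltr0_norm//.
  by split=> //; exact: (orbit_opp HO).
have [b' [Ob eb bn bm bp]] : exists b', [/\ O a' b' c d, comm a' b' = comm a b, tr b' = `|tr q.2|,
    `|tr (a' * b')%g| = `|tr (a' * q.2)%g| & tr b' * tr (a' * b')%g = tr q.2 * tr (a' * q.2)%g].
  have [x0|x0] := leP 0 (tr q.2); first by exists q.2; rewrite ger0_norm.
  exists (SL2_opp q.2); rewrite commNr SL2_mulgN !trN mulrNN normrN ltr0_norm//.
  by split=> //; exact: orbit_oppr.
have a2 : 2 < tr a' by rewrite an (orbit_tr HO Oq).
have b2 : 2 < tr b' by rewrite bn (orbit_tr2 Oq).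
have m2 := orbit_trM Ob.
have neg' : tr (a' * b')%g < 0.
  have : tr a' * (tr b' * tr (a' * b')%g) < 0.
    by rewrite bp mulrCA ap mulrCA mulrA -/(tr_prod q).
  by rewrite !pmulr_rlt0//; lra.
rewrite ltr0_norm// in m2; exists a', b'; split => //; first by lra.
by rewrite an bn -(ltr0_norm neg') bm am.
Qed.

(** With x, y, z the traces of a, b, a b, one has x y z = x^2 + y^2 + z^2 + K - 2 > 0, so the sign
    never obstructs a jump. The reduction stops only when one of the two smaller traces has square
    at most K - 2. *)
Lemma short_curve a b c d K : O a b c d -> tr (comm a b) = - K -> 18 <= K ->
  exists a' b', [/\ O a' b' c d, comm a' b' = comm a b & tr b' ^+ 2 <= K - 2].
Proof.
move=> h0 K0 K18.
pose P p := O p.1 p.2 c d /\ comm p.1 p.2 = comm a b.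
pose Q (p : G * G) := exists a' b', [/\ O a' b' c d, comm a' b' = comm a b & tr b' ^+ 2 <= K - 2].
suff [] : exists2 p, P p & Q p by [].
apply: (@descent R (G * G) P Q tr_norm 1 ltr01 _ _ (a, b)) => //.
  by move=> p _; rewrite /tr_norm !addr_ge0.
move=> p [Op ep]; have [q [Oq eq Nq Pq [q1 q2]]] := markov_sort Op ep.
have [s1|s1] := leP (tr q.1 ^+ 2) (K - 2).
  left; exists (q.1 * q.2)%g, q.1^-1%g; rewrite comm_rot trV; split => //.
  exact: orbit_rot.
have [s2|s2] := leP (tr q.2 ^+ 2) (K - 2); first by left; exists q.1, q.2.
have qE : tr (comm q.1 q.2) = - K by rewrite eq.
have pos : 0 < tr_prod q.
  have := sqr_ge0 (tr (q.1 * q.2)%g); move: qE; rewrite tr_comm /tr_prod; lra.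
right; rewrite -Nq; apply: (markov_step Oq eq pos).
apply: (@markov_gap_neg _ _ _ _ K); rewrite ?(orbit_tr HO Oq) ?(orbit_tr2 Oq) ?sqr_normr//.
by rewrite -qE tr_comm -!normrM gtr0_norm.
Qed.

End closure.
End orbit.

Definition int_iter (T : Type) (s s' : T -> T) (x : T) (j : int) : T :=
  match j with Posz n => iter n s x | Negz n => iter n.+1 s' x end.

Lemma int_iterS T (s s' : T -> T) x j : cancel s' s ->
  int_iter s s' x (j + 1) = s (int_iter s s' x j).
Proof.
move=> sK; case: j => n; first by rewrite (_ : Posz n + 1 = Posz n.+1)//; lia.
case: n => [|n]; first by rewrite /= sK.
rewrite (_ : Negz n.+1 + 1 = Negz n); first by rewrite /= sK.
by rewrite !NegzE; lia.
Qed.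

(** * Half twists of the second handle, and the descent step *)

Section orbit.
Context (R : realType).
Local Notation G := (SL2 R).
Implicit Types x y : G.

(* In the application e = [c, d] is the commutator of the second handle, p = c d c^-1 and
   q = d^-1, or their images by a half twist, and x, z belong to the first handle. *)
Section shift.
Context (e p q : G) (y K : R).
Hypotheses (pq : (p * q)%g = e) (te : tr e = - K) (tp : tr p = y) (tq : tr q = y).

Lemma shift_relation x : tr (x * e)%g = - tr x ->
  K * (tr (x * q)%g * tr (x * p)%g) = tr (x * q)%g ^+ 2 + tr (x * p)%g ^+ 2
    + (K - 2 + y ^+ 2) * (K + 2 - tr x ^+ 2).
Proof.
move=> xe.
have := @four_holed_sphere _ (val x) (val p) (val q) y K.
rewrite !SL2_det mulr1 -!val_SL2M -mulgA pq -!trE; exact.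
Qed.

Lemma shift_polar x z : tr (x * e)%g = - tr x -> tr (z * e)%g = - tr z ->
  K * (tr (x * q)%g * tr (z * p)%g + tr (x * p)%g * tr (z * q)%g)
    - 2 * (tr (x * q)%g * tr (z * q)%g) - 2 * (tr (x * p)%g * tr (z * p)%g) =
  (K - 2 + y ^+ 2) * ((K + 2) * (tr x * tr z - tr (x * z)%g) - 2 * (tr x * tr z)).
Proof.
move=> xe ze.
have := @four_holed_sphere_polar _ (val x) (val z) (val p) (val q) y K.
rewrite !SL2_det -!val_SL2M -!mulgA pq -!trE; exact.
Qed.

(** If q and p are consecutive terms Y_j and Y_{j+1} of a sequence with Y_{j+1} Y_j = e, then e p^-1
    is Y_{j+2}. *)
Lemma shift_recurrent x : tr (x * e)%g = - tr x ->
  tr (x * (e * p^-1))%g = K * tr (x * p)%g - tr (x * q)%g.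
Proof.
move=> xe.
have := Fricke_sum (val x) (val e) (val p^-1%g); rewrite -!val_SL2M -!trE.
have -> : (x * p^-1 * e = x * q)%g by rewrite -pq -mulgA mulKg.
have -> : tr (e * p^-1)%g = y by rewrite -pq tr_conj.
rewrite (tr_mulV x p) trV te tp xe => h.
by apply: (addIr (tr (x * q)%g)); rewrite mulgA h; ring.
Qed.

(** The trace of q x p x can be computed in two ways: from (q x p) x^-1, and from (x q) (x p)^-1,
    which is conjugate to q p^-1. *)
Lemma handle_relation x : tr (x * e)%g = - tr x ->
  tr (x * p * x^-1 * q)%g = K + y ^+ 2 - tr x ^+ 2 - tr (x * q)%g * tr (x * p)%g.
Proof.
move=> xe.
have -> : tr (x * p * x^-1 * q)%g = tr (q * (x * p) * x^-1)%g by rewrite tr_mulC !mulgA.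
have h1 : tr (q * (x * p))%g = - tr x.
  by rewrite tr_mulC -mulgA pq.
have := tr_mulV (x * q)%g (x * p)%g.
have -> : (x * q * (x * p)^-1 = x * (q * p^-1) * x^-1)%g by rewrite invgM !mulgA.
have -> : tr (x * q * (x * p))%g = tr (q * (x * p) * x)%g by rewrite [RHS]tr_mulC !mulgA.
rewrite tr_conj (tr_mulV q) (tr_mulC q p) pq tp tq te (tr_mulV _ x) h1 => h2.
rewrite -[tr (q * _ * x)%g](subKr (tr (x * q)%g * tr (x * p)%g)) -h2; ring.
Qed.

End shift.

Section conclusion.
Context (O : G -> G -> G -> G -> Prop) (HO : hyperbolic_orbit O).
Implicit Types a b c d : G.

Definition rot (u : G * G) : G * G := (u.1 * u.2, u.1^-1)%g.
Definition rotV (u : G * G) : G * G := (u.2^-1, u.2 * u.1)%g.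

Lemma rotVK : cancel rotV rot.
Proof. by case=> c d; rewrite /rot /rotV /= invgK mulKg. Qed.

(** With e = [c, d], this sends (c, d) to (e c^-1, d^-1 e^-1). Its square is the conjugation by e,
    that is, the full twist about the curve [c, d]. *)
Definition half_twist := iter 3 rot.
Definition half_twistV := iter 3 rotV.

Lemma half_twistVK : cancel half_twistV half_twist.
Proof. by move=> u; rewrite /half_twist /half_twistV /= !rotVK. Qed.

Lemma half_twist2 u : (half_twist u).2 = (u.1 * u.2^-1 * u.1^-1)%g.
Proof. by rewrite /= !invgM !invgK mulgA. Qed.

Lemma orbit_half_twist a b u : O a b u.1 u.2 ->
  O a b (half_twist u).1 (half_twist u).2 /\ comm (half_twist u).1 (half_twist u).2 = comm u.1 u.2.
Proof.
move/(orbit_swap HO)/(orbit_rot HO)/(orbit_rot HO)/(orbit_rot HO)/(orbit_swap HO).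
by split => //; rewrite /half_twist /= !comm_rot.
Qed.

Lemma orbit_half_twistV a b u : O a b u.1 u.2 ->
  O a b (half_twistV u).1 (half_twistV u).2 /\
  comm (half_twistV u).1 (half_twistV u).2 = comm u.1 u.2.
Proof.
move/(orbit_swap HO)/(orbit_rotV HO)/(orbit_rotV HO)/(orbit_rotV HO)/(orbit_swap HO).
by split => //; rewrite /half_twistV /= !comm_rotV.
Qed.

Section twisted.
Context (a b c d : G) (Oabcd : O a b c d).

Definition twisted (j : int) : G * G := int_iter half_twist half_twistV (c, d) j.
(** The inverse is taken so that two consecutive terms multiply to [c, d] ([twisted_secondM]). *)
Definition twisted_second (j : int) : G := (twisted j).2^-1%g.

Lemma orbit_twisted j : O a b (twisted j).1 (twisted j).2 /\
  comm (twisted j).1 (twisted j).2 = comm c d.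
Proof.
rewrite /twisted; case: j => n; rewrite /int_iter; elim: n => [|n [IHn e]].
- by [].
- by rewrite iterS -e; exact: orbit_half_twist.
- exact: (@orbit_half_twistV _ _ (c, d)).
- by rewrite iterS -e; exact: orbit_half_twistV.
Qed.

Lemma twisted_secondS j : twisted_second (j + 1) = (comm c d * (twisted_second j)^-1)%g.
Proof.
have [_ e] := orbit_twisted j; rewrite /twisted_second /twisted int_iterS; last exact: half_twistVK.
by rewrite -/(twisted j) half_twist2 -e /comm !invgM !invgK mulgA mulgVK.
Qed.

Lemma twisted_secondM j : (twisted_second (j + 1) * twisted_second j)%g = comm c d.
Proof. by rewrite twisted_secondS mulgVK. Qed.

Lemma tr_twisted_second j : tr (twisted_second j) = tr d.
Proof.
have S i : tr (twisted_second (i + 1)) = tr (twisted_second i).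
  rewrite /twisted_second /twisted int_iterS; last exact: half_twistVK.
  by rewrite half_twist2 !trV tr_conj trV.
elim/int_rec: j => [|n IHn|n IHn]; first by rewrite /twisted_second /= trV.
  by rewrite -addn1 PoszD S.
by rewrite -IHn -[in RHS](subrK 1 (- n%:Z)) S -addn1 PoszD opprD.
Qed.

End twisted.

(** With the next two lemmas: a, a b a^-1 and b^-1 satisfy tr (x e) = - tr x for e = [c, d] = -
    [a, b]^-1, the hypothesis on x in the shift lemmas. *)
Lemma tr_mul_commV a b : tr (a * (comm a b)^-1)%g = tr a.
Proof.
have -> : (a * (comm a b)^-1 = a * (b * a * b^-1) * a^-1)%g by rewrite /comm !invgM !invgK !mulgA.
by rewrite !tr_conj.
Qed.

Lemma tr_conj_mul_commV a b : tr (a * b * a^-1 * (comm a b)^-1)%g = tr b.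
Proof.
have -> : (a * b * a^-1 * (comm a b)^-1 = a * (b * (a^-1 * b * a^-1^-1) * b^-1) * a^-1)%g.
  by rewrite /comm !invgM !invgK !mulgA.
by rewrite !tr_conj.
Qed.

Lemma tr_inv_mul_commV a b : tr (b^-1 * (comm a b)^-1)%g = tr b.
Proof.
have -> : (b^-1 * (comm a b)^-1 = a * b^-1 * a^-1)%g by rewrite /comm !invgM !invgK !mulgA mulVg mul1g.
by rewrite !tr_conj trV.
Qed.

Lemma orbit_commE a b c d : O a b c d -> comm c d = SL2_opp (comm a b)^-1%g.
Proof. by move/(orbit_rel HO) => rel; rewrite -[LHS](mulKg (comm a b)) rel SL2_mulgN mulg1. Qed.

(* The twist about the curve (d^-1 a) changes the separating curve [a, b]. *)
Lemma tr_comm_handle a b c d K : O a b c d -> tr (comm a b) = K ->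
  exists a' b' c' d', O a' b' c' d' /\
    tr (comm a' b') = K + tr d ^+ 2 - tr a ^+ 2 - tr (a * d^-1)%g * tr (a * (c * d * c^-1))%g.
Proof.
move=> h hK; exists (d^-1 * a * c)%g, d, a, (d^-1 * a * b)%g.
split; first exact/(orbit_swap HO)/(orbit_handle HO).
have cdE := orbit_commE h.
have -> : comm (d^-1 * a * c)%g d = (d^-1 * (a * (c * d * c^-1) * a^-1 * d^-1) * d^-1^-1)%g.
  by rewrite /comm !invgM !invgK !mulgA mulgK mulgVK.
rewrite tr_conj (@handle_relation (comm c d) _ _ (tr d) K); rewrite ?trV ?tr_conj//.
- by rewrite cdE trN trV hK.
- by rewrite cdE SL2_mulgN trN tr_mul_commV.
Qed.


(** Inside the absolute value is the new commutator trace of [tr_comm_handle]. The relation, written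
    (K + 2) u v = (u + v)^2 + (K - 2 + y^2) (K + 2 - x^2), shows that it never exceeds K - 1. So if
    the twist fails to reduce K, it is below - (K - 1). *)
Lemma handle_bound (x y K u v : R) : 18 <= K -> x ^+ 2 <= K + 2 -> 4 < y ^+ 2 -> y ^+ 2 <= K - 2 ->
  K * (u * v) = u ^+ 2 + v ^+ 2 + (K - 2 + y ^+ 2) * (K + 2 - x ^+ 2) ->
  K - 1 < `|K + y ^+ 2 - x ^+ 2 - u * v| -> 2 * K - 1 + y ^+ 2 - x ^+ 2 < u * v.
Proof.
move=> K18 xK y4 yK E; have x0 := sqr_ge0 x.
have h : K + y ^+ 2 - x ^+ 2 - u * v <= K - 1.
  have h1 : 0 <= (u + v) ^+ 2 by exact: sqr_ge0.
  have h2 : 0 <= (K + 2 - x ^+ 2) * (y ^+ 2 - 4) by rewrite mulr_ge0//; lra.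
  have h3 : 0 <= (K + 2) * (K - 2 - y ^+ 2) by rewrite mulr_ge0//; lra.
  have h4 : 0 <= (K + 2) * (u * v - y ^+ 2 + x ^+ 2 - 1) by lra.
  by move: h4; rewrite pmulr_rge0; lra.
by rewrite ltr_normr => /orP[]; lra.
Qed.

Lemma comm_descent a b c d : O a b c d ->
  exists a' b' c' d', O a' b' c' d' /\ `|tr (comm a' b')| <= `|tr (comm a b)| - 1.
Proof.
wlog K0 : a b c d / 0 <= tr (comm a b) => [hw h|h].
  have [/hw/(_ h)//|K0] := leP 0 (tr (comm a b)).
  have h' := orbit_swap HO h; have := hw _ _ _ _ _ h'.
  by rewrite (orbit_commE h) trN trV normrN; apply; rewrite oppr_ge0 ltW.
have [//|none] := pselect (exists a' b' c' d', O a' b' c' d' /\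
  `|tr (comm a' b')| <= `|tr (comm a b)| - 1).
set K := tr (comm a b) in K0 none.
have := orbit_tr_comm HO h; rewrite -/K ger0_norm// => K2.
have [a1 [b1 [h1 e1 [a2 b2] c2 [ac bc]]]] := pants_pos HO h erefl K2.
pose z := - tr (a1 * b1)%g.
have KE : K + 2 = tr a1 ^+ 2 + tr b1 ^+ 2 + z ^+ 2 + tr a1 * tr b1 * z.
  by rewrite /K -e1 tr_comm /z; ring.
have {}z2 : 2 < z by rewrite /z; lra.
(* All of tr a1, tr b1 and z exceed 2, so K + 2 > 4 + 4 + 4 + 8. *)
have K18 : 18 <= K.
  have : 0 < (tr a1 - 2) * (tr a1 + 2) by rewrite mulr_gt0//; lra.
  have : 0 < (tr b1 - 2) * (tr b1 + 2) by rewrite mulr_gt0//; lra.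
  have : 0 < (z - 2) * (z + 2) by rewrite mulr_gt0//; lra.
  have : 0 < (tr a1 - 2) * tr b1 * z by rewrite !mulr_gt0//; lra.
  have : 0 < (tr b1 - 2) * z by rewrite !mulr_gt0//; lra.
  lra.
have h1s := orbit_swap HO h1.
have [|c1 [d1 [h2s e2 dK]]] := short_curve HO h1s (K := K) _ K18.
  by rewrite (orbit_commE h1) e1 trN trV.
have {h1s h1} h2 := orbit_swap HO h2s.
pose Y := twisted_second c1 d1; pose y := tr d1; pose e := comm c1 d1.
have eE : e = SL2_opp (comm a1 b1)^-1%g by exact: orbit_commE h2.
have te : tr e = - K by rewrite eE trN trV e1.
have y4 : 4 < y ^+ 2.
  have := orbit_tr2 HO (orbit_swap HO h2); rewrite -/y -[y ^+ 2]sqr_normr => y2.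
  have : 0 < (`|y| - 2) * (`|y| + 2) by rewrite mulr_gt0//; lra.
  lra.
have YM j : (Y (j + 1) * Y j)%g = e by exact: (twisted_secondM h2).
have YS j : Y (j + 1) = (e * (Y j)^-1)%g by exact: (twisted_secondS h2).
have tY j : tr (Y j) = y by exact: tr_twisted_second.
(* The second boundary curve of the pants is represented by this conjugate of b1, for which
   [tr_conj_mul_commV] gives tr (X e) = - tr X. Two rotations of (a1, b1) produce a pair that starts
   with X. *)
pose X := (a1 * b1 * a1^-1)%g.
have tX : tr X = tr b1 by rewrite tr_conj.
have xa : tr (a1 * e)%g = - tr a1 by rewrite eE SL2_mulgN trN tr_mul_commV.
have xX : tr (X * e)%g = - tr X by rewrite eE SL2_mulgN trN tr_conj_mul_commV tX.
have xb : tr (b1^-1 * e)%g = - tr b1^-1%g.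
  by rewrite eE SL2_mulgN trN tr_inv_mul_commV trV.
have rec x : tr (x * e)%g = - tr x -> recurrent K (fun j => tr (x * Y j)%g).
  by move=> xe j; rewrite YS (shift_recurrent (YM j) te (tY _) (tY _) xe).
have rel x : tr (x * e)%g = - tr x -> forall j, K * (tr (x * Y j)%g * tr (x * Y (j + 1))%g) =
  tr (x * Y j)%g ^+ 2 + tr (x * Y (j + 1))%g ^+ 2 + (K - 2 + y ^+ 2) * (K + 2 - tr x ^+ 2).
  by move=> xe j; exact: (shift_relation (YM j) te (tY _) (tY _) xe).
(* By [none] the twist never reduces K; this is applied to all half twists of the second handle,
   once with x = a1 and once with x = X. *)
have bad x x' : tr (x * e)%g = - tr x -> tr x ^+ 2 <= K + 2 -> comm x x' = comm a1 b1 ->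
    (forall j, O x x' (twisted c1 d1 j).1 (twisted c1 d1 j).2) ->
    (forall j, 2 < `|tr (x * Y j)%g|) /\
    (forall j, 2 * K - 1 + y ^+ 2 - tr x ^+ 2 < tr (x * Y j)%g * tr (x * Y (j + 1))%g).
  move=> xe xK ex Ox; split=> j.
    by rewrite tr_mulC; exact: (orbit_tr_bridge HO (Ox j)).
  have {}K18 := K18; have {}y4 := y4.
  apply: (handle_bound K18 xK y4 dK (rel x xe j)).
  have exK : tr (comm x x') = K by rewrite ex e1.
  have [a3 [b3 [c3 [d3 [h3 t3]]]]] := tr_comm_handle (Ox j) exK.
  rewrite ltNge; apply/negP => small; apply: none; exists a3, b3, c3, d3; split => //.
  rewrite t3 (ger0_norm K0); apply: le_trans small.
  have -> : tr (twisted c1 d1 j).2 = y by rewrite -trV tY.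
  suff -> : ((twisted c1 d1 j).1 * (twisted c1 d1 j).2 * (twisted c1 d1 j).1^-1)%g = Y (j + 1) by [].
  by rewrite YS /Y /twisted_second invgK -[e](orbit_twisted h2 j).2 /comm mulgVK.
have za : tr (a1 * X)%g = - z.
  by rewrite /z opprK (_ : a1 * X = a1 * (a1 * b1) * a1^-1)%g ?tr_conj// /X !mulgA.
(* Up to sign, the sequences of X and b1^-1 differ by one shift. The value of [beta] at shift -1
   thus comes from [shift_polar] for a1 and b1^-1, and the value at shift 0 from a1 and X. *)
have gE j : tr (X * Y j)%g = - tr (b1^-1 * Y (j + 1))%g.
  rewrite -[Y j](mulKg (Y (j + 1))) YM eE !SL2_mulgN trN; congr (- _).
  have -> : (X * ((Y (j + 1))^-1 * (comm a1 b1)^-1) =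
     (a1 * b1) * (a1^-1 * ((Y (j + 1))^-1 * b1) * a1^-1^-1) * (a1 * b1)^-1)%g.
    by rewrite /X /comm !invgM !invgK !mulgA.
  by rewrite !tr_conj -[RHS]trV invgM !invgK.
have aK : tr a1 ^+ 2 <= K + 2.
  have := sqr_ge0 (tr b1); have := sqr_ge0 z.
  have : 0 < tr a1 * tr b1 * z by rewrite !mulr_gt0//; lra.
  lra.
have bK : tr b1 ^+ 2 <= K + 2.
  have := sqr_ge0 (tr a1); have := sqr_ge0 z.
  have : 0 < tr a1 * tr b1 * z by rewrite !mulr_gt0//; lra.
  lra.
have [f2 badf] := bad a1 b1 xa aK erefl (fun j => (orbit_twisted h2 j).1).
have h3 := orbit_rot HO (orbit_rot HO h2).
have XK : tr X ^+ 2 <= K + 2 by rewrite tX.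
have Xe : comm X (a1 * b1)^-1%g = comm a1 b1 by rewrite -[RHS]comm_rot -[RHS]comm_rot.
have [g2 badg] := bad X _ xX XK Xe (fun j => (orbit_twisted h3 j).1).
rewrite tX in badg.
case: (@twist_contradiction R (fun j => tr (a1 * Y j)%g) (fun j => tr (X * Y j)%g)
  K y (tr a1) (tr b1) z) => //; try exact: rec.
- exact: rel.
- by move=> j; have := rel X xX j; rewrite tX.
- by rewrite /beta (shift_polar (YM 0) te (tY _) (tY _) xa xX) za tX; ring.
- rewrite /beta addNr !gE addNr.
  have := shift_polar (YM 0) te (tY _) (tY _) xa xb; rewrite tr_mulV trV => h5.
  rewrite /z; move: h5; lra.
Qed.

Theorem hyperbolic_orbit_empty a b c d : ~ O a b c d.
Proof.
move=> h; pose P (t : G * G * G * G) := O t.1.1.1 t.1.1.2 t.1.2 t.2.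
suff [] : exists2 t, P t & False by [].
apply: (@descent R _ P (fun=> False) (fun t => `|tr (comm t.1.1.1 t.1.1.2)|) 1 ltr01 _ _ (a, b, c, d)) => //.
move=> [[[a0 b0] c0] d0] /comm_descent[a' [b' [c' [d' [h' le]]]]].
by right; exists (a', b', c', d').
Qed.

End conclusion.
End orbit.

(** * Homotopy classes and homeomorphisms *)

Section groupoid.
Context {R : realType} {T : topologicalType} {x0 : T}.
Local Notation I := (I01 R).
Local Notation "p =~ q" := (path_homotopic p q) (at level 70).

Lemma path_quotient_homotopic x (p p' q q' : {path I from x0 to x}) :
  p =~ p' -> q =~ q' -> path_quotient p q = path_quotient p' q'.
Proof.
move=> pp qq; apply/loop_classP/path_concat_homotopic => //.
exact: path_reverse_homotopic.
Qed.

Lemma path_quotient_loop x (l : {path I from x0 to x0}) (p : {path I from x0 to x}) :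
  path_quotient (path_concat l p) p = loop_class l.
Proof.
apply/loop_classP; apply: path_homotopic_trans (path_homotopic_sym (path_concatA _ _ _)) _.
apply: path_homotopic_trans (path_concatp1 l).
by apply: path_concat_homotopic; [exact: path_homotopic_refl|exact: path_concatpV].
Qed.

Lemma path_quotient_concat x y (p q : {path I from x0 to x}) (r : {path I from x to y}) :
  path_quotient (path_concat p r) (path_concat q r) = path_quotient p q.
Proof.
rewrite -[RHS](path_quotient_loop _ (path_concat q r)).
apply: path_quotient_homotopic; last exact: path_homotopic_refl.
apply: path_homotopic_trans (path_homotopic_sym (path_concatA _ _ _)).
apply: path_concat_homotopic; last exact: path_homotopic_refl.
apply: path_homotopic_trans (path_concatA _ _ _).
apply: path_homotopic_trans (path_homotopic_sym (path_concatp1 _)) _.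
apply: path_concat_homotopic; first exact: path_homotopic_refl.
exact/path_homotopic_sym/path_concatVp.
Qed.

End groupoid.

Section planar.
Context {R : realType} {T : topologicalType}.
Local Notation I := (I01 R).

(** The homotopy is affine in the plane. As f is defined on the whole plane, there is no convexity
    to check. *)
Lemma planar_homotopic (f : R * R -> T) (P Q : I -> R * R) x y
    (p q : {path I from x to y}) :
  continuous f -> continuous P -> continuous Q ->
  (forall t, p t = f (P t)) -> (forall t, q t = f (Q t)) ->
  P zero = Q zero -> P one = Q one -> path_homotopic p q.
Proof.
move=> cf cP cQ pE qE PQ0 PQ1.
have c1 (F : I -> R * R) : continuous F -> continuous (fun t => (F t).1).
  by move=> cF; apply: continuous_compf cF => ?; exact: cvg_fst.
have c2 (F : I -> R * R) : continuous F -> continuous (fun t => (F t).2).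
  by move=> cF; apply: continuous_compf cF => ?; exact: cvg_snd.
have cu (F : I -> R) : continuous F -> continuous (fun u : I * I => F u.1).
  by move=> cF; apply: continuous_compf cF _; cts.
exists (fun u => f ((1 - I01_val u.2) * (P u.1).1 + I01_val u.2 * (Q u.1).1,
                 (1 - I01_val u.2) * (P u.1).2 + I01_val u.2 * (Q u.1).2)).
split => [|t|t|s|s] /=.
- apply: continuous_compf cf _; apply: continuous_pair; cts.
  + exact: (cu (fun t => (P t).1) (c1 _ cP)).
  + exact: (cu (fun t => (Q t).1) (c1 _ cQ)).
  + exact: (cu (fun t => (P t).2) (c2 _ cP)).
  + exact: (cu (fun t => (Q t).2) (c2 _ cQ)).
- by rewrite I01_zeroE subr0 !mul1r !mul0r !addr0 pE; case: (P t).
- by rewrite I01_oneE subrr !mul1r !mul0r !add0r qE; case: (Q t).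
- rewrite -[RHS](path_zero (s := p)) pE -PQ0; congr f.
  by rewrite -!mulrDl subrK !mul1r; case: (P zero).
- rewrite -[RHS](path_one (s := p)) pE -PQ1; congr f.
  by rewrite -!mulrDl subrK !mul1r; case: (P one).
Qed.

End planar.

Section push_forward.
Context {R : realType} {T U : topologicalType}.
Local Notation I := (I01 R).

Section def.
Context (f : T -> U) (cf : continuous f) {x y : T} {x' y' : U}.
Context (fx : f x = x') (fy : f y = y') (p : {path I from x to y}).

Lemma path_map_continuous : continuous (fun t => f (p t)).
Proof. by apply: continuous_compf cf _; exact: path_cts. Qed.

Lemma path_map_zero : f (p zero) = x'. Proof. by rewrite path_zero. Qed.
Lemma path_map_one : f (p one) = y'. Proof. by rewrite path_one. Qed.

Definition path_map : {path I from x' to y'} :=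
  mk_path path_map_continuous path_map_zero path_map_one.

Lemma path_mapE t : path_map t = f (p t). Proof. by []. Qed.

End def.

Lemma path_map_homotopic (f : T -> U) (cf : continuous f) x y x' y'
    (fx : f x = x') (fy : f y = y') (p q : {path I from x to y}) :
  path_homotopic p q -> path_homotopic (path_map cf fx fy p) (path_map cf fx fy q).
Proof.
move=> [H [cH H0 H1 Hx Hy]]; exists (fun u => f (H u)); split=> [|t|t|s|s].
- exact: continuous_compf cf cH.
- by rewrite H0.
- by rewrite H1.
- by rewrite Hx.
- by rewrite Hy.
Qed.

Lemma path_map_concat (f : T -> U) (cf : continuous f) x y z x' y' z'
    (fx : f x = x') (fy : f y = y') (fz : f z = z')
    (p : {path I from x to y}) (q : {path I from y to z}) :
  path_map cf fx fz (path_concat p q) =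
  path_concat (path_map cf fx fy p) (path_map cf fy fz q).
Proof. by apply/path_eqP => t; rewrite path_mapE !path_concatE; case: ifP. Qed.

Lemma path_map_reverse (f : T -> U) (cf : continuous f) x y x' y'
    (fx : f x = x') (fy : f y = y') (p : {path I from x to y}) :
  path_map cf fy fx (path_reverse p) = path_reverse (path_map cf fx fy p).
Proof. by apply/path_eqP => t. Qed.

End push_forward.

Section homeomorphism.
Context (R : realType) (T : topologicalType) (x0 : T).
Local Notation I := (I01 R).

Record pointed_homeo := PointedHomeo {
  homeo_fun :> T -> T;
  homeo_inv : T -> T;
  homeo_continuous : continuous homeo_fun;
  homeo_inv_continuous : continuous homeo_inv;
  homeoK : cancel homeo_fun homeo_inv;
  homeo_invK : cancel homeo_inv homeo_fun;
  homeo_base : homeo_fun x0 = x0 }.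

Arguments homeo_continuous : clear implicits.
Arguments homeo_inv_continuous : clear implicits.
Arguments homeo_base : clear implicits.

Implicit Types h k : pointed_homeo.

Lemma homeo_inv_base h : homeo_inv h x0 = x0.
Proof. by rewrite -{1}(homeo_base h) homeoK. Qed.

Definition homeo_opp h := PointedHomeo (homeo_inv_continuous h) (homeo_continuous h)
  (homeo_invK h) (homeoK h) (homeo_inv_base h).

Lemma homeo_comp_base h k : h (k x0) = x0.
Proof. by rewrite !homeo_base. Qed.

Definition homeo_comp h k :=
  PointedHomeo (continuous_compf (homeo_continuous h) (homeo_continuous k))
    (continuous_compf (homeo_inv_continuous k) (homeo_inv_continuous h))
    (can_comp (homeoK h) (homeoK k)) (can_comp (homeo_invK k) (homeo_invK h))
    (homeo_comp_base h k).

Definition homeo_id := @PointedHomeo id id (fun=> cvg_id) (fun=> cvg_id)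
  (fun=> erefl) (fun=> erefl) erefl.

Definition induced h (g : fundamental_group R x0) : fundamental_group R x0 :=
  loop_class (path_map (homeo_continuous h) (homeo_base h) (homeo_base h) (repr g)).

Lemma induced_class h (p : {path I from x0 to x0}) : induced h (loop_class p) =
  loop_class (path_map (homeo_continuous h) (homeo_base h) (homeo_base h) p).
Proof.
apply/loop_classP; apply: path_map_homotopic.
exact/loop_classP/loop_class_repr.
Qed.

Lemma inducedM h : {morph induced h : x y / (x * y)%g}.
Proof.
move=> a b; rewrite -(loop_class_repr a) -(loop_class_repr b) loop_classM !induced_class.
by rewrite loop_classM (path_map_concat _ _ (homeo_base h)).
Qed.

Lemma inducedV h : {morph induced h : x / (x^-1)%g}.
Proof.
move=> a; rewrite -(loop_class_repr a) loop_classV !induced_class loop_classV.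
by rewrite path_map_reverse.
Qed.

Lemma induced_comp h k g : induced (homeo_comp h k) g = induced h (induced k g).
Proof.
rewrite -(loop_class_repr g) !induced_class; congr loop_class.
by apply/path_eqP => t.
Qed.

Lemma induced_id g : induced homeo_id g = g.
Proof.
rewrite -{2}(loop_class_repr g) -{1}(loop_class_repr g) induced_class; congr loop_class.
by apply/path_eqP => t.
Qed.

Lemma inducedK h : cancel (induced h) (induced (homeo_opp h)).
Proof.
move=> g; rewrite -{2}(loop_class_repr g) -{1}(loop_class_repr g) !induced_class.
by congr loop_class; apply/path_eqP => t; rewrite !path_mapE; exact: homeoK.
Qed.

Lemma induced_path_quotient h x y (hx : h x = y) (p q : {path I from x0 to x}) :
  induced h (path_quotient p q) =
  path_quotient (path_map (homeo_continuous h) (homeo_base h) hx p)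
                (path_map (homeo_continuous h) (homeo_base h) hx q).
Proof. by rewrite induced_class (path_map_concat _ _ hx) path_map_reverse. Qed.

Lemma simple_closed_curve_induced h g :
  simple_closed_curve g -> simple_closed_curve (induced h g).
Proof.
move=> [p [<- sp]]; exists (path_map (homeo_continuous h) (homeo_base h) (homeo_base h) p).
split; first by rewrite induced_class.
by move=> s t s1 t1 /(can_inj (homeoK h)); exact: sp.
Qed.

End homeomorphism.
Arguments homeo_continuous {T x0} h : rename.
Arguments homeo_inv_continuous {T x0} h : rename.
Arguments homeo_base {T x0} h : rename.

(** * Paths in the octagon *)

Lemma planar_concat_homotopic {R : realType} {T : topologicalType} (f : R * R -> T)
    (P Q S : I01 R -> R * R) x y z (p : {path I01 R from x to y})
    (q : {path I01 R from y to z}) (s : {path I01 R from x to z}) :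
  continuous f -> continuous P -> continuous Q -> continuous S ->
  (forall t, p t = f (P t)) -> (forall t, q t = f (Q t)) -> (forall t, s t = f (S t)) ->
  P zero = S zero -> P one = Q zero -> Q one = S one ->
  path_homotopic (path_concat p q) s.
Proof.
move=> cf cP cQ cS pE qE sE PS PQ QS.
apply: (planar_homotopic cf _ cS _ sE (P := concat_fun P Q)).
- apply: pasting.
  + exact: I01_val_continuous.
  + by apply: continuous_clamp_comp cP _; cts.
  + by apply: continuous_clamp_comp cQ _; cts.
  + by move=> t ->; rewrite divff ?pnatr_eq0// subrr.
- by move=> t; rewrite path_concatE /concat_fun; case: ifP.
- by rewrite -PS /concat_fun I01_zeroE mulr0 invr_ge0 ler0n.
- rewrite -QS /concat_fun I01_oneE ifF; last by lra.
  by rewrite mulr1 (_ : 2 - 1 = 1)//; lra.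
Qed.

Section octagon.
Context (R : realType).
Local Notation I := (I01 R).
Local Notation base := (@base R).
Implicit Types (u v : R * R) (a : R).

Definition sqnorm u : R := u.1 ^+ 2 + u.2 ^+ 2.

Lemma sqnorm_continuous : continuous sqnorm.
Proof. by rewrite /sqnorm; apply: continuous_add => u; apply: cvgM; (exact: cvg_fst || exact: cvg_snd). Qed.

(** Outside the disc this is the inversion u / |u|^2 rather than the radial projection: it is still
    a continuous retraction and avoids a square root. *)
Definition retract_fun u : R * R := (u.1 / Num.max 1 (sqnorm u), u.2 / Num.max 1 (sqnorm u)).

Lemma retract_subproof u : sqnorm (retract_fun u) <= 1.
Proof.
have n0 : 0 <= sqnorm u by rewrite addr_ge0// sqr_ge0.
have m1 : 1 <= Num.max 1 (sqnorm u) by rewrite le_max lexx.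
have m0 : 0 < Num.max 1 (sqnorm u) by exact: lt_le_trans m1.
rewrite /sqnorm /= !expr_div_n -mulrDl ler_pdivrMr ?exprn_gt0// mul1r -/(sqnorm u).
apply: (@le_trans _ _ (Num.max 1 (sqnorm u))); first by rewrite le_max lexx orbT.
by rewrite expr2 ler_peMr// ltW.
Qed.

Definition retract u : disc R := mk_disc (retract_subproof u).

(* The projection of the octagon to the surface, extended to the whole plane. *)
Definition pr u : Sigma2 R := proj (retract u).

Lemma retract_id u : sqnorm u <= 1 -> disc_val (retract u) = u.
Proof.
move=> u1; rewrite /disc_val set_valE /= /retract_fun (max_idPl u1) !divr1.
by case: u {u1}.
Qed.

Lemma pr_continuous : continuous pr.
Proof.
apply: continuous_compf; first exact: proj_continuous.
have cV : continuous (fun u => (Num.max 1 (sqnorm u))^-1).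
  move=> u; apply: cvgV; last by apply: continuous_maxr; [exact: continuous_const|exact: sqnorm_continuous].
  by rewrite gt_eqF// lt_max ltr01.
apply: continuous_comp_initial; apply: continuous_pair.
  by apply: continuous_mul => //; cts.
by apply: continuous_mul => //; cts.
Qed.

Lemma pr_disc (w : disc R) : pr (disc_val w) = proj w.
Proof. by congr proj; apply: disc_val_inj; rewrite retract_id// disc_valP. Qed.

Definition circle a : R * R := (cos a, sin a).

Lemma sqnorm_circle a : sqnorm (circle a) = 1.
Proof. exact: cos2Dsin2. Qed.

Lemma pr_circle a : pr (circle a) = proj (boundary_point (a / (pi / 4))).
Proof.
rewrite -pr_disc; congr pr; rewrite /disc_val set_valE /= /boundary_fun divfK//.
by rewrite gt_eqF// divr_gt0// pi_gt0.
Qed.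

Lemma boundary_pointE t : proj (boundary_point t) = pr (circle (t * (pi / 4))).
Proof. by rewrite pr_circle mulfK// gt_eqF// divr_gt0// pi_gt0. Qed.

Lemma pr_glue (k : nat) a : k \in [:: 0; 1; 4; 5]%N ->
  k%:R * (pi / 4) <= a <= (k%:R + 1) * (pi / 4) ->
  pr (circle a) = pr (circle ((2 * k%:R + 3) * (pi / 4) - a)).
Proof.
move=> kin /andP[a0 a1]; have pi0 : 0 < pi / 4 :> R by rewrite divr_gt0// pi_gt0.
pose s := a / (pi / 4) - k%:R.
have s01 : 0 <= s <= 1.
  by rewrite subr_ge0 ler_pdivlMr// a0 lerBlDl ler_pdivrMr.
have := @glued_side R k s kin s01 => /projP; rewrite !boundary_pointE => e.
rewrite (_ : a = (k%:R + s) * (pi / 4)); last by rewrite /s addrC subrK divfK// gt_eqF.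
by rewrite e; congr (pr (circle _)); ring.
Qed.

Lemma circle2pi a : circle (a + pi *+ 2) = circle a.
Proof. by rewrite /circle cosD2pi sinD2pi. Qed.

Definition corner (k : nat) : R * R := circle (k%:R * (pi / 4)).
Definition vertex : Sigma2 R := pr (corner 0).

Lemma pr_corner_glue k : k \in [:: 0; 1; 4; 5]%N -> pr (corner k) = pr (corner k.+3) /\
  pr (corner k.+1) = pr (corner k.+2).
Proof.
move=> kin; have p0 := pi_gt0 R.
split; rewrite /corner (pr_glue kin).
- by congr (pr (circle _)); rewrite -[k.+3]addn3 natrD; lra.
- by apply/andP; split; lra.
- by congr (pr (circle _)); rewrite -[k.+2]addn2 -[k.+1]addn1 !natrD; lra.
- by rewrite -[k.+1]addn1 natrD; apply/andP; split; lra.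
Qed.

Lemma pr_corner k : (k <= 8)%N -> pr (corner k) = vertex.
Proof.
have [h03 h12] := @pr_corner_glue 0 isT.
have [h14 h23] := @pr_corner_glue 1 isT.
have [h47 h56] := @pr_corner_glue 4 isT.
have [h58 h67] := @pr_corner_glue 5 isT.
have h80 : corner 8 = corner 0.
  rewrite /corner mul0r -[RHS]circle2pi; congr circle; rewrite add0r -mulr_natr; lra.
have h5 : pr (corner 5) = vertex by rewrite h58 h80.
have h3 : pr (corner 3) = vertex by rewrite -h03.
have h2 : pr (corner 2) = vertex by rewrite h23.
have h1 : pr (corner 1) = vertex by rewrite h12.
have h4 : pr (corner 4) = vertex by rewrite -h14.
have h6 : pr (corner 6) = vertex by rewrite -h56.
have h7 : pr (corner 7) = vertex by rewrite -h47.
by case: k => [|[|[|[|[|[|[|[|[|k]]]]]]]]] //; rewrite h80.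
Qed.

Lemma pr0 : pr (0, 0) = base.
Proof. by rewrite -[RHS]/(proj (disc_center R)) -pr_disc; congr pr; rewrite /disc_val set_valE. Qed.

Section segment.
Context (u v : R * R) (x y : Sigma2 R) (ux : pr u = x) (vy : pr v = y).

Definition segment_fun (t : I) : R * R :=
  ((1 - I01_val t) * u.1 + I01_val t * v.1, (1 - I01_val t) * u.2 + I01_val t * v.2).

Lemma segment_fun_continuous : continuous segment_fun.
Proof. by apply: continuous_pair; cts. Qed.

Lemma segment_fun0 : segment_fun zero = u.
Proof. by rewrite /segment_fun I01_zeroE subr0 !mul1r !mul0r !addr0; case: (u). Qed.

Lemma segment_fun1 : segment_fun one = v.
Proof. by rewrite /segment_fun I01_oneE subrr !mul1r !mul0r !add0r; case: (v). Qed.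

Lemma segment_zero : pr (segment_fun zero) = x.
Proof. by rewrite segment_fun0. Qed.

Lemma segment_one : pr (segment_fun one) = y.
Proof. by rewrite segment_fun1. Qed.

Definition segment : {path I from x to y} :=
  mk_path (continuous_compf pr_continuous segment_fun_continuous) segment_zero segment_one.

Lemma segmentE t : segment t = pr (segment_fun t). Proof. by []. Qed.

End segment.

Lemma segment_congr u v w x y (wy : pr w = y) (ux : pr u = x) (vx : pr v = x) :
  u = v -> segment wy ux = segment wy vx.
Proof. by move=> uv; case: _ / uv vx => vx; congr segment; exact: Prop_irrelevance. Qed.

Definition spoke k (hk : (k <= 8)%N) : {path I from base to vertex} :=
  segment pr0 (pr_corner hk).

Lemma clamp_val (x : R) : 0 <= x -> x <= 1 -> I01_val (clamp x) = x.
Proof. by move=> x0 x1; rewrite clampE// x0. Qed.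

Lemma spoke_concatE u v x (ux : pr u = x) (vx : pr v = x) (t : I) :
  path_concat (segment pr0 ux) (path_reverse (segment pr0 vx)) t =
  if I01_val t <= 2^-1 then pr (2 * I01_val t * u.1, 2 * I01_val t * u.2)
  else pr ((2 - 2 * I01_val t) * v.1, (2 - 2 * I01_val t) * v.2).
Proof.
have t0 := I01_ge0 t; have t1 := I01_le1 t; rewrite path_concatE; case: ifPn => t2.
  by rewrite segmentE /segment_fun !mulr0 !add0r clamp_val//; lra.
rewrite path_reverseE segmentE /segment_fun !mulr0 !add0r clamp_val; [|rewrite clamp_val; lra..].
by rewrite clamp_val; [congr (pr (_, _)); ring|lra..].
Qed.

(** Both radii turn simultaneously, and their end points, of angles g and g', stay glued throughout,
    so the loop never breaks. *)
Lemma spoke_homotopic k a a' x y (b := (2 * k%:R + 3) * (pi / 4) - a)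
    (b' := (2 * k%:R + 3) * (pi / 4) - a') (ux : pr (circle a) = x) (vx : pr (circle b) = x)
    (uy : pr (circle a') = y) (vy : pr (circle b') = y) :
  k \in [:: 0; 1; 4; 5]%N -> k%:R * (pi / 4) <= a <= (k%:R + 1) * (pi / 4) ->
  k%:R * (pi / 4) <= a' <= (k%:R + 1) * (pi / 4) ->
  path_quotient (segment pr0 ux) (segment pr0 vx) =
  path_quotient (segment pr0 uy) (segment pr0 vy).
Proof.
move=> kin /andP[a0 a1] /andP[a'0 a'1]; apply/loop_classP.
pose g (w : I * I) := (1 - I01_val w.2) * a + I01_val w.2 * a'.
pose g' w := (2 * k%:R + 3) * (pi / 4) - g w.
have gg' w : pr (circle (g w)) = pr (circle (g' w)).
  have s0 := I01_ge0 w.2; have s1 := I01_le1 w.2.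
  apply: pr_glue => //; rewrite /g; set s := I01_val w.2 in s0 s1 *.
  have h1 : 0 <= (1 - s) * (a - k%:R * (pi / 4)) by rewrite mulr_ge0//; lra.
  have h2 : 0 <= s * (a' - k%:R * (pi / 4)) by rewrite mulr_ge0//; lra.
  have h3 : 0 <= (1 - s) * ((k%:R + 1) * (pi / 4) - a) by rewrite mulr_ge0//; lra.
  have h4 : 0 <= s * ((k%:R + 1) * (pi / 4) - a') by rewrite mulr_ge0//; lra.
  by apply/andP; split; lra.
have cg : continuous g by rewrite /g; cts.
have cg' : continuous g' by rewrite /g'; apply: continuous_sub => //; cts.
have ccos (f : I * I -> R) : continuous f -> continuous (fun w => cos (f w)).
  by move=> cf; apply: continuous_compf cf => ?; exact: continuous_cos.
have csin (f : I * I -> R) : continuous f -> continuous (fun w => sin (f w)).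
  by move=> cf; apply: continuous_compf cf => ?; exact: continuous_sin.
have g0 t : g (t, zero) = a by rewrite /g /= I01_zeroE; ring.
have g1 t : g (t, one) = a' by rewrite /g /= I01_oneE; ring.
exists (fun w => if I01_val w.1 <= 2^-1
  then pr (2 * I01_val w.1 * cos (g w), 2 * I01_val w.1 * sin (g w))
  else pr ((2 - 2 * I01_val w.1) * cos (g' w), (2 - 2 * I01_val w.1) * sin (g' w))).
split => [|t|t|s|s].
- apply: (@pasting _ _ _ (fun w : I * I => I01_val w.1)); first by cts.
  + apply: continuous_compf pr_continuous _.
    by apply: continuous_pair; apply: continuous_mul; [cts|exact: ccos|cts|exact: csin].
  + apply: continuous_compf pr_continuous _.
    by apply: continuous_pair; apply: continuous_mul; [cts|exact: ccos|cts|exact: csin].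
  + move=> w ->; rewrite divff ?pnatr_eq0//.
    have -> : 2 - 1 = 1 :> R by ring.
    by rewrite !mul1r; exact: gg'.
- by rewrite spoke_concatE /= g0 /g' g0.
- by rewrite spoke_concatE /= g1 /g' g1.
- by rewrite /= I01_zeroE mulr0 invr_ge0 ler0n !mul0r pr0.
- rewrite /= I01_oneE ifF; last by lra.
  by rewrite mulr1 subrr !mul0r pr0.
Qed.

Lemma spoke_glue k (h0 : (k <= 8)%N) (h1 : (k.+1 <= 8)%N) (h2 : (k.+2 <= 8)%N)
    (h3 : (k.+3 <= 8)%N) : k \in [:: 0; 1; 4; 5]%N ->
  path_quotient (spoke h0) (spoke h3) = path_quotient (spoke h1) (spoke h2).
Proof.
move=> kin; have p0 := pi_gt0 R.
have e0 : circle ((2 * k%:R + 3) * (pi / 4) - k%:R * (pi / 4)) = corner k.+3.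
  by rewrite /corner; congr circle; rewrite -[k.+3]addn3 natrD; lra.
have e1 : circle ((2 * k%:R + 3) * (pi / 4) - k.+1%:R * (pi / 4)) = corner k.+2.
  by rewrite /corner; congr circle; rewrite -[k.+2]addn2 -[k.+1]addn1 !natrD; lra.
rewrite /spoke -(segment_congr _ (etrans (congr1 pr e0) (pr_corner h3)) _ e0).
rewrite -(segment_congr _ (etrans (congr1 pr e1) (pr_corner h2)) _ e1).
apply: spoke_homotopic => //; rewrite -?[k.+1]addn1 ?natrD; apply/andP; split; lra.
Qed.

Lemma glued_boundary (w z : disc R) : glued w z ->
  w = z \/ sqnorm (disc_val w) = 1 /\ sqnorm (disc_val z) = 1.
Proof.
elim=> [k s _ _|u|u v _ [->|[? ?]]|u v x _ h1 _ h2]; [|by left|by left|by right|].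
  by right; rewrite /disc_val !set_valE /=; split; exact: cos2Dsin2.
case: h1 => [->//|[h1 h1']]; case: h2 => [<-|[h2 h2']]; by right.
Qed.

Lemma pr_inj u v : sqnorm u <= 1 -> sqnorm v <= 1 -> pr u = pr v ->
  u = v \/ sqnorm u = 1 /\ sqnorm v = 1.
Proof.
move=> u1 v1 /projP/glued_boundary; rewrite !retract_id// => -[e|]; last by right.
by left; rewrite -(retract_id u1) e retract_id.
Qed.

(** The gluing identifies interior points of the disc with no other point, and the loop meets the
    boundary circle only at its midpoint, where [rad] is 1. *)
Lemma simple_spokes i j (hi : (i <= 8)%N) (hj : (j <= 8)%N) : corner i <> corner j ->
  simple_closed_curve (path_quotient (spoke hi) (spoke hj)).
Proof.
move=> ij; exists (path_concat (spoke hi) (path_reverse (spoke hj))); split => //.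
pose rad (t : I) := if I01_val t <= 2^-1 then 2 * I01_val t else 2 - 2 * I01_val t.
pose dir (t : I) := if I01_val t <= 2^-1 then corner i else corner j.
have E t : path_concat (spoke hi) (path_reverse (spoke hj)) t =
    pr (rad t * (dir t).1, rad t * (dir t).2).
  by rewrite spoke_concatE /rad /dir; case: ifP.
have nE t : sqnorm (rad t * (dir t).1, rad t * (dir t).2) = rad t ^+ 2.
  rewrite /sqnorm /= !exprMn -mulrDr [X in _ * X](_ : _ = 1) ?mulr1//.
  by rewrite /dir; case: ifP => _; exact: cos2Dsin2.
have r0 t : t != one -> 0 <= rad t <= 1 /\ (I01_val t <= 2^-1 \/ 0 < rad t).
  move=> t1; have t0 := I01_ge0 t; have t1' := I01_le1 t.
  have {}t1 : I01_val t < 1.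
    by rewrite lt_neqAle t1' andbT -I01_oneE; apply: contra t1 => /eqP/I01_val_inj ->.
  rewrite /rad; case: ifPn => t2; first by split; [lra|left].
  by split; [lra|right; lra].
move=> s t; rewrite !inE => s1 t1; rewrite !E.
have [/andP[rs0 rs1] ds] := r0 _ s1; have [/andP[rt0 rt1] dt] := r0 _ t1.
move/pr_inj; rewrite !nE !expr_le1// => /(_ rs1 rt1)[[e1 e2]|[]].
  have rr : rad s = rad t.
    by apply/eqP; rewrite -(@eqrXn2 _ 2%N)// -!nE e1 e2.
  apply: I01_val_inj; move: rr ds dt e1 e2; rewrite /rad /dir.
  case: ifPn => hs; case: ifPn => ht rr ds dt; try (move=> _ _; lra).
    case: dt => [|dt]; first by rewrite ?(negbTE ht).
    have nz := lt0r_neq0 dt; rewrite rr => /(mulfI nz) e1 /(mulfI nz) e2.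
    case: ij; move: e2 e1; rewrite /corner /circle /=.
    by move=> -> ->.
  case: ds => [|ds]; first by rewrite ?(negbTE hs).
  have nz := lt0r_neq0 ds; rewrite -rr => /(mulfI nz) e1 /(mulfI nz) e2.
  case: ij; move: e2 e1; rewrite /corner /circle /=.
  by move=> -> ->.
have sq x : 0 <= x -> x ^+ 2 = 1 -> x = 1 :> R.
  by move=> x0 /eqP; rewrite sqrf_eq1 => /orP[/eqP//|/eqP x1]; rewrite x1 in x0; lra.
move=> /(sq _ rs0) + /(sq _ rt0); move: ds dt; rewrite /rad => ds dt.
by case: ifPn => hs; case: ifPn => ht e1 e2; apply: I01_val_inj; lra.
Qed.

End octagon.

(** * Standard generators of the fundamental group *)

Section generators.
Context (R : realType).
Local Notation I := (I01 R).
Local Notation base := (@base R).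

(** Out along the radius to corner i, back along the radius to corner j. Products telescope, so
    relations reduce to bookkeeping on indices, with [spoke_glue] translating between glued
    sides. *)
Definition spoke_loop i j (hi : (i <= 8)%N) (hj : (j <= 8)%N) : fundamental_group R base :=
  path_quotient (spoke R hi) (spoke R hj).
Local Notation loop i j := (@spoke_loop i j isT isT).

Definition gen_a := loop 4 1.
Definition gen_b := loop 1 2.
Definition gen_c := loop 0 5.
Definition gen_d := loop 5 6.

Lemma spoke_loopM i j k (hi : (i <= 8)%N) (hj : (j <= 8)%N) (hk : (k <= 8)%N) :
  (spoke_loop hi hj * spoke_loop hj hk)%g = spoke_loop hi hk.
Proof. exact: path_quotientM. Qed.

Lemma spoke_loopV i j (hi : (i <= 8)%N) (hj : (j <= 8)%N) :
  ((spoke_loop hi hj)^-1)%g = spoke_loop hj hi.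
Proof. exact: path_quotientV. Qed.

Lemma spoke_loop23 : loop 2 3 = (gen_a^-1)%g.
Proof. by rewrite spoke_loopV; apply/esym; exact: (@spoke_glue _ 1). Qed.

Lemma spoke_loop03 : loop 0 3 = gen_b.
Proof. exact: (@spoke_glue _ 0). Qed.

Lemma spoke_loop30 : loop 3 0 = (gen_b^-1)%g.
Proof. by rewrite -spoke_loop03 spoke_loopV. Qed.

Lemma spoke_loop74 : loop 7 4 = (gen_d^-1)%g.
Proof. by rewrite spoke_loopV -[LHS]spoke_loopV; apply/esym; rewrite -spoke_loopV; congr (_^-1)%g; exact/esym/(@spoke_glue _ 4). Qed.

(** Corner 8 occurs as the last end of side 7, which is glued to side 5. *)
Lemma spoke8 : spoke R (k := 8) isT = spoke R (k := 0) isT.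
Proof.
rewrite /spoke; move: (pr_corner _ _) => h8; move: (pr_corner _ _) => h0.
have e : corner R 8 = corner R 0.
  rewrite /corner mul0r -[RHS]circle2pi; congr circle; rewrite add0r -mulr_natr; lra.
by case: _ / e h0 => h0; congr segment; exact: Prop_irrelevance.
Qed.

Lemma spoke_loop67 : loop 6 7 = (gen_c^-1)%g.
Proof.
rewrite spoke_loopV; rewrite /spoke_loop -spoke8.
by apply/esym; exact: (@spoke_glue _ 5).
Qed.

Lemma spoke_loop04 : loop 0 4 = comm gen_c gen_d.
Proof. by rewrite /comm -spoke_loop67 -spoke_loop74 !spoke_loopM. Qed.

Lemma spoke_loop71 : loop 7 1 = (gen_d^-1 * gen_a)%g.
Proof. by rewrite -spoke_loop74 spoke_loopM. Qed.

(** [a, b] telescopes to the loop from spoke 4 to spoke 0, and [c, d] to the loop from spoke 0 to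
    spoke 4. *)
Lemma surface_relation : (comm gen_a gen_b * comm gen_c gen_d)%g = 1%g.
Proof.
rewrite -spoke_loop04 /comm -spoke_loop23 -spoke_loop30 !spoke_loopM.
exact: path_quotient1.
Qed.

Lemma cos_piquarter_gt0 : 0 < cos (pi / 4) :> R.
Proof. by have := pi_gt0 R => p0; apply: cos_gt0_pihalf; apply/andP; split; lra. Qed.

Lemma sin_piquarter_gt0 : 0 < sin (pi / 4) :> R.
Proof. by have := pi_gt0 R => p0; apply: sin_gt0_pihalf; apply/andP; split; lra. Qed.

Lemma simple_a : simple_closed_curve gen_a.
Proof.
apply: simple_spokes => -[_]; rewrite (_ : 4 * _ = pi :> R); last by field.
by rewrite sinpi mul1r => e; have := sin_piquarter_gt0; rewrite -e ltxx.
Qed.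

Lemma simple_cd : simple_closed_curve (comm gen_c gen_d).
Proof.
rewrite -spoke_loop04; apply: simple_spokes => -[+ _].
rewrite (_ : 4 * _ = pi :> R); last by field.
by rewrite cospi mul0r cos0; lra.
Qed.

Lemma simple_da : simple_closed_curve (gen_d^-1 * gen_a)%g.
Proof.
rewrite -spoke_loop71; apply: simple_spokes => -[_].
rewrite (_ : 7 * _ = - (pi / 4) + pi *+ 2 :> R); last by rewrite -mulr_natr; field.
by rewrite sinD2pi sinN mul1r; have := sin_piquarter_gt0; lra.
Qed.

End generators.

(** * Homeomorphisms of the surface defined on the octagon; its symmetries *)

Section surface_maps.
Context (R : realType).
Local Notation I := (I01 R).
Local Notation base := (@base R).
Implicit Types (u v : R * R) (a : R).

Definition glue_invariant (T : Type) (g : R * R -> T) : Prop :=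
  forall k a, k \in [:: 0; 1; 4; 5]%N -> k%:R * (pi / 4) <= a <= (k%:R + 1) * (pi / 4) ->
  g (circle a) = g (circle ((2 * k%:R + 3) * (pi / 4) - a)).

Lemma surface_lift (T : topologicalType) (g : R * R -> T) :
  continuous (fun w : disc R => g (disc_val w)) -> glue_invariant g ->
  {h : Sigma2 R -> T | continuous h & forall u, sqnorm u <= 1 -> h (pr u) = g u}.
Proof.
move=> cg gg; pose g' (w : disc R) := g (disc_val w).
have inv w z : glued w z -> g' w = g' z.
  elim=> [k s kin /andP[s0 s1]|//|u v _ -> //|u v x _ -> _ -> //].
  have p0 := pi_gt0 R; have := @gg k ((k%:R + s) * (pi / 4)) kin.
  rewrite /g' /disc_val !set_valE /= => -> //; last first.
    by apply/andP; split; rewrite ler_pM2r ?divr_gt0//; lra.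
  by congr g; rewrite /boundary_fun /circle; congr (cos _, sin _); ring.
exists (g' \o repr).
  apply: repr_comp_continuous => // w z /eqP e; apply/eqP/inv/projP; exact: e.
move=> u u1; rewrite /=.
have /projP := reprK (pr u) : proj (repr (pr u)) = proj (retract u).
by move/inv ->; rewrite /g' retract_id.
Qed.


Lemma pr_surj (x : Sigma2 R) : exists2 u, sqnorm u <= 1 & x = pr u.
Proof.
exists (disc_val (repr x)); first exact: disc_valP.
by rewrite pr_disc; apply/esym; exact: reprK.
Qed.

Lemma disc_val_continuous : continuous (@disc_val R).
Proof. exact: initial_continuous. Qed.

Lemma surface_homeo (f g : R * R -> Sigma2 R) (hf hg : Sigma2 R -> Sigma2 R) :
  continuous hf -> (forall u, sqnorm u <= 1 -> hf (pr u) = f u) ->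
  continuous hg -> (forall u, sqnorm u <= 1 -> hg (pr u) = g u) ->
  (forall u, sqnorm u <= 1 -> hg (f u) = pr u) ->
  (forall u, sqnorm u <= 1 -> hf (g u) = pr u) -> f (0, 0) = base ->
  {h : pointed_homeo base | forall u, sqnorm u <= 1 -> h (pr u) = f u}.
Proof.
move=> cf fE cg gE gf fg f0.
have n0 : sqnorm (0, 0) <= 1 :> R by rewrite /sqnorm /= expr0n addr0 ler01.
have b0 : hf base = base by rewrite -[in LHS]pr0 fE// f0.
have fK : cancel hf hg by move=> x; have [u u1 ->] := pr_surj x; rewrite fE// gf.
have gK : cancel hg hf by move=> x; have [u u1 ->] := pr_surj x; rewrite gE// fg.
by exists (PointedHomeo cf cg fK gK b0).
Qed.

Lemma spoke_path_map k k' (hk : (k <= 8)%N) (hk' : (k' <= 8)%N) (h : pointed_homeo base)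
    (hv : h (vertex R) = vertex R) :
  (forall t, 0 <= t <= 1 -> h (pr (t * (corner R k).1, t * (corner R k).2)) =
                            pr (t * (corner R k').1, t * (corner R k').2)) ->
  path_map (homeo_continuous h) (homeo_base h) hv (spoke R hk) = spoke R hk'.
Proof.
move=> hE; apply/path_eqP => t; rewrite path_mapE /spoke !segmentE /segment_fun !mulr0 !add0r.
by apply: hE; rewrite I01_ge0 I01_le1.
Qed.

Lemma sqnorm_corner k t : 0 <= t <= 1 -> sqnorm (t * (corner R k).1, t * (corner R k).2) <= 1.
Proof.
move=> /andP[t0 t1]; rewrite /sqnorm /= !exprMn -mulrDr cos2Dsin2 mulr1.
by rewrite expr_le1.
Qed.

Section involution.
Context (m : R * R -> R * R) (k' : nat -> nat).
Hypotheses (m_cont : continuous m) (mK : involutive m)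
  (m_norm : forall u, sqnorm (m u) = sqnorm u) (m_glue : glue_invariant (fun u => pr (m u)))
  (m_scale : forall t u, m (t * u.1, t * u.2) = (t * (m u).1, t * (m u).2))
  (m_corner : forall k, (k < 8)%N -> m (corner R k) = corner R (k' k)).

(** m commutes with the scaling of radii, so it maps spokes to spokes. On the surface the induced
    map is its own inverse. *)
Lemma involution_homeo : exists h : pointed_homeo base, forall i j (hi : (i <= 8)%N) (hj : (j <= 8)%N)
  (hi' : (k' i <= 8)%N) (hj' : (k' j <= 8)%N), (i < 8)%N -> (j < 8)%N ->
  induced h (spoke_loop R hi hj) = spoke_loop R hi' hj'.
Proof.
have cm : continuous (fun w : disc R => pr (m (disc_val w))).
  apply: continuous_compf; first exact: pr_continuous.
  exact: continuous_compf m_cont disc_val_continuous.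
have [h' ch hE'] := surface_lift cm m_glue.
have hK u : sqnorm u <= 1 -> h' (pr (m u)) = pr u by move=> u1; rewrite hE' ?m_norm// /= mK.
have m0 : pr (m (0, 0)) = base.
  by have := m_scale 0 (0, 0); rewrite !mul0r /= => ->; rewrite pr0.
have [h hE] := surface_homeo ch hE' ch hE' hK hK m0.
exists h => i j hi hj hi' hj' i8 j8.
have hc k : (k < 8)%N -> forall t, 0 <= t <= 1 ->
    h (pr (t * (corner R k).1, t * (corner R k).2)) =
    pr (t * (corner R (k' k)).1, t * (corner R (k' k)).2).
  by move=> k8 t t01; rewrite hE ?sqnorm_corner// m_scale m_corner.
have hv : h (vertex R) = vertex R.
  have := hc _ i8 1; rewrite !mul1r ler01 lexx -!surjective_pairing => /(_ isT).
  by rewrite !pr_corner.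
rewrite /spoke_loop (induced_path_quotient hv).
by rewrite (@spoke_path_map _ (k' i) _ hi')//; [rewrite (@spoke_path_map _ (k' j) _ hj')//|]; exact: hc.
Qed.

End involution.

Lemma continuous_fst_neg : continuous (fun u => (- u.1, u.2)).
Proof.
apply: continuous_pair; last by cts.
by move=> u; apply: cvgN; exact: cvg_fst.
Qed.

Lemma rotate_continuous : continuous (fun u : R * R => (- u.1, - u.2)).
Proof. by apply: continuous_pair => u; apply: cvgN; [exact: cvg_fst|exact: cvg_snd]. Qed.

Lemma reflect_glue : glue_invariant (fun u : R * R => pr (- u.1, u.2)).
Proof.
have p0 := pi_gt0 R.
have E a : (- cos a, sin a) = circle (pi - a) by rewrite /circle cosB sinB cospi sinpi; congr (_, _); ring.
move=> k a kin a01; rewrite /= !E; move: kin a01; rewrite !inE => /or4P[]/eqP-> /andP[a0 a1].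
- rewrite (@pr_glue _ 1 (pi - ((2 * 0%:R + 3) * (pi / 4) - a))) //; last by apply/andP; split; lra.
  by congr (pr (circle _)); lra.
- rewrite (@pr_glue _ 0 (pi - ((2 * 1%:R + 3) * (pi / 4) - a))) //; last by apply/andP; split; lra.
  by congr (pr (circle _)); lra.
- rewrite -[circle (pi - (_ - _))]circle2pi.
  rewrite (@pr_glue _ 5 (pi - ((2 * 4%:R + 3) * (pi / 4) - a) + pi *+ 2)) //; last by apply/andP; split; lra.
  by rewrite -[circle (pi - a)]circle2pi; congr (pr (circle _)); lra.
- rewrite -[circle (pi - (_ - _))]circle2pi.
  rewrite (@pr_glue _ 4 (pi - ((2 * 5%:R + 3) * (pi / 4) - a) + pi *+ 2)) //; last by apply/andP; split; lra.
  by rewrite -[circle (pi - a)]circle2pi; congr (pr (circle _)); lra.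
Qed.

Lemma rotate_glue : glue_invariant (fun u : R * R => pr (- u.1, - u.2)).
Proof.
have p0 := pi_gt0 R.
have E a : (- cos a, - sin a) = circle (a + pi) by rewrite /circle cosDpi sinDpi.
move=> k a kin a01; rewrite /= !E; move: kin a01; rewrite !inE => /or4P[]/eqP-> /andP[a0 a1].
- rewrite (@pr_glue _ 4 (a + pi)) //; last by apply/andP; split; lra.
  by congr (pr (circle _)); lra.
- rewrite (@pr_glue _ 5 (a + pi)) //; last by apply/andP; split; lra.
  by congr (pr (circle _)); lra.
- rewrite (_ : circle (a + pi) = circle (a - pi)); last by rewrite -[RHS]circle2pi; congr circle; ring.
  rewrite (@pr_glue _ 0 (a - pi)) //; last by apply/andP; split; lra.
  by rewrite -[LHS]/(pr _) -[X in pr X = _]circle2pi; congr (pr (circle _)); lra.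
- rewrite (_ : circle (a + pi) = circle (a - pi)); last by rewrite -[RHS]circle2pi; congr circle; ring.
  rewrite (@pr_glue _ 1 (a - pi)) //; last by apply/andP; split; lra.
  by rewrite -[LHS]/(pr _) -[X in pr X = _]circle2pi; congr (pr (circle _)); lra.
Qed.

(** Reflection in the vertical axis, which sends corner k to corner 4 - k modulo 8. It reverses the
    orientation; the relation with value -1 nevertheless survives the exchange of the generators
    ([relation_reflect]). *)
Lemma reflect_homeo : exists h : pointed_homeo base,
  [/\ induced h (gen_a R) = gen_b R, induced h (gen_b R) = gen_a R,
      induced h (gen_c R) = gen_d R & induced h (gen_d R) = gen_c R].
Proof.
have [||||h hE] := @involution_homeo (fun u => (- u.1, u.2)) (nth 0 [:: 4; 3; 2; 1; 0; 7; 6; 5])%N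
    continuous_fst_neg _ _ reflect_glue.
- by case=> x y; rewrite /= opprK.
- by move=> u; rewrite /sqnorm /= sqrrN.
- by move=> t u /=; rewrite mulrN.
- have E a : (- cos a, sin a) = circle (pi - a).
    by rewrite /circle cosB sinB cospi sinpi; congr (_, _); ring.
  have E2 (x : R) n : pi - x = n%:R * (pi / 4) \/ pi - x + pi *+ 2 = n%:R * (pi / 4) ->
      circle (pi - x) = corner R n.
    by move=> [e|e]; [|rewrite -circle2pi]; rewrite e.
  move=> k k8; rewrite /corner /= E; apply: E2; move: k k8.
  by do 5 (case=> [_|]; first by left; rewrite /=; field); do 3 (case=> [_|]; first by right; rewrite -mulr_natr /=; field).
exists h; split.
- by rewrite /gen_a (hE 4 1 isT isT isT isT isT isT)%N spoke_loop03.
- by rewrite /gen_b (hE 1 2 isT isT isT isT isT isT)%N -[LHS]spoke_loopV spoke_loop23 invgK.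
- by rewrite /gen_c (hE 0 5 isT isT isT isT isT isT)%N -[LHS]spoke_loopV spoke_loop74 invgK.
- by rewrite /gen_d (hE 5 6 isT isT isT isT isT isT)%N -[LHS]spoke_loopV spoke_loop67 invgK.
Qed.

Lemma rotate_homeo : exists h : pointed_homeo base,
  [/\ induced h (gen_a R) = gen_c R, induced h (gen_b R) = gen_d R,
      induced h (gen_c R) = gen_a R & induced h (gen_d R) = gen_b R].
Proof.
have [||||h hE] := @involution_homeo (fun u => (- u.1, - u.2)) (nth 0 [:: 4; 5; 6; 7; 0; 1; 2; 3])%N
    rotate_continuous _ _ rotate_glue.
- by case=> x y; rewrite /= !opprK.
- by move=> u; rewrite /sqnorm /= !sqrrN.
- by move=> t u /=; rewrite !mulrN.
- have E a : (- cos a, - sin a) = circle (a + pi) by rewrite /circle cosDpi sinDpi.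
  have E2 (x : R) n : x + pi = n%:R * (pi / 4) \/ x + pi = n%:R * (pi / 4) + pi *+ 2 ->
      circle (x + pi) = corner R n.
    by move=> [->|->]; rewrite ?circle2pi.
  move=> k k8; rewrite /corner /= E; apply: E2; move: k k8.
  by do 4 (case=> [_|]; first by left; rewrite /=; field); do 4 (case=> [_|]; first by right; rewrite -mulr_natr /=; field).
exists h; split.
- by rewrite /gen_a (hE 4 1 isT isT isT isT isT isT)%N.
- by rewrite /gen_b (hE 1 2 isT isT isT isT isT isT)%N.
- by rewrite /gen_c (hE 0 5 isT isT isT isT isT isT)%N.
- by rewrite /gen_d (hE 5 6 isT isT isT isT isT isT)%N.
Qed.

End surface_maps.

(** * Dehn twists *)

Section twist.
Context (R : realType).
Local Notation I := (I01 R).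
Local Notation base := (@base R).
Implicit Types (u v : R * R).

Context (kappa : R * R -> Sigma2 R) (T1 S1 B1 T2 S2 B2 : R * R -> R).

(* kappa parametrizes an annulus by an angle in [0, 1] (whose ends are identified)
   and a height in [0, 1]. In the octagon the annulus is the union of the two
   disjoint bands B1 <= 0 and B2 <= 0, on which (Ti, Si) are the coordinates. *)
Definition chart_at u (t s : R) : Prop :=
  [/\ B1 u <= 0, T1 u = t & S1 u = s] \/ [/\ B2 u <= 0, T2 u = t & S2 u = s].

Definition outside u : Prop := 0 <= B1 u /\ 0 <= B2 u.

(** Conditions under which the shear (t, s) -> (t + s, s) of the annulus, extended by the identity,
    descends to the surface. [chart_glue] says that two glued boundary points are both outside, or
    have the same height and the same angle modulo 1. *)
Record twist_chart : Prop := TwistChart {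
  chart_cont : continuous kappa;
  chart_closed : forall s, kappa (0, s) = kappa (1, s);
  chart_cont1 : [/\ continuous T1, continuous S1 & continuous B1];
  chart_cont2 : [/\ continuous T2, continuous S2 & continuous B2];
  chart_disjoint : forall u, sqnorm u <= 1 -> B1 u <= 0 -> 0 < B2 u;
  chart_range : forall u t s, sqnorm u <= 1 -> chart_at u t s -> 0 <= t <= 1 /\ 0 <= s <= 1;
  chart_pr : forall u t s, sqnorm u <= 1 -> chart_at u t s -> pr u = kappa (t, s);
  chart_edge1 : forall u, sqnorm u <= 1 -> B1 u = 0 -> S1 u = 0 \/ S1 u = 1;
  chart_edge2 : forall u, sqnorm u <= 1 -> B2 u = 0 -> S2 u = 0 \/ S2 u = 1;
  chart_surj : forall t s, 0 <= t <= 1 -> 0 <= s <= 1 -> exists2 u, sqnorm u <= 1 & chart_at u t s;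
  chart_glue : forall k a, k \in [:: 0; 1; 4; 5]%N ->
    k%:R * (pi / 4) <= a <= (k%:R + 1) * (pi / 4) ->
    let u := circle a in let v := circle ((2 * k%:R + 3) * (pi / 4) - a) in
    (outside u /\ outside v) \/
    (exists t t' s, [/\ chart_at u t s, chart_at v t' s & t = t' \/ (t = 0 /\ t' = 1) \/ (t = 1 /\ t' = 0)]);
  chart_center : outside (0, 0) }.

Hypothesis chart : twist_chart.

(** [kappa] made 1-periodic in the angle over [-1, 2], the range of t + s and t - s. *)
Definition unroll u : Sigma2 R :=
  if u.1 <= 0 then kappa (u.1 + 1, u.2)
  else if u.1 <= 1 then kappa u else kappa (u.1 - 1, u.2).

Lemma unroll_continuous : continuous unroll.
Proof.
have ck := chart_cont chart; have kc := chart_closed chart.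
apply: pasting; first by cts.
- apply: continuous_compf ck _; apply: continuous_pair; cts.
- apply: pasting; first by cts.
  + exact: ck.
  + apply: continuous_compf ck _; apply: continuous_pair; cts.
  + by case=> x y /= ->; rewrite subrr kc.
- by case=> x y /= ->; rewrite add0r ler01 kc.
Qed.

Lemma unroll_id t s : 0 <= t <= 1 -> unroll (t, s) = kappa (t, s).
Proof.
move=> /andP[t0 t1]; rewrite /unroll /= t1; case: ifPn => // tn.
have -> : t = 0 by lra.
by rewrite add0r (chart_closed chart).
Qed.

Lemma unrollD1 t s : -1 <= t <= 1 -> unroll (t + 1, s) = unroll (t, s).
Proof.
move=> /andP[t0 t1]; have [tn|tp] := leP t 0.
  by rewrite unroll_id /unroll /= ?tn//; apply/andP; split; lra.
have h1 : (t + 1 <= 0) = false by lra.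
have h2 : (t + 1 <= 1) = false by lra.
have h3 : (t <= 0) = false by lra.
by rewrite /unroll /= h1 h2 h3 t1 addrK.
Qed.

(** e = 1 gives the twist and e = -1 its inverse. *)
Definition twist_fun (e : R) u : Sigma2 R :=
  if B1 u <= 0 then unroll (T1 u + e * S1 u, S1 u)
  else if B2 u <= 0 then unroll (T2 u + e * S2 u, S2 u) else pr u.

Lemma twist_fun_chart e u t s : sqnorm u <= 1 -> chart_at u t s ->
  twist_fun e u = unroll (t + e * s, s).
Proof.
move=> u1 [] [b <- <-]; rewrite /twist_fun; first by rewrite b.
by rewrite ifF ?b//; apply/negP => /(chart_disjoint chart u1); rewrite ltNge b.
Qed.

Lemma unroll_edge e u t s : e = 1 \/ e = -1 -> sqnorm u <= 1 -> chart_at u t s ->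
  s = 0 \/ s = 1 -> unroll (t + e * s, s) = pr u.
Proof.
move=> e1 u1 uts; have [/andP[t0 t1] _] := chart_range chart u1 uts.
rewrite (chart_pr chart u1 uts) => -[->|->].
  by rewrite mulr0 addr0 unroll_id ?t0.
rewrite mulr1; case: e1 => ->; first by rewrite unrollD1 ?unroll_id ?t0//; apply/andP; split; lra.
by rewrite -unrollD1 ?subrK ?unroll_id ?t0//; apply/andP; split; lra.
Qed.

Lemma twist_fun_outside e u : e = 1 \/ e = -1 -> sqnorm u <= 1 -> outside u ->
  twist_fun e u = pr u.
Proof.
move=> e1 u1 [b1 b2]; rewrite /twist_fun; case: ifPn => h1.
  have b10 : B1 u = 0 by apply/eqP; rewrite eq_le h1.
  by apply: unroll_edge => //; [left|exact: (chart_edge1 chart)].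
case: ifPn => // h2; have b20 : B2 u = 0 by apply/eqP; rewrite eq_le h2.
by apply: unroll_edge => //; [right|exact: (chart_edge2 chart)].
Qed.

Lemma twist_fun_continuous e : e = 1 \/ e = -1 ->
  continuous (fun w : disc R => twist_fun e (disc_val w)).
Proof.
move=> e1; have [cT1 cS1 cB1] := chart_cont1 chart; have [cT2 cS2 cB2] := chart_cont2 chart.
have cd f : continuous f -> continuous (fun w : disc R => f (disc_val w) : R).
  by move=> cf; apply: continuous_compf cf (@disc_val_continuous R).
have cu (T S : R * R -> R) : continuous T -> continuous S -> continuous
    (fun w : disc R => unroll (T (disc_val w) + e * S (disc_val w), S (disc_val w))).
  move=> cT cS; apply: continuous_compf unroll_continuous _.
  by apply: continuous_pair; [apply: continuous_add; [exact: cd|apply: continuous_mul; [cts|exact: cd]]|exact: cd].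
apply: (@pasting _ _ _ (fun w : disc R => B1 (disc_val w))).
- exact: cd.
- exact: cu.
- apply: (@pasting _ _ _ (fun w : disc R => B2 (disc_val w))).
  + exact: cd.
  + exact: cu.
  + exact: continuous_compf (@pr_continuous R) (@disc_val_continuous R).
  + move=> w b2; have w1 := disc_valP w; apply: unroll_edge => //.
      by right; rewrite b2.
    exact: (chart_edge2 chart).
- move=> w b1; have w1 : sqnorm (disc_val w) <= 1 := disc_valP w.
  have b2 : 0 < B2 (disc_val w) by apply: (chart_disjoint chart); rewrite ?b1.
  rewrite ifF; last by lra.
  apply: unroll_edge => //; first by left; rewrite b1.
  exact: (chart_edge1 chart).
Qed.

Lemma twist_fun_glue e : e = 1 \/ e = -1 -> glue_invariant (twist_fun e).
Proof.
move=> e1 k a kin a01; have ar := sqnorm_circle.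
have c1 x : sqnorm (circle x) <= 1 :> R by rewrite sqnorm_circle.
have [[nu nv]|[t [t' [s [ut vt tt]]]]] := chart_glue chart kin a01.
  by rewrite !twist_fun_outside//; exact: pr_glue.
rewrite (twist_fun_chart e (c1 _) ut) (twist_fun_chart e (c1 _) vt).
have [_ /andP[s0 s1]] := chart_range chart (c1 _) ut.
case: tt => [-> //|[[-> ->]|[-> ->]]].
  rewrite add0r [1 + _]addrC unrollD1//.
  by case: e1 => ->; apply/andP; split; lra.
rewrite add0r [1 + _]addrC unrollD1//.
by case: e1 => ->; apply/andP; split; lra.
Qed.

Lemma twist_lift e : e = 1 \/ e = -1 -> {h : Sigma2 R -> Sigma2 R | continuous h &
  forall u, sqnorm u <= 1 -> h (pr u) = twist_fun e u}.
Proof. by move=> e1; apply: surface_lift; [exact: twist_fun_continuous|exact: twist_fun_glue]. Qed.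

Lemma twist_inverse e (h : Sigma2 R -> Sigma2 R) : e = 1 \/ e = -1 ->
  (forall u, sqnorm u <= 1 -> h (pr u) = twist_fun (- e) u) ->
  forall u, sqnorm u <= 1 -> h (twist_fun e u) = pr u.
Proof.
move=> e1 hE u u1; have e1' : - e = 1 \/ - e = -1 by case: e1 => ->; [right|left; rewrite opprK].
have hk t s : 0 <= t <= 1 -> 0 <= s <= 1 -> h (kappa (t, s)) = unroll (t - e * s, s).
  move=> t01 s01; have [v v1 vts] := chart_surj chart t01 s01.
  by rewrite -(chart_pr chart v1 vts) hE// (twist_fun_chart _ v1 vts) mulNr.
have [nb|[t [s uts]]] : outside u \/ exists t s, chart_at u t s.
  have [b1|b1] := leP (B1 u) 0; first by right; exists (T1 u), (S1 u); left.
  have [b2|b2] := leP (B2 u) 0; first by right; exists (T2 u), (S2 u); right.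
  by left; split; exact: ltW.
  by rewrite twist_fun_outside// hE// twist_fun_outside.
have [/andP[t0 t1] /andP[s0 s1]] := chart_range chart u1 uts.
rewrite (twist_fun_chart _ u1 uts) (chart_pr chart u1 uts).
have [p0 p1] : -1 <= t + e * s /\ t + e * s <= 2 by case: e1 => ->; split; lra.
have kt : unroll (t, s) = kappa (t, s) by rewrite unroll_id// t0.
(* The sheared angle lies in [-1, 2]; a full turn brings it back to [0, 1], where [hk] applies. *)
have [q0|q0] := leP 0 (t + e * s); last first.
  rewrite -unrollD1 ?unroll_id ?hk//; try (by apply/andP; split; lra).
  by rewrite (_ : _ - _ = t + 1); [rewrite unrollD1//; apply/andP; split; lra|ring].
have [q1|q1] := leP (t + e * s) 1.
  rewrite unroll_id ?hk ?addrK//; by apply/andP; split.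
rewrite -[t + e * s](subrK 1) unrollD1 ?unroll_id ?hk//; try (by apply/andP; split; lra).
rewrite (_ : _ - _ = t - 1); last by ring.
by rewrite -unrollD1 ?subrK//; apply/andP; split; lra.
Qed.

Lemma twist_homeo : exists h : pointed_homeo base,
  (forall u, sqnorm u <= 1 -> outside u -> h (pr u) = pr u) /\
  (forall t s, 0 <= t <= 1 -> 0 <= s <= 1 -> h (kappa (t, s)) = unroll (t + s, s)).
Proof.
have e1 : 1 = 1 :> R \/ 1 = -1 :> R by left.
have e2 : -1 = 1 :> R \/ -1 = -1 :> R by right.
have [hf cf fE] := twist_lift e1; have [hg cg gE] := twist_lift e2.
have n0 : sqnorm (0, 0) <= 1 :> R by rewrite /sqnorm /= expr0n addr0 ler01.
have gf := twist_inverse e1 gE.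
have fg := @twist_inverse (-1) hf e2.
rewrite opprK in fg; have {}fg := fg fE.
have [|h hE] := surface_homeo cf fE cg gE gf fg.
  by rewrite twist_fun_outside ?pr0//; exact: (chart_center chart).
exists h; split=> [u u1 o|t s t01 s01]; first by rewrite hE// twist_fun_outside.
have [v v1 vts] := chart_surj chart t01 s01.
by rewrite -(chart_pr chart v1 vts) hE// (twist_fun_chart _ v1 vts) mul1r.
Qed.

(** In the unrolled strip the image of the edge p is the diagonal from (0, 0) to (1, 1). It is
    homotopic to the bottom side, which is l, followed by the right side, which is again p by
    [chart_closed]. *)
Lemma twist_edge (h : pointed_homeo base) x y (hx : h x = x) (hy : h y = y)
    (l : {path I from x to x}) (p : {path I from x to y}) :
  (forall t s, 0 <= t <= 1 -> 0 <= s <= 1 -> h (kappa (t, s)) = unroll (t + s, s)) ->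
  (forall t, l t = kappa (I01_val t, 0)) -> (forall t, p t = kappa (0, I01_val t)) ->
  path_homotopic (path_map (homeo_continuous h) hx hy p) (path_concat l p).
Proof.
move=> hE lE pE; apply: path_homotopic_sym.
apply: (planar_concat_homotopic unroll_continuous (P := fun t => (I01_val t, 0))
  (Q := fun t => (1, I01_val t)) (S := fun t => (I01_val t, I01_val t))).
- by apply: continuous_pair; cts.
- by apply: continuous_pair; cts.
- by apply: continuous_pair; cts.
- by move=> t; rewrite lE unroll_id// I01_ge0 I01_le1.
- by move=> t; rewrite pE (chart_closed chart) unroll_id// ler01 lexx.
- by move=> t; rewrite path_mapE pE hE ?add0r// ?lexx ?ler01// I01_ge0 I01_le1.
- by rewrite I01_zeroE.
- by rewrite I01_zeroE I01_oneE.
- by rewrite I01_oneE.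
Qed.

End twist.

Section half_chord.
Context (R : realType).
Implicit Types (x y : R).

(* Half the length of the vertical chord of abscissa x, kept away from 0 so that
   it is continuously invertible. *)
Definition half_chord x : R := Num.sqrt (Num.max (1 - x ^+ 2) 16^-1).

Lemma half_chord_continuous : continuous half_chord.
Proof.
apply: continuous_compf; first exact: sqrt_continuous.
apply: continuous_maxr; last by cts.
by apply: continuous_sub; [cts|exact: exprn_continuous].
Qed.

Lemma half_chord_gt0 x : 0 < half_chord x.
Proof. by rewrite sqrtr_gt0 lt_max; apply/orP; right; lra. Qed.

Lemma half_chordV_continuous : continuous (fun x => (half_chord x)^-1).
Proof.
by move=> x; apply: cvgV; [rewrite gt_eqF// half_chord_gt0|exact: half_chord_continuous].
Qed.

Lemma half_chord_ge x y : x ^+ 2 + y ^+ 2 <= 1 -> `|y| <= half_chord x.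
Proof.
move=> xy; rewrite -sqrtr_sqr; apply: ler_wsqrtr.
by rewrite le_max; apply/orP; left; lra.
Qed.

Lemma half_chord_eq x y : 4^-1 <= y -> x ^+ 2 + y ^+ 2 = 1 -> half_chord x = y.
Proof.
move=> y4 xy; rewrite /half_chord (_ : Num.max _ _ = y ^+ 2).
  by rewrite sqrtr_sqr ger0_norm//; lra.
have : 0 <= (y - 4^-1) * (y + 4^-1) by rewrite mulr_ge0//; lra.
by move=> h; rewrite (_ : y ^+ 2 = 1 - x ^+ 2); [apply/max_idPl; lra|lra].
Qed.

Lemma half_chordP x : 16^-1 <= 1 - x ^+ 2 -> half_chord x ^+ 2 = 1 - x ^+ 2.
Proof. by move=> h; rewrite /half_chord (max_idPl h) sqr_sqrtr//; lra. Qed.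

Lemma half_chord_small x : 1 - x ^+ 2 <= 16^-1 -> half_chord x = 4^-1.
Proof.
move=> h; rewrite /half_chord (max_idPr h) (_ : 16^-1 = 4^-1 ^+ 2); last by field.
by rewrite sqrtr_sqr ger0_norm//; lra.
Qed.

Definition unit_clamp x : R := Num.max 0 (Num.min 1 x).

Lemma unit_clamp_continuous : continuous unit_clamp.
Proof. by apply: continuous_maxr; [cts|apply: continuous_minr; cts]. Qed.

Lemma unit_clampP x : 0 <= unit_clamp x <= 1.
Proof. by rewrite /unit_clamp le_max lexx /= ge_max ler01 /= ge_min lexx. Qed.

Lemma unit_clamp_id x : 0 <= x <= 1 -> unit_clamp x = x.
Proof. by move=> /andP[x0 x1]; rewrite /unit_clamp (min_idPr x1) (max_idPr x0). Qed.

Lemma cos_piquarter_sqr : cos (pi / 4) ^+ 2 = 2^-1 :> R.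
Proof.
have := cos_mulr2n (pi / 4 : R); rewrite (_ : (pi / 4) *+ 2 = pi / 2 :> R); last first.
  by rewrite -mulr_natr; field.
by rewrite cos_pihalf -mulr_natr => h; lra.
Qed.

Lemma sin_piquarter : sin (pi / 4) = cos (pi / 4) :> R.
Proof.
have := sinBpihalf (- (pi / 4 : R)); rewrite cosN => h.
have := sinBpihalf (pi / 4 : R); rewrite (_ : pi / 4 - pi / 2 = - (pi / 4) :> R); last by field.
by rewrite sinN => /oppr_inj.
Qed.

(** The cosine decreases with the distance to the angle 0 on the circle. *)
Lemma cos_le_far x y : 0 <= x <= pi -> x <= y <= 2 * pi - x -> cos y <= cos x.
Proof.
have p0 := pi_gt0 R; move=> /andP[x0 xp] /andP[xy yx].
have mono z : x <= z -> z <= pi -> cos z <= cos x.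
  move=> xz zp; rewrite leNgt ltr_cos ?in_itv /=; first by rewrite -leNgt.
    by apply/andP; split; lra.
  by apply/andP; split; lra.
have [yp|yp] := leP y pi; first exact: mono.
have -> : cos y = cos (2 * pi - y).
  by rewrite -[LHS]cosN -[LHS]cosD2pi addrC; congr (cos (_ - _)); ring.
by apply: mono; lra.
Qed.

End half_chord.

(** * The Dehn twist about b *)

Section slide.
Context (R : realType).
Local Notation I := (I01 R).
Local Notation base := (@base R).
Implicit Types (u v : R * R).

(** The direction of the axis of symmetry that exchanges the glued sides 0 and 2. The strip between
    the heights y0 and y1 along this axis joins the two sides; it is bounded by the chord of corners
    0 and 3 and by that of corners 1 and 2. *)
Let beta : R := 3 * pi / 8.
Let y0 : R := cos beta.
Let y1 : R := cos (pi / 8).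

Definition slide_x u : R := u.1 * sin beta - u.2 * cos beta.
Definition slide_y u : R := u.1 * cos beta + u.2 * sin beta.
Definition slide_pt (x y : R) : R * R := (x * sin beta + y * cos beta, y * sin beta - x * cos beta).

Lemma slide_ptK u : slide_pt (slide_x u) (slide_y u) = u.
Proof.
have e := cos2Dsin2 beta; case: u => a b; rewrite /slide_pt /slide_x /slide_y /=; congr (_, _).
  by rewrite -[RHS]mulr1 -e; ring.
by rewrite -[RHS]mulr1 -e; ring.
Qed.

Lemma slide_x_pt x y : slide_x (slide_pt x y) = x.
Proof. by have e := cos2Dsin2 beta; rewrite /slide_x /slide_pt /= -[RHS]mulr1 -e; ring. Qed.

Lemma slide_y_pt x y : slide_y (slide_pt x y) = y.
Proof. by have e := cos2Dsin2 beta; rewrite /slide_y /slide_pt /= -[RHS]mulr1 -e; ring. Qed.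

Lemma slide_norm u : slide_x u ^+ 2 + slide_y u ^+ 2 = sqnorm u.
Proof.
have e := cos2Dsin2 beta; rewrite /slide_x /slide_y /sqnorm -[RHS]mulr1 -e; ring.
Qed.

Lemma slide_x_circle a : slide_x (circle a) = sin (beta - a).
Proof. by rewrite /slide_x sinB /=; ring. Qed.

Lemma slide_y_circle a : slide_y (circle a) = cos (beta - a).
Proof. by rewrite /slide_y cosB /=; ring. Qed.

Lemma slide_pt_circle a : slide_pt (sin a) (cos a) = circle (beta - a).
Proof. by rewrite -[RHS]slide_ptK slide_x_circle slide_y_circle subKr. Qed.

Lemma slide_pt_circleN a : slide_pt (- sin a) (cos a) = circle (beta + a).
Proof. by rewrite -{1}[a]opprK sinN opprK -[cos a]cosN slide_pt_circle opprK. Qed.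

Lemma y0_gt0 : 0 < y0.
Proof. by have p := pi_gt0 R; rewrite /y0 /beta; apply: cos_gt0_pihalf; apply/andP; split; lra. Qed.

Lemma y01 : y0 < y1.
Proof.
have p := pi_gt0 R; rewrite /y0 /y1 /beta ltr_cos ?in_itv /=; [lra|..]; apply/andP; split; lra.
Qed.

(** This keeps the strip where [half_chord] is not truncated. *)
Lemma y1_sqr : 16^-1 <= 1 - y1 ^+ 2.
Proof.
have := cos_mulr2n (pi / 8 : R); rewrite (_ : (pi / 8) *+ 2 = pi / 4 :> R); last first.
  by rewrite -mulr_natr; field.
rewrite -/y1 => h; rewrite mulr2n in h; have := cos_piquarter_sqr R; have c0 := cos_piquarter_gt0 R.
move: (cos (pi / 4)) h c0 => c h c0 c2.
suff : c <= 7 / 8 by lra.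
rewrite leNgt; apply/negP => hc.
have : 0 < (c - 7 / 8) * (c + 7 / 8) by rewrite mulr_gt0//; lra.
lra.
Qed.

Lemma slide_height y : y0 <= y <= y1 -> half_chord y ^+ 2 = 1 - y ^+ 2.
Proof.
move=> /andP[a b]; apply: half_chordP; apply: le_trans y1_sqr _.
have h := y0_gt0; have : 0 <= (y1 - y) * (y1 + y) by rewrite mulr_ge0//; lra.
lra.
Qed.

Definition slide_level (s : R) : R := y0 + unit_clamp s * (y1 - y0).

Lemma slide_levelP s : y0 <= slide_level s <= y1.
Proof.
have /andP[c0 c1] := unit_clampP s; have h := y01; rewrite /slide_level.
set c := unit_clamp s in c0 c1 *.
have : 0 <= c * (y1 - y0) by rewrite mulr_ge0//; lra.
have : 0 <= (1 - c) * (y1 - y0) by rewrite mulr_ge0//; lra.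
by move=> *; apply/andP; split; lra.
Qed.

Definition slide_map u : R * R :=
  slide_pt (half_chord (slide_level u.2) * (1 - 2 * u.1)) (slide_level u.2).

Lemma slide_level_continuous : continuous slide_level.
Proof. by apply: continuous_add; cts; exact: unit_clamp_continuous. Qed.

Lemma slide_map_continuous : continuous slide_map.
Proof.
have cl : continuous (fun u : R * R => slide_level u.2).
  by apply: continuous_compf slide_level_continuous _; cts.
have ch : continuous (fun u : R * R => half_chord (slide_level u.2)).
  exact: continuous_compf (@half_chord_continuous R) cl.
by apply: continuous_pair; cts.
Qed.

(** The chord at height cos g ends at the angles beta - g and beta + g, which lie on sides 0 and 2
    because pi / 8 <= g <= beta, and which are glued. *)
Lemma slide_closed s : pr (slide_map (0, s)) = pr (slide_map (1, s)).
Proof.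
rewrite /slide_map /= mulr0 subr0 mulr1 mulr1 (_ : 1 - 2 = -1 :> R); last by ring.
have /andP[l0 l1] := slide_levelP s; set y := slide_level s in l0 l1 *.
have p := pi_gt0 R; have y00 := y0_gt0.
pose g := acos y.
have yr : -1 <= y <= 1 by have h := cos_le1 (pi / 8 : R); rewrite -/y1 in h; apply/andP; split; lra.
have gE : cos g = y by rewrite /g acosK// in_itv.
have g0 : 0 <= g by exact: acos_ge0.
have gp : g <= pi by exact: acos_lepi.
have mono x z : 0 <= x <= pi -> 0 <= z <= pi -> cos z <= cos x -> x <= z.
  by move=> x0 z0; rewrite !leNgt ltr_cos ?in_itv.
have g1 : pi / 8 <= g.
  by apply: mono; rewrite ?gE ?g0//; apply/andP; split; lra.
have g2 : g <= beta.
  by apply: mono; rewrite ?gE ?g0 ?gp// /beta; apply/andP; split; lra.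
have hE : half_chord y = sin g.
  have s0 : 0 <= sin g by apply: sin_ge0_pi; rewrite g0.
  apply/eqP; rewrite -(@eqrXn2 _ 2%N)// ?ltW ?half_chord_gt0//.
  by rewrite slide_height ?l0// -gE sin2cos2.
rewrite hE -gE mulrN mulr1 slide_pt_circle slide_pt_circleN.
rewrite (@pr_glue _ 0)//; last by rewrite /beta in g2 *; apply/andP; split; lra.
by congr (pr (circle _)); rewrite /beta; lra.
Qed.

Definition slide_T u : R := (1 - slide_x u * (half_chord (slide_y u))^-1) * 2^-1.
Definition slide_S u : R := (slide_y u - y0) * (y1 - y0)^-1.
Definition slide_B u : R := Num.max (y0 - slide_y u) (slide_y u - y1).

Lemma slide_B_le0 u : (slide_B u <= 0) = (y0 <= slide_y u <= y1).
Proof. by rewrite /slide_B ge_max !subr_le0. Qed.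

Lemma slide_B_ge0 u : slide_y u <= y0 \/ y1 <= slide_y u -> 0 <= slide_B u.
Proof. by move=> h; rewrite /slide_B le_max !subr_ge0; apply/orP; case: h; [left|right]. Qed.

Lemma slide_S_level u : slide_B u <= 0 -> 0 <= slide_S u <= 1 /\ slide_level (slide_S u) = slide_y u.
Proof.
rewrite slide_B_le0 => /andP[h0 h1]; have h := y01.
have S01 : 0 <= slide_S u <= 1.
  by rewrite /slide_S -/(_ / _) ler_pdivrMr ?subr_gt0// mul1r divr_ge0 ?subr_ge0 ?(ltW h)//= lerD2r.
split=> //; rewrite /slide_level unit_clamp_id// /slide_S divfK ?subrKC//.
by rewrite subr_eq0 gt_eqF.
Qed.

Lemma slide_S_of_level u s : 0 <= s <= 1 -> slide_y u = slide_level s -> slide_S u = s.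
Proof.
move=> s01 e; rewrite /slide_S e /slide_level unit_clamp_id// addrAC subrr add0r mulfK//.
by rewrite subr_eq0 gt_eqF// y01.
Qed.

Lemma slide_xy_continuous : continuous slide_x /\ continuous slide_y.
Proof. by split; [apply: continuous_sub|apply: continuous_add]; cts. Qed.

(** The annulus is a single band of the octagon: with B2 = 1 the second band is empty. *)
Lemma slide_chart : twist_chart (fun u => pr (slide_map u)) slide_T slide_S slide_B
  (fun=> 0) (fun=> 0) (fun=> 1).
Proof.
have p := pi_gt0 R; have [cx cy] := slide_xy_continuous; have y00 := y0_gt0.
have h0 u : 0 < half_chord (slide_y u) by exact: half_chord_gt0.
split.
- exact: continuous_compf (@pr_continuous R) slide_map_continuous.
- exact: slide_closed.
- split; [|by apply: continuous_mul; [apply: continuous_sub|]; cts|].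
    apply: continuous_mul; last by cts.
    apply: continuous_sub; first by cts.
    by apply: continuous_mul => //; exact: continuous_compf (@half_chordV_continuous R) cy.
  by apply: continuous_maxr; cts.
- by split; cts.
- by [].
- move=> u t s u1 [[B <- <-]|[]]; last by rewrite ler10.
  have [S01 _] := slide_S_level B; split=> //.
  have := @half_chord_ge _ (slide_y u) (slide_x u); rewrite addrC slide_norm => /(_ u1).
  rewrite ler_norml => /andP[xl xr].
  have {}xr : slide_x u / half_chord (slide_y u) <= 1 by rewrite ler_pdivrMr// mul1r.
  have {}xl : -1 <= slide_x u / half_chord (slide_y u) by rewrite ler_pdivlMr// mulN1r.
  by rewrite /slide_T; apply/andP; split; lra.
- move=> u t s u1 [[B <- <-]|[]]; last by rewrite ler10.
  have [S01 L] := slide_S_level B.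
  rewrite /slide_map /= L (_ : half_chord _ * _ = slide_x u) ?slide_ptK//.
  rewrite /slide_T [2 * _]mulrC divfK ?pnatr_eq0// subKr mulrC divfK//.
  by rewrite gt_eqF.
- move=> u u1; rewrite /slide_B => B0; have h := y01.
  have : slide_y u = y0 \/ slide_y u = y1.
    by move: B0; case: leP => _ B0; [right|left]; lra.
  rewrite /slide_S => -[->|->]; first by left; rewrite subrr mul0r.
  by right; rewrite mulfV// subr_eq0 gt_eqF.
- by move=> u _ /eqP; rewrite oner_eq0.
- move=> t s /andP[t0 t1] s01; exists (slide_map (t, s)).
    rewrite -slide_norm slide_x_pt slide_y_pt exprMn slide_height ?slide_levelP//=.
    have /andP[l0 l1] := slide_levelP s; set y := slide_level s in l0 l1 *.
    have : (1 - y ^+ 2) * (1 - 2 * t) ^+ 2 <= (1 - y ^+ 2) * 1.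
      rewrite ler_wpM2l//; last by rewrite -[1](expr1n _ 2) expr2 expr2; nra.
      by rewrite -(@slide_height y) ?sqr_ge0// l0.
    lra.
  left; rewrite slide_B_le0 slide_y_pt slide_levelP; split => //=.
    rewrite /slide_T slide_x_pt slide_y_pt /= mulrAC divff ?mul1r; first by field.
    by rewrite gt_eqF// half_chord_gt0.
  by apply: slide_S_of_level => //; rewrite slide_y_pt.
- move=> k a kin a01 u v.
  (* Boundary points at angular distance at least beta from the axis lie below the strip, those at
     distance at most pi / 8 above it. *)
  have far x : beta <= x <= 13 * pi / 8 -> cos x <= y0.
    by move=> /andP[x0 x1]; apply: cos_le_far; rewrite /beta in x0 *; apply/andP; split; lra.
  have near x : - (pi / 8) <= x <= pi / 8 -> y1 <= cos x.
    move=> /andP[x0 x1]; rewrite -(cos_norm x) /y1.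
    have xx : `|x| <= pi / 8 by rewrite ler_norml x0.
    by apply: cos_le_far; rewrite ?normr_ge0 /=; [|apply/andP; split]; lra.
  have one1 : 0 <= 1 :> R by [].
  move: kin a01; rewrite !inE => /or4P[]/eqP kE /andP[a0 a1]; subst k.
  + right; exists 0, 1, (slide_S u).
    have uB : y0 <= slide_y u <= y1.
      rewrite slide_y_circle; have [d0|d0] := leP beta (pi / 8).
        by rewrite /beta in d0; lra.
      have d1 : pi / 8 <= beta - a <= beta by rewrite /beta; apply/andP; split; lra.
      move: d1 => /andP[d1 d2]; apply/andP; split; apply: cos_le_far; rewrite /beta in d1 d2 *; apply/andP; split; lra.
    have vy : slide_y v = slide_y u.
      by rewrite !slide_y_circle -[RHS]cosN; congr cos; rewrite /beta; lra.
    have vx : slide_x v = - slide_x u.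
      by rewrite !slide_x_circle -sinN; congr sin; rewrite /beta; lra.
    have x00 : 0 <= slide_x u.
      by rewrite slide_x_circle; apply: sin_ge0_pi; rewrite /beta; apply/andP; split; lra.
    have ux : half_chord (slide_y u) = slide_x u.
      have n1 := slide_norm u; rewrite sqnorm_circle in n1.
      apply/eqP; rewrite -(@eqrXn2 _ 2%N)// ?(ltW (h0 u))// slide_height// -n1.
      by rewrite addrK.
    have x0 : slide_x u != 0 by rewrite -ux gt_eqF.
    split; last by right; left.
      left; split; rewrite ?slide_B_le0//.
      by rewrite /slide_T ux divff// subrr mul0r.
    left; split; rewrite ?slide_B_le0 /slide_T /slide_S ?vy//.
    by rewrite ux vx mulNr divff// opprK divff// pnatr_eq0.
  + left; split; split => //; apply: slide_B_ge0; rewrite slide_y_circle.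
      by right; apply: near; rewrite /beta; apply/andP; split; lra.
    by left; rewrite -cosN; apply: far; rewrite /beta; apply/andP; split; lra.
  + left; split; split => //; apply: slide_B_ge0; rewrite slide_y_circle; left; rewrite -cosN;
      apply: far; rewrite /beta; apply/andP; split; lra.
  + left; split; split => //; apply: slide_B_ge0; rewrite slide_y_circle; left; rewrite -cosN;
      apply: far; rewrite /beta; apply/andP; split; lra.
- by split => //; apply: slide_B_ge0; left; rewrite /slide_y /= !mul0r addr0 ltW.
Qed.

Lemma slide_corner k : slide_x (corner R k) = sin (beta - k%:R * (pi / 4)) /\
  slide_y (corner R k) = cos (beta - k%:R * (pi / 4)).
Proof. by rewrite /corner slide_x_circle slide_y_circle. Qed.

Lemma slide_level0 : slide_level 0 = y0.
Proof. by rewrite /slide_level unit_clamp_id ?lexx ?ler01// mul0r addr0. Qed.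

Lemma slide_level1 : slide_level 1 = y1.
Proof. by rewrite /slide_level unit_clamp_id ?lexx ?ler01// mul1r addrC subrK. Qed.

Lemma half_chord_slide g : pi / 8 <= g <= beta -> half_chord (cos g) = sin g.
Proof.
have p := pi_gt0 R; move=> /andP[g1 g2].
have s0 : 0 <= sin g by apply: sin_ge0_pi; rewrite /beta in g2; apply/andP; split; lra.
apply/eqP; rewrite -(@eqrXn2 _ 2%N)// ?ltW ?half_chord_gt0// slide_height ?sin2cos2//.
by apply/andP; split; apply: cos_le_far; rewrite /beta in g2 *; apply/andP; split; lra.
Qed.

Lemma slide_map_corner0 : slide_map (0, 0) = corner R 0.
Proof.
have p := pi_gt0 R.
rewrite /slide_map /= slide_level0 mulr0 subr0 mulr1 half_chord_slide ?slide_pt_circle.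
  by rewrite subrr /corner mul0r.
by rewrite lexx andbT /beta; lra.
Qed.

Lemma slide_map_corner3 : slide_map (1, 0) = corner R 3.
Proof.
have p := pi_gt0 R.
rewrite /slide_map /= slide_level0 (_ : 1 - 2 * 1 = -1 :> R); last by ring.
rewrite mulrN1 half_chord_slide ?slide_pt_circleN.
  by rewrite /corner; congr circle; rewrite /beta; field.
by rewrite lexx andbT /beta; lra.
Qed.

Lemma slide_map_corner1 : slide_map (0, 1) = corner R 1.
Proof.
have p := pi_gt0 R.
rewrite /slide_map /= slide_level1 mulr0 subr0 mulr1 half_chord_slide ?slide_pt_circle.
  by rewrite /corner; congr circle; rewrite /beta; field.
by rewrite lexx /= /beta; lra.
Qed.

(** Spoke 1 is spoke 0 followed by an edge E across the annulus, where the twist inserts the loop L,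
    of class b^-1 when based along spoke 0. The spokes 0, 3, 4, 5, 6 are fixed, so c, d and b, read
    as the loop from spoke 0 to spoke 3, are fixed, whereas a returns along spoke 1. *)
Lemma slide_homeo : exists h : pointed_homeo base,
  [/\ induced h (gen_a R) = (gen_a R * gen_b R)%g, induced h (gen_b R) = gen_b R,
      induced h (gen_c R) = gen_c R & induced h (gen_d R) = gen_d R].
Proof.
have [h [hfix hE]] := twist_homeo slide_chart.
have p := pi_gt0 R; have y00 := y0_gt0.
have far x : beta <= x <= 13 * pi / 8 -> cos x <= y0.
  by move=> /andP[x0 x1]; apply: cos_le_far; rewrite /beta in x0 *; apply/andP; split; lra.
have corner_fix k : slide_y (corner R k) <= y0 -> forall t, 0 <= t <= 1 ->
    h (pr (t * (corner R k).1, t * (corner R k).2)) = pr (t * (corner R k).1, t * (corner R k).2).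
  move=> yk t t01; apply: hfix; first exact: sqnorm_corner.
  split=> //; apply: slide_B_ge0; left; rewrite /slide_y /= -!mulrA -mulrDr -/(slide_y _).
  move: t01 => /andP[t0 t1]; have [yn|yp] := leP (slide_y (corner R k)) 0.
    by apply: le_trans (ltW y00); rewrite mulr_ge0_le0.
  by apply: le_trans yk; rewrite ger_pMl.
have yk k : k \in [:: 0; 3; 4; 5; 6]%N -> slide_y (corner R k) <= y0.
  have [_ ->] := slide_corner k; rewrite !inE => kE.
  have [/eqP-> {kE}|k3] := boolP (k == 0)%N; first by rewrite mul0r subr0.
  rewrite -cosN; apply: far; rewrite /beta.
  by move: kE; rewrite (negbTE k3) /= => /or4P[]/eqP->; apply/andP; split; lra.
have hv : h (vertex R) = vertex R.
  have := corner_fix 0%N (yk 0%N isT) 1; rewrite !mul1r ler01 lexx -surjective_pairing.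
  exact.
have sfix k (hk : (k <= 8)%N) : k \in [:: 0; 3; 4; 5; 6]%N ->
    path_map (homeo_continuous h) (homeo_base h) hv (spoke R hk) = spoke R hk.
  by move=> kin; apply: spoke_path_map; exact/corner_fix/yk.
have lfix i j (hi : (i <= 8)%N) (hj : (j <= 8)%N) : i \in [:: 0; 3; 4; 5; 6]%N ->
    j \in [:: 0; 3; 4; 5; 6]%N -> induced h (spoke_loop R hi hj) = spoke_loop R hi hj.
  by move=> iin jin; rewrite /spoke_loop (induced_path_quotient hv) !sfix.
pose E0 (t : I) := slide_map (0, I01_val t).
pose L0 (t : I) := slide_map (I01_val t, 0).
have cE0 : continuous E0.
  by apply: continuous_compf slide_map_continuous _; apply: continuous_pair; cts.
have cL0 : continuous L0.
  by apply: continuous_compf slide_map_continuous _; apply: continuous_pair; cts.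
have E00 : pr (E0 zero) = vertex R by rewrite /E0 I01_zeroE slide_map_corner0.
have E01 : pr (E0 one) = vertex R by rewrite /E0 I01_oneE slide_map_corner1 pr_corner.
have L00 : pr (L0 zero) = vertex R by rewrite /L0 I01_zeroE slide_map_corner0.
have L01 : pr (L0 one) = vertex R by rewrite /L0 I01_oneE slide_map_corner3 pr_corner.
pose E : {path I from vertex R to vertex R} :=
  mk_path (continuous_compf (@pr_continuous R) cE0) E00 E01.
pose L : {path I from vertex R to vertex R} :=
  mk_path (continuous_compf (@pr_continuous R) cL0) L00 L01.
pose s0 := spoke R (k := 0) isT; pose s1 := spoke R (k := 1) isT; pose s3 := spoke R (k := 3) isT.
have s1E : path_homotopic (path_concat s0 E) s1.
  apply: (planar_concat_homotopic (@pr_continuous R) (P := segment_fun (0, 0) (corner R 0))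
    (Q := E0) (S := segment_fun (0, 0) (corner R 1))) => //; try exact: segment_fun_continuous.
  - by rewrite !segment_fun0.
  - by rewrite segment_fun1 /E0 I01_zeroE slide_map_corner0.
  - by rewrite segment_fun1 /E0 I01_oneE slide_map_corner1.
have s3E : path_homotopic (path_concat s0 L) s3.
  apply: (planar_concat_homotopic (@pr_continuous R) (P := segment_fun (0, 0) (corner R 0))
    (Q := L0) (S := segment_fun (0, 0) (corner R 3))) => //; try exact: segment_fun_continuous.
  - by rewrite !segment_fun0.
  - by rewrite segment_fun1 /L0 I01_zeroE slide_map_corner0.
  - by rewrite segment_fun1 /L0 I01_oneE slide_map_corner3.
have hE' : path_homotopic (path_map (homeo_continuous h) hv hv E) (path_concat L E).
  exact: (twist_edge slide_chart).
have key : path_quotient (path_map (homeo_continuous h) (homeo_base h) hv s1) s1 = ((gen_b R)^-1)%g.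
  rewrite -spoke_loop30 /spoke_loop -[RHS](path_quotient_concat _ _ E).
  apply: path_quotient_homotopic; last exact: (path_homotopic_sym s1E).
  apply: path_homotopic_trans (path_map_homotopic _ _ _ (path_homotopic_sym s1E)) _.
  rewrite (path_map_concat _ _ hv) sfix//.
  apply: path_homotopic_trans (path_concat_homotopic (path_homotopic_refl _) hE') _.
  apply: path_homotopic_trans (path_concatA _ _ _) _.
  by apply: path_concat_homotopic; [exact: s3E|exact: path_homotopic_refl].
exists h; split; last 3 first.
- by rewrite -spoke_loop03 lfix.
- exact: lfix.
- exact: lfix.
rewrite /gen_a /spoke_loop (induced_path_quotient hv) sfix// -(path_quotientM _ s1).
by congr (_ * _)%g; rewrite -path_quotientV key invgK.
Qed.

End slide.

Lemma cos2pi_sub (R : realType) (x : R) : cos (2 * pi - x) = cos x.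
Proof. by rewrite -[RHS]cosN -[RHS]cosD2pi mulr2n; congr cos; ring. Qed.

Lemma sin2pi_sub (R : realType) (x : R) : sin (2 * pi - x) = - sin x.
Proof. by rewrite -[RHS]sinN -[RHS]sinD2pi mulr2n; congr sin; ring. Qed.

Lemma cos_piquarter_ge (R : realType) : 7 / 10 <= cos (pi / 4) :> R.
Proof.
have r0 := cos_piquarter_gt0 R; rewrite leNgt; apply/negP => h.
have : 0 < (7 / 10 - cos (pi / 4)) * (7 / 10 + cos (pi / 4)) :> R by rewrite mulr_gt0//; lra.
by have := cos_piquarter_sqr R; lra.
Qed.

(** * The Dehn twist about d^-1 a *)

Section handle.
Context (R : realType).
Local Notation I := (I01 R).
Local Notation base := (@base R).
Implicit Types (u v : R * R).

Let r : R := cos (pi / 4).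

Let r_sqr : r ^+ 2 = 2^-1. Proof. exact: cos_piquarter_sqr. Qed.

Let r_ge : 7 / 10 <= r. Proof. exact: cos_piquarter_ge. Qed.

(* The annulus crosses the sides 1, 3, 4, 6. At height s, it consists of the vertical
   chord of abscissa sin f and of the one whose end points have the angles
   3 pi / 4 + f and - 3 pi / 4 - f, where sin f = s / 2. *)
Definition handle_sin (s : R) : R := unit_clamp s / 2.
Definition handle_cos (s : R) : R := half_chord (handle_sin s).

Lemma handle_sinP s : 0 <= handle_sin s <= 2^-1.
Proof. by have /andP[h0 h1] := unit_clampP s; rewrite /handle_sin; apply/andP; split; lra. Qed.

Lemma handle_cos_sqr s : handle_cos s ^+ 2 = 1 - handle_sin s ^+ 2.
Proof.
have /andP[h0 h1] := handle_sinP s; apply: half_chordP.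
have : 0 <= (2^-1 - handle_sin s) * (2^-1 + handle_sin s) by rewrite mulr_ge0//; lra.
lra.
Qed.

Lemma handle_cosP s : 6 / 7 <= handle_cos s.
Proof.
have /andP[h0 h1] := handle_sinP s; have c0 := half_chord_gt0 (handle_sin s).
have e := handle_cos_sqr s; rewrite -/(handle_cos s) in c0.
rewrite leNgt; apply/negP => h.
have : 0 < (6 / 7 - handle_cos s) * (6 / 7 + handle_cos s) by rewrite mulr_gt0//; lra.
have : 0 <= (2^-1 - handle_sin s) * (2^-1 + handle_sin s) by rewrite mulr_ge0//; lra.
lra.
Qed.

(** As t increases, the annulus runs down the left chord, passes from side 4 to side 6, runs up the
    right chord, and returns from side 1 to side 3. *)
Definition handle_map1 u : R * R :=
  (- (r * (handle_cos u.2 + handle_sin u.2)),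
   r * (handle_cos u.2 - handle_sin u.2) * (1 - 4 * u.1)).
Definition handle_map2 u : R * R := (handle_sin u.2, handle_cos u.2 * (4 * u.1 - 3)).

Definition handle_kappa u : Sigma2 R :=
  if u.1 <= 2^-1 then pr (handle_map1 u) else pr (handle_map2 u).

Lemma handle_angle s : exists a, [/\ pi / 4 <= a <= pi / 2, cos a = handle_sin s & sin a = handle_cos s].
Proof.
have p := pi_gt0 R; have /andP[s0 s1] := handle_sinP s; have c0 := handle_cosP s.
have e := handle_cos_sqr s; have rg := r_ge.
have sr : -1 <= handle_sin s <= 1 by apply/andP; split; lra.
pose a := acos (handle_sin s).
have aE : cos a = handle_sin s by rewrite /a acosK// in_itv.
have a0 : 0 <= a by exact: acos_ge0.
have ap : a <= pi by exact: acos_lepi.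
have mono x z : 0 <= x <= pi -> 0 <= z <= pi -> cos z <= cos x -> x <= z.
  by move=> x0 z0; rewrite !leNgt ltr_cos ?in_itv.
exists a; split => //.
  apply/andP; split; apply: mono; rewrite ?aE ?cos_pihalf -/r ?a0//; try (by apply/andP; split; lra).
  lra.
apply/eqP; rewrite -(@eqrXn2 _ 2%N)// ?sin2cos2 ?aE ?e//; last by lra.
by apply: sin_ge0_pi; rewrite a0.
Qed.

Lemma handle_map1_circle s a : cos a = handle_sin s -> sin a = handle_cos s ->
  (- (r * (handle_cos s + handle_sin s)), r * (handle_cos s - handle_sin s)) =
  circle (5 * (pi / 4) - a).
Proof.
move=> <- <-; rewrite (_ : 5 * (pi / 4) - a = pi / 4 - a + pi); last by field.
by rewrite /circle cosDpi sinDpi cosB sinB sin_piquarter -/r; congr (_, _); ring.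
Qed.

Lemma circleN a : circle (- a) = ((circle a).1, - (circle a).2) :> R * R.
Proof. by rewrite /circle cosN sinN. Qed.

Lemma handle_glue_top s : pr (handle_map1 (0, s)) = pr (handle_map2 (1, s)).
Proof.
have [a [/andP[a0 a1] ca sa]] := handle_angle s.
rewrite /handle_map1 /handle_map2 /=.
rewrite (_ : r * _ * _ = r * (handle_cos s - handle_sin s)); last by ring.
rewrite (handle_map1_circle ca sa) (_ : _ * (4 * 1 - 3) = handle_cos s); last by ring.
rewrite -ca -sa.
rewrite -[(cos a, sin a)]/(circle a) (@pr_glue _ 1 a)//; last by apply/andP; split; lra.
by congr (pr (circle _)); ring.
Qed.

Lemma handle_glue_bottom s : pr (handle_map1 (2^-1, s)) = pr (handle_map2 (2^-1, s)).
Proof.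
have [a [/andP[a0 a1] ca sa]] := handle_angle s.
have := handle_map1_circle ca sa; rewrite /circle => -[e1 e2].
rewrite /handle_map1 /handle_map2 /= (_ : 1 - 4 * 2^-1 = -1 :> R); last by field.
rewrite (_ : 4 * 2^-1 - 3 = -1 :> R); last by field.
rewrite !mulrN1 e1 e2 -ca -sa.
have -> : (cos (5 * (pi / 4) - a), - sin (5 * (pi / 4) - a)) = circle (3 * (pi / 4) + a).
  rewrite -[LHS](circleN (5 * (pi / 4) - a)) -[LHS]circle2pi; congr circle.
  by rewrite [pi *+ 2]mulr2n; field.
rewrite (@pr_glue _ 4 (3 * (pi / 4) + a))//; last by apply/andP; split; lra.
rewrite -(circleN a) -[X in _ = pr X]circle2pi; congr (pr (circle _)).
by rewrite [pi *+ 2]mulr2n; field.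
Qed.

Lemma handle_kappa1 t s : t <= 2^-1 -> handle_kappa (t, s) = pr (handle_map1 (t, s)).
Proof. by rewrite /handle_kappa /= => ->. Qed.

Lemma handle_kappa2 t s : 2^-1 <= t -> handle_kappa (t, s) = pr (handle_map2 (t, s)).
Proof.
rewrite /handle_kappa /= le_eqVlt => /orP[/eqP<-|t2]; first by rewrite lexx handle_glue_bottom.
by rewrite ifF//; apply/negbTE; rewrite -ltNge.
Qed.

Definition handle_T1 u : R := (1 - u.2 * (half_chord u.1)^-1) * 4^-1.
(** On the left chord the half length is r (cos f - sin f) and the abscissa - r (cos f + sin f).
    Their sum is - 2 r sin f, and 4 r^2 sin f = 2 sin f = s. *)
Definition handle_S1 u : R := - (2 * r * (half_chord u.1 + u.1)).
(** The term [u.1 + 4^-1] confines this band to the left half of the disc, away from the other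
    one. *)
Definition handle_B1 u : R := Num.max (Num.max (- handle_S1 u) (handle_S1 u - 1)) (u.1 + 4^-1).
Definition handle_T2 u : R := (3 + u.2 * (half_chord u.1)^-1) * 4^-1.
Definition handle_S2 u : R := 2 * u.1.
Definition handle_B2 u : R := Num.max (- u.1) (u.1 - 2^-1).

Lemma handle_B1_le0 u : handle_B1 u <= 0 -> [/\ 0 <= handle_S1 u, handle_S1 u <= 1 & u.1 <= - 4^-1].
Proof.
rewrite /handle_B1 !ge_max => /andP[/andP[h1 h2] h3].
by rewrite oppr_le0 in h1; split=> //; lra.
Qed.

Lemma handle_B1_le0r u : 0 <= handle_S1 u <= 1 -> u.1 <= - 4^-1 -> handle_B1 u <= 0.
Proof.
move=> /andP[h1 h2] h3; rewrite /handle_B1 !ge_max oppr_le0 h1 subr_le0 h2 /=; lra.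
Qed.

Lemma handle_B2_le0 u : (handle_B2 u <= 0) = (0 <= u.1 <= 2^-1).
Proof. by rewrite /handle_B2 ge_max oppr_le0 subr_le0. Qed.

(** Near the leftmost point of the disc [half_chord] is truncated, but the formula for the height
    still places these points at or beyond the edge s = 1. *)
Lemma handle_S1_small u : sqnorm u <= 1 -> u.1 <= 0 -> 1 - u.1 ^+ 2 <= 16^-1 -> 1 <= handle_S1 u.
Proof.
case: u => x y; rewrite /sqnorm /handle_S1 /= => n x0 xs; rewrite half_chord_small//.
have rg := r_ge.
(* Here x^2 >= 15 / 16 > (29 / 30)^2. *)
have x1 : x <= - (29 / 30).
  rewrite leNgt; apply/negP => h.
  have : 0 < (x + 29 / 30) * (29 / 30 - x) by rewrite mulr_gt0//; lra.
  lra.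
have : 0 <= (r - 7 / 10) * (- x - 4^-1) by rewrite mulr_ge0//; lra.
lra.
Qed.

Lemma handle_band1 u : sqnorm u <= 1 -> handle_B1 u <= 0 ->
  [/\ half_chord u.1 ^+ 2 = 1 - u.1 ^+ 2, handle_sin (handle_S1 u) = - (r * (half_chord u.1 + u.1)) &
      handle_cos (handle_S1 u) = r * (half_chord u.1 - u.1)].
Proof.
move=> n B1; have [s0 s1 x4] := handle_B1_le0 B1; have rg := r_ge; have r2 := r_sqr.
set w := half_chord u.1.
have w2 : w ^+ 2 = 1 - u.1 ^+ 2.
  have [le|lt] := leP (1 - u.1 ^+ 2) 16^-1; last by apply/half_chordP/ltW.
  have := handle_S1_small n _ le => /(_ ltac:(lra)) s1'.
  have e1 : handle_S1 u = 1 by lra.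
  have [le'|lt'] := leP 16^-1 (1 - u.1 ^+ 2); first exact: half_chordP.
  exfalso; move: e1; rewrite /handle_S1 half_chord_small//.
  have x1 : u.1 <= - (29 / 30).
    rewrite leNgt; apply/negP => h.
    have : 0 < (u.1 + 29 / 30) * (29 / 30 - u.1) by rewrite mulr_gt0//; lra.
    lra.
  have : 0 <= (r - 7 / 10) * (- u.1 - 4^-1) by rewrite mulr_ge0//; lra.
  lra.
have w0 : 4^-1 <= w.
  rewrite /w /half_chord -[4^-1]ger0_norm; last by lra.
  rewrite -sqrtr_sqr; apply: ler_wsqrtr; rewrite le_max; apply/orP; right.
  by rewrite (_ : 4^-1 ^+ 2 = 16^-1)//; field.
have sE : handle_sin (handle_S1 u) = - (r * (w + u.1)).
  by rewrite /handle_sin unit_clamp_id ?s0// /handle_S1 -/w; field.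
split=> //; rewrite /handle_cos sE; apply: half_chord_eq.
  have : 0 <= (r - 7 / 10) * (w - u.1) by rewrite mulr_ge0//; lra.
  lra.
rewrite (_ : _ + _ = 2 * r ^+ 2 * (w ^+ 2 + u.1 ^+ 2)); last by ring.
by rewrite w2 r2; field.
Qed.

Lemma handle_band2 u : handle_B2 u <= 0 ->
  [/\ half_chord u.1 ^+ 2 = 1 - u.1 ^+ 2, handle_sin (handle_S2 u) = u.1 &
      handle_cos (handle_S2 u) = half_chord u.1].
Proof.
rewrite handle_B2_le0 => /andP[x0 x1].
have sE : handle_sin (handle_S2 u) = u.1.
  by rewrite /handle_sin /handle_S2 unit_clamp_id; [field|apply/andP; split; lra].
split=> //; last by rewrite /handle_cos sE.
apply: half_chordP; have : 0 <= (2^-1 - u.1) * (2^-1 + u.1) by rewrite mulr_ge0//; lra.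
lra.
Qed.

Lemma outside_mid u : - r <= u.1 <= 0 -> outside handle_B1 handle_B2 u.
Proof.
move=> /andP[x0 x1]; have rg := r_ge; have r2 := r_sqr; split; last first.
  by rewrite /handle_B2 le_max oppr_ge0 x1.
rewrite /handle_B1 !le_max; apply/orP; left; apply/orP; left.
rewrite /handle_S1 opprK mulr_ge0//; first by lra.
have := @half_chord_ge _ u.1 r; rewrite ger0_norm; last by lra.
move=> h; have : 0 <= (u.1 + r) * (r - u.1) by rewrite mulr_ge0//; lra.
move=> h'; have := h ltac:(lra); lra.
Qed.

Lemma outside_right u : 2^-1 <= u.1 -> outside handle_B1 handle_B2 u.
Proof.
move=> x0; split; rewrite /handle_B1 /handle_B2 !le_max; apply/orP; right; lra.
Qed.

Lemma outside_left u : u.1 <= 0 -> 1 <= handle_S1 u -> outside handle_B1 handle_B2 u.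
Proof.
move=> x0 s1; split; last by rewrite /handle_B2 le_max oppr_ge0 x0.
by rewrite /handle_B1 !le_max; apply/orP; left; apply/orP; right; lra.
Qed.

Lemma half_chord_ratio u : sqnorm u <= 1 -> -1 <= u.2 / half_chord u.1 <= 1.
Proof.
move=> n; have := @half_chord_ge _ u.1 u.2 n; rewrite ler_norml => /andP[h1 h2].
by rewrite ler_pdivlMr ?half_chord_gt0// mulN1r h1 ler_pdivrMr ?half_chord_gt0// mul1r.
Qed.

(** e = 1 treats the upper sides 1 and 3, and e = -1 their mirror images, the lower sides 6 and
    4. *)
Lemma handle_glue a (e : R) (x := cos a) (y := sin a) (x' := cos (5 * (pi / 4) - a))
    (y' := sin (5 * (pi / 4) - a)) : pi / 4 <= a <= pi / 2 -> e = 1 \/ e = -1 ->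
  (outside handle_B1 handle_B2 (x, e * y) /\ outside handle_B1 handle_B2 (x', e * y')) \/
  [/\ handle_B2 (x, e * y) <= 0, handle_T2 (x, e * y) = (3 + e) / 4, handle_B1 (x', e * y') <= 0,
    handle_T1 (x', e * y') = (1 - e) / 4 & handle_S1 (x', e * y') = handle_S2 (x, e * y)].
Proof.
move=> /andP[a0 a1] e1; have p := pi_gt0 R; have rg := r_ge; have r2 := r_sqr.
have ee : e ^+ 2 = 1 by case: e1 => ->; ring.
have xy : x ^+ 2 + y ^+ 2 = 1 by exact: cos2Dsin2.
have x'y' : x' ^+ 2 + y' ^+ 2 = 1 by exact: cos2Dsin2.
have x0 : 0 <= x by apply: cos_ge0_pihalf; apply/andP; split; lra.
have y0 : 0 <= y by apply: sin_ge0_pi; apply/andP; split; lra.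
have [x'E y'E] : x' = - (r * (y + x)) /\ y' = r * (y - x).
  rewrite /x' /y' (_ : 5 * (pi / 4) - a = pi / 4 - a + pi); last by field.
  by rewrite cosDpi sinDpi cosB sinB sin_piquarter -/r -/x -/y; split; ring.
have xr : x <= r by apply: cos_le_far; apply/andP; split; lra.
clear p a0 a1; clearbody x y x' y'.
have ry : r <= y.
  rewrite leNgt; apply/negP => h.
  have : 0 < (r - y) * (r + y) by rewrite mulr_gt0//; lra.
  have : 0 <= (r - x) * (r + x) by rewrite mulr_ge0//; lra.
  lra.
have x'0 : x' <= 0 by rewrite x'E oppr_le0 mulr_ge0//; lra.
have y'0 : 0 <= y' by rewrite y'E mulr_ge0//; lra.
have n1 : sqnorm (x', e * y') <= 1 by rewrite /sqnorm /= exprMn ee mul1r x'y'.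
have SE : 4^-1 <= y' -> half_chord x' = y' /\ handle_S1 (x', e * y') = 2 * x.
  move=> h; have hE := half_chord_eq h x'y'; split=> //; rewrite /handle_S1 /= hE x'E y'E.
  by rewrite (_ : - _ = 4 * r ^+ 2 * x); [rewrite r2; field|ring].
have [hx|hx] := leP x 2^-1; last first.
  left; split; first by apply: outside_right; exact: ltW.
  apply: outside_left => //; have [h|h] := leP 4^-1 y'; first by rewrite (SE h).2; lra.
  apply: handle_S1_small => //=.
  have : 0 <= (4^-1 - y') * (4^-1 + y') by rewrite mulr_ge0//; lra.
  lra.
right.
have y67 : 6 / 7 <= y.
  rewrite leNgt; apply/negP => h.
  have : 0 < (6 / 7 - y) * (6 / 7 + y) by rewrite mulr_gt0//; lra.
  have : 0 <= (2^-1 - x) * (2^-1 + x) by rewrite mulr_ge0//; lra.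
  lra.
have h4 : 4^-1 <= y'.
  have : 0 <= (r - 7 / 10) * (y - x) by rewrite mulr_ge0//; lra.
  rewrite y'E; lra.
have [hE S] := SE h4.
have hxE : half_chord x = y by apply: half_chord_eq => //; lra.
have x'4 : x' <= - 4^-1.
  have : 0 <= (r - 7 / 10) * (y + x) by rewrite mulr_ge0//; lra.
  rewrite x'E; lra.
split.
- by rewrite handle_B2_le0 /= x0.
- by rewrite /handle_T2 /= hxE mulfK//; apply/eqP; lra.
- by apply: handle_B1_le0r => //; rewrite S; apply/andP; split; lra.
- by rewrite /handle_T1 /= hE mulfK//; apply/eqP; lra.
- by rewrite S.
Qed.

End handle.

Section handle_action.
Context (R : realType).
Local Notation I := (I01 R).
Local Notation base := (@base R).
Implicit Types (u v : R * R).

Let r : R := cos (pi / 4).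

Let r_sqr : r ^+ 2 = 2^-1. Proof. exact: cos_piquarter_sqr. Qed.

Let r_ge : 7 / 10 <= r. Proof. exact: cos_piquarter_ge. Qed.

Let cos_mid x : pi / 2 <= x <= 3 * (pi / 4) \/ 5 * (pi / 4) <= x <= 3 * (pi / 2) -> - r <= cos x <= 0.
Proof.
have p := pi_gt0 R.
have h z : pi / 2 <= z <= 3 * (pi / 4) -> - r <= cos z <= 0.
  move=> /andP[z0 z1]; rewrite -oppr_ge0 lerNl -cosDpi -cos2pi_sub.
  rewrite (_ : 2 * pi - (z + pi) = pi - z); last by ring.
  apply/andP; split; first by apply: cos_le_far; apply/andP; split; lra.
  by apply: cos_ge0_pihalf; apply/andP; split; lra.
case; first exact: h.
by move=> /andP[x0 x1]; rewrite -cos2pi_sub; apply: h; apply/andP; split; lra.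
Qed.

Let cos_right (x : R) : - (pi / 4) <= x <= pi / 4 -> 2^-1 <= cos x.
Proof.
have p := pi_gt0 R; rewrite -ler_norml => x0; have n := normr_ge0 x; suff : r <= cos x by have := r_ge; lra.
by rewrite -(cos_norm x); apply: cos_le_far; apply/andP; split; lra.
Qed.

Let continuous_opp (f : R * R -> R) : continuous f -> continuous (fun u => - f u).
Proof. by move=> cf u; apply: cvgN; exact: cf. Qed.

Lemma handle_sin_cos_continuous : continuous (@handle_sin R) /\ continuous (@handle_cos R).
Proof.
have c : continuous (@handle_sin R).
  by apply: continuous_mul; [exact: unit_clamp_continuous|cts].
by split=> //; apply: continuous_compf c; exact: half_chord_continuous.
Qed.

Lemma handle_map_continuous : continuous (@handle_map1 R) /\ continuous (@handle_map2 R).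
Proof.
have [c1 c2] := handle_sin_cos_continuous.
have c1' : continuous (fun u : R * R => handle_sin u.2) by apply: continuous_compf c1 _; cts.
have c2' : continuous (fun u : R * R => handle_cos u.2) by apply: continuous_compf c2 _; cts.
split; apply: continuous_pair => //; last by cts.
  by apply: continuous_opp; cts.
by cts.
Qed.

Lemma handle_kappa_continuous : continuous (@handle_kappa R).
Proof.
have [c1 c2] := handle_map_continuous; apply: pasting; first by cts.
- exact: continuous_compf (@pr_continuous R) c1.
- exact: continuous_compf (@pr_continuous R) c2.
- by case=> t s /= ->; exact: handle_glue_bottom.
Qed.

Let half_chord_fst : continuous (fun u : R * R => half_chord u.1).
Proof. by apply: continuous_compf (@half_chord_continuous R) _; cts. Qed.

Let ratio_continuous : continuous (fun u : R * R => u.2 * (half_chord u.1)^-1).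
Proof.
apply: continuous_mul; first by cts.
by apply: continuous_compf (@half_chordV_continuous R) _; cts.
Qed.

Lemma handle_kappa_surj t s : 0 <= t <= 1 -> 0 <= s <= 1 -> exists2 u, sqnorm u <= 1 &
  chart_at (@handle_T1 R) (@handle_S1 R) (@handle_B1 R) (@handle_T2 R) (@handle_S2 R) (@handle_B2 R) u t s.
Proof.
move=> /andP[t0 t1] s01; have rg := r_ge; have r2 := r_sqr.
have /andP[sn0 sn1] := handle_sinP s; have cs := handle_cosP s; have cE := handle_cos_sqr s.
have sE : 2 * handle_sin s = s by rewrite /handle_sin unit_clamp_id//; field.
have shrink (w z : R) : 0 <= w -> -1 <= z <= 1 -> w * z ^+ 2 <= w.
  move=> w0 /andP[z0 z1]; have : 0 <= (1 - z) * (1 + z) by rewrite mulr_ge0//; lra.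
  by move=> h; rewrite ler_piMr//; lra.
have [th|th] := leP t 2^-1.
  exists (handle_map1 (t, s)).
    rewrite /handle_map1 /sqnorm /= -/r exprMn.
    set w := r * (handle_cos s - handle_sin s).
    have e : (- (r * (handle_cos s + handle_sin s))) ^+ 2 + w ^+ 2 = 1.
      rewrite (_ : _ + _ = 2 * r ^+ 2 * (handle_cos s ^+ 2 + handle_sin s ^+ 2)); last by rewrite /w; ring.
      by rewrite r2 cE; field.
    have := @shrink (w ^+ 2) (1 - 4 * t) (sqr_ge0 w) ltac:(by apply/andP; split; lra).
    lra.
  left.
  have w4 : 4^-1 <= r * (handle_cos s - handle_sin s).
    have : 0 <= (r - 7 / 10) * (handle_cos s - handle_sin s) by rewrite mulr_ge0//; lra.
    lra.
  have x4 : - (r * (handle_cos s + handle_sin s)) <= - 4^-1.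
    have : 0 <= (r - 7 / 10) * (handle_cos s + handle_sin s) by rewrite mulr_ge0//; lra.
    lra.
  have hE : half_chord (- (r * (handle_cos s + handle_sin s))) = r * (handle_cos s - handle_sin s).
    apply: half_chord_eq => //.
    rewrite (_ : _ + _ = 2 * r ^+ 2 * (handle_cos s ^+ 2 + handle_sin s ^+ 2)); last by ring.
    by rewrite r2 cE; field.
  have SE : handle_S1 (handle_map1 (t, s)) = s.
    rewrite /handle_S1 /handle_map1 /= -/r hE -[RHS]sE.
    by rewrite (_ : - _ = 4 * r ^+ 2 * handle_sin s); [rewrite r2; field|ring].
  split=> //; first by apply: handle_B1_le0r; rewrite ?SE.
  rewrite /handle_T1 /handle_map1 /= -/r hE mulrAC divff ?mul1r; first by field.
  by rewrite gt_eqF//; lra.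
exists (handle_map2 (t, s)).
  rewrite /handle_map2 /sqnorm /= [X in _ + X]exprMn.
  have := @shrink (handle_cos s ^+ 2) (4 * t - 3) (sqr_ge0 _) ltac:(by apply/andP; split; lra).
  lra.
right; split=> //; first by rewrite handle_B2_le0 /= sn0.
rewrite /handle_T2 /handle_map2 /= -/(handle_cos s) mulrAC divff ?mul1r; first by field.
by rewrite gt_eqF//; lra.
Qed.

Lemma handle_chart : twist_chart (@handle_kappa R) (@handle_T1 R) (@handle_S1 R) (@handle_B1 R)
  (@handle_T2 R) (@handle_S2 R) (@handle_B2 R).
Proof.
have p := pi_gt0 R; have rg := r_ge; have r2 := r_sqr.
have w0 u : 0 < half_chord u.1 by exact: half_chord_gt0.
have cS1 : continuous (@handle_S1 R).
  by apply: continuous_opp; apply: continuous_mul; [cts|apply: continuous_add => //; cts].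
have T1r u : sqnorm u <= 1 -> 0 <= handle_T1 u <= 2^-1.
  by move=> /half_chord_ratio /andP[h1 h2]; rewrite /handle_T1; apply/andP; split; lra.
have T2r u : sqnorm u <= 1 -> 2^-1 <= handle_T2 u <= 1.
  by move=> /half_chord_ratio /andP[h1 h2]; rewrite /handle_T2; apply/andP; split; lra.
split.
- exact: handle_kappa_continuous.
- move=> s; rewrite handle_kappa1 ?handle_kappa2 ?handle_glue_top//; lra.
- split=> //; first by apply: continuous_mul; [apply: continuous_sub => //; cts|cts].
  apply: continuous_maxr; last by cts.
  apply: continuous_maxr; last by apply: continuous_sub => //; cts.
  exact: continuous_opp.
- split; [|by apply: continuous_mul; cts|].
    by apply: continuous_mul; [apply: continuous_add => //; cts|cts].
  apply: continuous_maxr; last by cts.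
  by apply: continuous_opp; cts.
- move=> u _ /handle_B1_le0[_ _ x0]; rewrite /handle_B2 lt_max; apply/orP; left; lra.
- move=> u t s n [] [B <- <-].
    have [-> ->] := handle_B1_le0 B; have /andP[-> h] := T1r _ n; split=> //=; lra.
  have /andP[h ->] := T2r _ n; move: B; rewrite handle_B2_le0 /handle_S2 andbT => /andP[x0 x1].
  by split; [lra|apply/andP; split; lra].
- move=> u t s n [] [B <- <-].
    have /andP[_ h] := T1r _ n; rewrite handle_kappa1// /handle_map1 /=.
    have [_ -> ->] := handle_band1 n B; rewrite -/r.
    case: u {n B h} (w0 u) => x y /= w1; congr (pr (_, _)).
      by rewrite (_ : - _ = 2 * r ^+ 2 * x); [rewrite r2; field|ring].
    rewrite /handle_T1 /= (_ : r * _ = 2 * r ^+ 2 * half_chord x); last by ring.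
    by rewrite r2; field; rewrite gt_eqF.
  have /andP[h _] := T2r _ n; rewrite handle_kappa2// /handle_map2 /=.
  have [_ -> ->] := handle_band2 B.
  case: u {n B h} (w0 u) => x y /= w1; congr (pr (_, _)).
  by rewrite /handle_T2 /=; field; rewrite gt_eqF.
- move=> u n B; have [s0 s1 x4] : [/\ 0 <= handle_S1 u, handle_S1 u <= 1 & u.1 <= - 4^-1].
    by apply: handle_B1_le0; rewrite B.
  have [|x4'] := eqVneq (u.1) (- 4^-1).
    move=> xE; exfalso; move: s0; rewrite /handle_S1 -/r xE.
    have := @half_chord_ge _ (- 4^-1 : R) 2^-1 ltac:(lra); rewrite ger0_norm; last by lra.
    set w := half_chord _ => wh.
    have : 0 <= (r - 7 / 10) * (w - 4^-1) by rewrite mulr_ge0//; lra.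
    lra.
  have x4s : u.1 < - 4^-1 by rewrite lt_neqAle x4'.
  move: B; rewrite /handle_B1; have [h|h] := leP (- handle_S1 u) (handle_S1 u - 1).
    by case: leP => _ ?; [lra|right; lra].
  by case: leP => _ ?; [lra|left; lra].
- move=> u n; rewrite /handle_B2 /handle_S2; case: leP => _ B; first by right; lra.
  by left; lra.
- exact: handle_kappa_surj.
- move=> k a kin a01 u v; move: kin a01; rewrite !inE => /or4P[]/eqP kE /andP[a0 a1]; subst k.
  + left; split; [apply: outside_right|apply: outside_mid]; rewrite /u /v /circle /= -/r.
      by apply: cos_right; apply/andP; split; lra.
    by apply: cos_mid; left; apply/andP; split; lra.
  + have [||[e1 e2]|[b2 t2 b1 t1 ss]] := @handle_glue R a 1.
    * by apply/andP; split; lra.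
    * by left.
    * left; rewrite !mul1r in e1 e2; split => //.
      by rewrite /v (_ : _ - a = 5 * (pi / 4) - a)//; ring.
    * right; rewrite !mul1r in b1 b2 t1 t2 ss; exists 1, 0, (handle_S2 u).
      split; last by right; right.
        by right; split=> //; rewrite t2; field.
      rewrite /v (_ : _ - a = 5 * (pi / 4) - a); last by ring.
      by left; split=> //; rewrite t1 subrr mul0r.
  + have uE : u = (cos (5 * (pi / 4) - (a - 3 * (pi / 4))), -1 * sin (5 * (pi / 4) - (a - 3 * (pi / 4)))).
      rewrite (_ : 5 * (pi / 4) - _ = 2 * pi - a); last by field.
      by rewrite cos2pi_sub sin2pi_sub mulN1r opprK.
    have vE : v = (cos (a - 3 * (pi / 4)), -1 * sin (a - 3 * (pi / 4))).
      rewrite /v (_ : _ - a = 2 * pi - (a - 3 * (pi / 4))); last by field.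
      by rewrite /circle cos2pi_sub sin2pi_sub mulN1r.
    have [||[e1 e2]|[b2 t2 b1 t1 ss]] := @handle_glue R (a - 3 * (pi / 4)) (-1).
    * by apply/andP; split; lra.
    * by right.
    * by left; rewrite uE vE.
    * right; exists 2^-1, 2^-1, (handle_S2 v); split; last by left.
        by left; rewrite uE; split=> //; rewrite ?t1 ?ss -?vE//; field.
      by right; rewrite vE; split=> //; rewrite t2; field.
  + left; split; [apply: outside_mid|apply: outside_right]; rewrite /u /v /circle /= -/r.
      by apply: cos_mid; right; apply/andP; split; lra.
    by rewrite -cos2pi_sub; apply: cos_right; apply/andP; split; lra.
- by apply: outside_mid => /=; rewrite -/r; apply/andP; split; lra.
Qed.

Let trig0 : (handle_sin 0 = 0 :> R) * (handle_cos 0 = 1 :> R).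
Proof.
have s0 : handle_sin 0 = 0 :> R by rewrite /handle_sin unit_clamp_id ?mul0r// lexx ler01.
by split=> //; rewrite /handle_cos s0; apply: half_chord_eq; [lra|ring].
Qed.

Let cornerE : [/\ corner R 2 = (0, 1), corner R 3 = (- r, r), corner R 5 = (- r, - r) & corner R 6 = (0, -1)].
Proof.
have p := pi_gt0 R; have sr := sin_piquarter R; rewrite -/r in sr.
rewrite /corner /circle; split.
- by rewrite (_ : 2 * (pi / 4) = pi / 2); [rewrite cos_pihalf sin_pihalf|field].
- rewrite (_ : 3 * (pi / 4) = pi / 4 + pi / 2); last by field.
  by rewrite cosDpihalf sinDpihalf sr.
- rewrite (_ : 5 * (pi / 4) = pi / 4 + pi); last by field.
  by rewrite cosDpi sinDpi sr.
- rewrite (_ : 6 * (pi / 4) = pi / 2 + pi); last by field.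
  by rewrite cosDpi sinDpi cos_pihalf sin_pihalf oppr0.
Qed.

Lemma sqnorm_segment u v (t : I) : sqnorm u <= 1 -> sqnorm v <= 1 -> sqnorm (segment_fun u v t) <= 1.
Proof.
have t0 := I01_ge0 t; have t1 := I01_le1 t; rewrite /sqnorm /segment_fun /=.
move: (I01_val t) t0 t1 => {}t t0 t1 u1 v1.
have : 0 <= t * (1 - t) * ((u.1 - v.1) ^+ 2 + (u.2 - v.2) ^+ 2).
  by rewrite mulr_ge0 ?addr_ge0 ?sqr_ge0// mulr_ge0//; lra.
have : 0 <= (1 - t) * (1 - (u.1 ^+ 2 + u.2 ^+ 2)) by rewrite mulr_ge0//; lra.
have : 0 <= t * (1 - (v.1 ^+ 2 + v.2 ^+ 2)) by rewrite mulr_ge0//; lra.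
lra.
Qed.

Lemma segment_homotopic u v w x y z (ux : pr u = x) (vy : pr v = y) (wz : pr w = z) :
  path_homotopic (path_concat (segment ux vy) (segment vy wz)) (segment ux wz).
Proof.
apply: (planar_concat_homotopic (@pr_continuous R) (P := segment_fun u v)
  (Q := segment_fun v w) (S := segment_fun u w)) => //; try exact: segment_fun_continuous.
- by rewrite !segment_fun0.
- by rewrite segment_fun1 segment_fun0.
- by rewrite !segment_fun1.
Qed.

(** The spokes 2, 3, 5, 6 are fixed. Corner 1 lies to the right of the annulus, so spoke 1 is spoke
    2, an edge E across the annulus and a fixed segment F; corner 0 is joined to corner 1 by a fixed
    segment G. Spokes 0 and 1 are therefore multiplied on the left by L based along spoke 2: its two
    chords contribute the loops from spoke 2 to 3 and from spoke 5 to 6, that is, a^-1 d. *)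
Lemma handle_homeo : exists h : pointed_homeo base,
  [/\ induced h (gen_a R) = gen_a R,
      induced h (gen_b R) = ((gen_a R)^-1 * gen_d R * gen_b R)%g,
      induced h (gen_c R) = ((gen_a R)^-1 * gen_d R * gen_c R)%g &
      induced h (gen_d R) = gen_d R].
Proof.
have [h [hfix hE]] := twist_homeo handle_chart.
have p := pi_gt0 R; have rg := r_ge; have [c2 c3 c5 c6] := cornerE; have [s0 c0] := trig0.
have mid k : - r <= (corner R k).1 <= 0 -> forall t, 0 <= t <= 1 ->
    h (pr (t * (corner R k).1, t * (corner R k).2)) = pr (t * (corner R k).1, t * (corner R k).2).
  move=> /andP[k0 k1] t t01; apply: hfix; first exact: sqnorm_corner.
  move: t01 => /andP[t0 t1]; apply: outside_mid; rewrite -/r.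
  rewrite -[(_, _).1]/(t * (corner R k).1).
  have : 0 <= t * - (corner R k).1 by rewrite mulr_ge0//; lra.
  have : 0 <= (1 - t) * - (corner R k).1 by rewrite mulr_ge0//; lra.
  by move=> ? ?; apply/andP; split; lra.
have mk k : k \in [:: 2; 3; 5; 6]%N -> - r <= (corner R k).1 <= 0.
  have {}rg := rg; rewrite !inE => /or4P[]/eqP->; rewrite ?c2 ?c3 ?c5 ?c6 /=; apply/andP; split; lra.
have hv : h (vertex R) = vertex R.
  have := mid 2%N (mk 2%N isT) 1; rewrite !mul1r ler01 lexx -surjective_pairing pr_corner//.
  exact.
have sfix k (hk : (k <= 8)%N) : k \in [:: 2; 3; 5; 6]%N ->
    path_map (homeo_continuous h) (homeo_base h) hv (spoke R hk) = spoke R hk.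
  by move=> kin; apply: spoke_path_map; exact/mid/mk.
have lfix i j (hi : (i <= 8)%N) (hj : (j <= 8)%N) : i \in [:: 2; 3; 5; 6]%N ->
    j \in [:: 2; 3; 5; 6]%N -> induced h (spoke_loop R hi hj) = spoke_loop R hi hj.
  by move=> iin jin; rewrite /spoke_loop (induced_path_quotient hv) !sfix.
have right_fix u : sqnorm u <= 1 -> 2^-1 <= u.1 -> h (pr u) = pr u.
  by move=> n u1; apply: hfix => //; exact: outside_right.
have seg_fix u v x y (ux : pr u = x) (vy : pr v = y) (hx : h x = x) (hy : h y = y) :
    sqnorm u <= 1 -> sqnorm v <= 1 -> 2^-1 <= u.1 -> 2^-1 <= v.1 ->
    path_map (homeo_continuous h) hx hy (segment ux vy) = segment ux vy.
  move=> nu nv u1 v1; apply/path_eqP => t; rewrite path_mapE segmentE.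
  apply: right_fix; first exact: sqnorm_segment.
  have t0 := I01_ge0 t; have t1 := I01_le1 t; rewrite /segment_fun /=.
  have : 0 <= (1 - I01_val t) * (u.1 - 2^-1) by rewrite mulr_ge0//; lra.
  have : 0 <= I01_val t * (v.1 - 2^-1) by rewrite mulr_ge0//; lra.
  lra.
have ck k : sqnorm (corner R k) <= 1 by rewrite sqnorm_circle.
have {}rg := rg; have x0 : 2^-1 <= (corner R 0).1 by rewrite /corner mul0r /circle cos0 /=; lra.
have x1 : 2^-1 <= (corner R 1).1 by rewrite /corner mul1r /circle /= -/r; lra.
(* The point of side 1 where E leaves the annulus. *)
pose w := handle_map2 (1, 1) : R * R.
have sin1 : handle_sin 1 = 2^-1 :> R by rewrite /handle_sin unit_clamp_id ?mul1r// lexx ler01.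
have nw : sqnorm w <= 1.
  rewrite /w /handle_map2 /sqnorm /= (_ : 4 * 1 - 3 = 1); last by ring.
  by rewrite mulr1 handle_cos_sqr addrC subrK.
have xw : 2^-1 <= w.1 by rewrite /w /handle_map2 /= sin1.
pose q := pr w; have hq : h q = q by exact: right_fix.
pose E0 (t : I) := handle_map2 (1, I01_val t).
pose L0 (t : I) := handle_kappa (I01_val t, 0).
have [_ cm2] := handle_map_continuous.
have cE0 : continuous E0 by apply: continuous_compf cm2 _; apply: continuous_pair; cts.
have cL0 : continuous L0.
  by apply: continuous_compf handle_kappa_continuous _; apply: continuous_pair; cts.
have E0z : E0 zero = corner R 2.
  by rewrite /E0 I01_zeroE /handle_map2 /= s0 c0 c2; congr (_, _); ring.
have E00 : pr (E0 zero) = vertex R by rewrite E0z pr_corner.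
have E01 : pr (E0 one) = q by rewrite /E0 I01_oneE.
have L00 : L0 zero = vertex R.
  rewrite /L0 I01_zeroE handle_kappa1 ?invr_ge0// -(@pr_corner _ 3)// c3; congr pr.
  by rewrite /handle_map1 /= s0 c0 -/r; congr (_, _); ring.
have L01 : L0 one = vertex R.
  rewrite /L0 I01_oneE handle_kappa2; last by lra.
  by rewrite -(@pr_corner _ 2)// c2 /handle_map2 /= s0 c0; congr (pr (_, _)); ring.
pose E : {path I from vertex R to q} :=
  mk_path (continuous_compf (@pr_continuous R) cE0) E00 E01.
pose L : {path I from vertex R to vertex R} := mk_path cL0 L00 L01.
pose s1 := spoke R (k := 1) isT; pose s2 := spoke R (k := 2) isT.
pose s3 := spoke R (k := 3) isT; pose s5 := spoke R (k := 5) isT; pose s6 := spoke R (k := 6) isT.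
pose s0' := spoke R (k := 0) isT.
pose F := segment (erefl q) (@pr_corner R 1 isT).
pose G := segment (@pr_corner R 1 isT) (@pr_corner R 0 isT).
pose L1 := segment (@pr_corner R 3 isT) (@pr_corner R 5 isT).
pose L2 := segment (@pr_corner R 6 isT) (@pr_corner R 2 isT).
have s1E : path_homotopic (path_concat (path_concat s2 E) F) s1.
  apply: path_homotopic_trans (segment_homotopic (pr0 R) (erefl q) _).
  apply: path_concat_homotopic; last exact: path_homotopic_refl.
  apply: (planar_concat_homotopic (@pr_continuous R) (P := segment_fun (0, 0) (corner R 2))
    (Q := E0) (S := segment_fun (0, 0) w)) => //; try exact: segment_fun_continuous.
  - by rewrite !segment_fun0.
  - by rewrite segment_fun1.
  - by rewrite segment_fun1 /E0 I01_oneE.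
have LE : L = path_concat L1 L2.
  apply/path_eqP => t; rewrite path_concatE; have t0 := I01_ge0 t; have t1 := I01_le1 t.
  rewrite [LHS]/(L0 t) /L0; case: leP => th.
    rewrite handle_kappa1// segmentE /segment_fun clamp_val; [|lra|lra].
    by rewrite c3 c5 /handle_map1 /= s0 c0 -/r; congr (pr (_, _)); ring.
  rewrite handle_kappa2; last exact: ltW.
  rewrite segmentE /segment_fun clamp_val; [|lra|lra].
  by rewrite c2 c6 /handle_map2 /= s0 c0; congr (pr (_, _)); ring.
have loopE : path_quotient (path_concat s2 L) s2 = ((gen_a R)^-1 * gen_d R)%g.
  rewrite -spoke_loop23 /gen_d /spoke_loop LE.
  transitivity (path_quotient (path_concat (path_concat s2 L1) L2) (path_concat s6 L2)).
    apply: path_quotient_homotopic; first exact: path_concatA.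
    apply: path_homotopic_sym; exact: segment_homotopic.
  rewrite path_quotient_concat -(path_quotientM _ (path_concat s3 L1)) path_quotient_concat.
  congr (_ * _)%g; apply: path_quotient_homotopic; last exact: path_homotopic_refl.
  exact: segment_homotopic.
have hE' : path_homotopic (path_map (homeo_continuous h) hv hq E) (path_concat L E).
  apply: (twist_edge handle_chart) => // t.
  by rewrite handle_kappa1 ?invr_ge0// handle_glue_top.
have key : path_quotient (path_map (homeo_continuous h) (homeo_base h) hv s1) s1 =
    ((gen_a R)^-1 * gen_d R)%g.
  rewrite -loopE -[RHS](path_quotient_concat _ _ E) -[RHS](path_quotient_concat _ _ F).
  apply: path_quotient_homotopic; last exact: (path_homotopic_sym s1E).
  apply: path_homotopic_trans (path_map_homotopic _ _ _ (path_homotopic_sym s1E)) _.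
  rewrite (path_map_concat _ _ hq) seg_fix// (path_map_concat _ _ hv) sfix//.
  apply: path_concat_homotopic; last exact: path_homotopic_refl.
  apply: path_homotopic_trans (path_concat_homotopic (path_homotopic_refl _) hE') _.
  exact: path_concatA.
have key0 : path_quotient (path_map (homeo_continuous h) (homeo_base h) hv s0') s0' =
    ((gen_a R)^-1 * gen_d R)%g.
  rewrite -key -[RHS](path_quotient_concat _ _ G).
  have e : path_homotopic s0' (path_concat s1 G).
    apply: path_homotopic_sym; exact: segment_homotopic.
  apply: path_quotient_homotopic => //.
  apply: path_homotopic_trans (path_map_homotopic _ _ _ e) _.
  by rewrite (path_map_concat _ _ hv) (seg_fix _ _ _ _ _ _ hv hv)//; exact: path_homotopic_refl.
exists h; split; last exact: lfix.
- by apply: invg_inj; rewrite -inducedV -spoke_loop23 lfix.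
- rewrite /gen_b /spoke_loop (induced_path_quotient hv) (sfix 2%N)// -(path_quotientM _ s1).
  by rewrite key.
- rewrite /gen_c /spoke_loop (induced_path_quotient hv) (sfix 5%N)// -(path_quotientM _ s0').
  by rewrite key0.
Qed.

End handle_action.

(** * Lifts to SL(2, R) and the Euler number *)

Section positive_multiple.
Context (R : realType).
Implicit Types (v w : 'cV[R]_2) (M N : SL2 R).

(** Lines see matrices only up to sign; positive proportionality retains the sign that distinguishes
    the two lifts. *)
Definition same_ray v w : Prop := exists2 c : R, 0 < c & v = c *: w.

Lemma same_ray_sym v w : same_ray v w -> same_ray w v.
Proof.
move=> [c c0 ->]; exists c^-1; first by rewrite invr_gt0.
by rewrite scalerA mulVf ?gt_eqF// scale1r.
Qed.

Lemma same_ray_trans u v w : same_ray u v -> same_ray v w -> same_ray u w.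
Proof. by move=> [c c0 ->] [d d0 ->]; exists (c * d); rewrite ?mulr_gt0// scalerA. Qed.

Lemma same_rayM M v w : same_ray v w -> same_ray (val M *m v) (val M *m w).
Proof. by move=> [c c0 ->]; exists c; rewrite // -scalemxAr. Qed.

Lemma same_rayV M v w : same_ray v (val M *m w) -> same_ray w (val (M^-1)%g *m v).
Proof.
move/(same_rayM (M^-1)%g); rewrite mulmxA -val_SL2M mulVg mul1mx.
exact: same_ray_sym.
Qed.

Lemma same_ray_step M N u v w :
  same_ray u (val M *m v) -> same_ray v (val N *m w) -> same_ray u (val (M * N)%g *m w).
Proof.
move=> uv /(same_rayM M) vw; apply: same_ray_trans uv _.
by rewrite val_SL2M -mulmxA.
Qed.

Lemma same_rayN v w : same_ray v w -> same_ray (- v) (- w).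
Proof. by move=> [c c0 ->]; exists c; rewrite ?scalerN. Qed.

End positive_multiple.

Lemma PSL2_classgM (R : realType) (X Y : SL2 R) :
  PSL2_class (X * Y)%g = (PSL2_class X * PSL2_class Y)%g.
Proof. by rewrite PSL2_classM. Qed.

Lemma PSL2_classV (R : realType) (X : SL2 R) : PSL2_class (X^-1)%g = ((PSL2_class X)^-1)%g.
Proof. by apply: (mulgI (PSL2_class X)); rewrite -PSL2_classgM !mulgV. Qed.

Lemma PSL2_class_comm (R : realType) (X Y : SL2 R) :
  PSL2_class (comm X Y) = comm (PSL2_class X) (PSL2_class Y).
Proof. by rewrite /comm !(PSL2_classgM, PSL2_classV). Qed.

Section boundary_holonomy.
Context (R : realType) (rho : {multiplicative fundamental_group R (base R) -> PSL2 R}).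

Lemma ray_segment t x (tx : proj (boundary_point t) = x) (cx : pr (circle (t * (pi / 4))) = x) :
  ray tx = segment (pr0 R) cx.
Proof.
apply/path_eqP => s; rewrite -[LHS]/(proj (scale s (boundary_point t))) -pr_disc segmentE; congr pr.
rewrite /disc_val set_valE /= /scale_fun /segment_fun /disc_val set_valE /=.
by rewrite !mulr0 !add0r.
Qed.

(** The loop attached to two glued points does not depend on their position s, so a single element
    of the group glues the flat bundle along the whole side. *)
Lemma ray_quotient k (h0 : (k <= 8)%N) (h3 : (k.+3 <= 8)%N) s x
    (sx : proj (boundary_point (k%:R + s)) = x) (s'x : proj (boundary_point (k%:R + 3 - s)) = x) :
  k \in [:: 0; 1; 4; 5]%N -> 0 <= s <= 1 ->
  path_quotient (ray sx) (ray s'x) = spoke_loop R h0 h3.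
Proof.
move=> kin /andP[s0 s1]; have p := pi_gt0 R; rewrite /spoke_loop /spoke.
have cx : pr (circle ((k%:R + s) * (pi / 4))) = x by rewrite -boundary_pointE.
have e : (k%:R + 3 - s) * (pi / 4) = (2 * k%:R + 3) * (pi / 4) - (k%:R + s) * (pi / 4).
  by field.
have c'x : pr (circle ((2 * k%:R + 3) * (pi / 4) - (k%:R + s) * (pi / 4))) = x.
  by rewrite -e -boundary_pointE.
have c'x' : pr (circle ((k%:R + 3 - s) * (pi / 4))) = x by rewrite e.
rewrite (ray_segment sx cx) (ray_segment s'x c'x') (segment_congr _ c'x' c'x) ?e//.
have e3 : circle ((2 * k%:R + 3) * (pi / 4) - k%:R * (pi / 4)) = corner R k.+3.
  by rewrite /corner; congr circle; rewrite -[k.+3]addn3 natrD; field.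
rewrite -(segment_congr _ (etrans (congr1 (@pr R) e3) (pr_corner R h3)) _ e3).
have : 0 <= s * (pi / 4) by rewrite mulr_ge0//; lra.
have : 0 <= (1 - s) * (pi / 4) by rewrite mulr_ge0//; lra.
by move=> *; apply: spoke_homotopic => //; apply/andP; split; lra.
Qed.

Lemma mulmx_angle (M : 'M[R]_2) a i : (M *m angle_vec a) i 0 = M i 0 * cos a + M i 1 * sin a.
Proof.
rewrite mxE !big_ord_recl big_ord0 addr0 !mxE /=.
by congr (_ + M _ _ * _); apply: val_inj.
Qed.

Lemma flat_point_glue k (h0 : (k <= 8)%N) (h3 : (k.+3 <= 8)%N) s l l' :
  k \in [:: 0; 1; 4; 5]%N -> 0 <= s <= 1 ->
  flat_point rho (boundary_point (k%:R + s)) l = flat_point rho (boundary_point (k%:R + 3 - s)) l' ->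
  l = PSL2_act (rho (spoke_loop R h0 h3)) l'.
Proof.
move=> kin s01 /eqmodP/asboolP[x [sx [s'x]]] /= ->.
by rewrite (ray_quotient h0 h3).
Qed.

Lemma rhoV g : rho (g^-1)%g = ((rho g)^-1)%g.
Proof. by apply: (mulgI (rho g)); rewrite mulgV -gmulfM mulgV rho1. Qed.

Lemma rho_comm g h : rho (comm g h) = comm (rho g) (rho h).
Proof. by rewrite /comm -!rhoV -!gmulfM. Qed.

Lemma clamped_continuous (f : R -> R) (a b : R) : a <= b -> {within `[a, b], continuous f} ->
  continuous (fun t => f (Num.max a (Num.min b t))).
Proof.
move=> ab /subspace_continuousP cf t; set m := fun t => Num.max a (Num.min b t).
have mab x : `[a, b]%classic (m x).
  by rewrite /= in_itv /= le_max lexx ge_max ab ge_min lexx.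
have cm : continuous m.
  apply: continuous_maxr; first by cts.
  by apply: continuous_minr; [cts|exact: (fun=> cvg_id)].
apply: (@cvg_comp _ _ _ m f _ (within `[a, b] (nbhs (m t)))); last exact: cf.
move=> V /= VV; have : \forall x \near t, `[a, b]%classic (m x) -> V (m x) := cm t _ VV.
by apply: filterS => x /(_ (mab x)).
Qed.

Lemma constant_sign (f : R -> R) : continuous f -> (forall t, 0 <= t <= 1 -> f t != 0) ->
  0 < f 0 * f 1.
Proof.
move=> cf f0; rewrite ltNge; apply/negP => le0.
have [|c] := @IVT R f 0 1 0 ler01 (continuous_subspaceT cf).
  rewrite ge_min le_max; have [h0|h0] := ltP 0 (f 0); have [h1|h1] := ltP 0 (f 1).
  - by move: le0; rewrite leNgt mulr_gt0.
  - by rewrite (ltW h0) orbT.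
  - by rewrite (ltW h1) orbT.
  - move: le0; rewrite leNgt nmulr_rgt0 ?lt_neqAle ?h0 ?h1 ?f0 ?lexx ?ler01//.
by rewrite in_itv /= => c01 fc; have := f0 c c01; rewrite fc eqxx.
Qed.

(* The line of angle f t is the image by M of the line of angle g t; by continuity the
   sign of the proportionality factor is constant, hence positive for one lift of M. *)
Lemma lift_act (x : PSL2 R) (f g : R -> R) : continuous f -> continuous g ->
  (forall t, 0 <= t <= 1 -> angle_line (f t) = PSL2_act x (angle_line (g t))) ->
  exists M : SL2 R, [/\ PSL2_class M = x,
    same_ray (angle_vec (f 0)) (val M *m angle_vec (g 0)) &
    same_ray (angle_vec (f 1)) (val M *m angle_vec (g 1))].
Proof.
move=> cf cg fg; pose M := repr x.
have Mx : PSL2_class M = x by exact: PSL2_class_repr.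
(* The scalar product of the two vectors. They are proportional on [0, 1], so it does not vanish
   there, and its sign is that of the proportionality factor c. *)
pose phi t := cos (f t) * (val M *m angle_vec (g t)) 0 0 + sin (f t) * (val M *m angle_vec (g t)) 1 0.
have phiE t : 0 <= t <= 1 -> exists2 c : R, c * phi t = 1 &
    angle_vec (f t) = c *: (val M *m angle_vec (g t)).
  move=> t01; have := fg t t01; rewrite -Mx PSL2_actE => /lineP[c c0].
  rewrite /vec !set_valE /= => e; exists c => //.
  have e0 := congr1 (fun X : 'cV_2 => X 0 0) e; rewrite [LHS]mxE [RHS]mxE /= in e0.
  have e1 := congr1 (fun X : 'cV_2 => X 1 0) e; rewrite [LHS]mxE [RHS]mxE /= in e1.
  rewrite -(cos2Dsin2 (f t)) /phi mulrDr ![c * (_ * _)]mulrCA !expr2.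
  by congr (_ + _); rewrite ?e0 ?e1.
have ccos (h : R -> R) : continuous h -> continuous (fun t => cos (h t)).
  by move=> ch; apply: continuous_compf ch => ?; exact: continuous_cos.
have csin (h : R -> R) : continuous h -> continuous (fun t => sin (h t)).
  by move=> ch; apply: continuous_compf ch => ?; exact: continuous_sin.
have cphi : continuous phi.
  have e : phi = fun t => cos (f t) * (val M 0 0 * cos (g t) + val M 0 1 * sin (g t)) +
      sin (f t) * (val M 1 0 * cos (g t) + val M 1 1 * sin (g t)).
    by apply/funext => t; rewrite /phi !mulmx_angle.
  by rewrite e; cts; (exact: ccos || exact: csin).
have phi0 t : 0 <= t <= 1 -> phi t != 0.
  by move=> /phiE[c e _]; apply/eqP => p0; move: e; rewrite p0 mulr0 => /eqP; rewrite eq_sym oner_eq0.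
have s01 := constant_sign cphi phi0.
have z0 : (0 <= 0 :> R) && (0 <= 1 :> R) by rewrite lexx ler01.
have z1 : (0 <= 1 :> R) && (1 <= 1 :> R) by rewrite lexx ler01.
have pos t : 0 < phi t -> 0 <= t <= 1 -> same_ray (angle_vec (f t)) (val M *m angle_vec (g t)).
  move=> p0 /phiE[c e ->]; exists c => //; rewrite ltNge; apply/negP => c0.
  by have := mulr_le0_ge0 c0 (ltW p0); rewrite e ler10.
have neg t : phi t < 0 -> 0 <= t <= 1 ->
    same_ray (angle_vec (f t)) (val (SL2_opp M) *m angle_vec (g t)).
  move=> p0 /phiE[c e ->]; exists (- c); last by rewrite /= mulNmx scalerN scaleNr opprK.
  rewrite oppr_gt0 ltNge; apply/negP => c0.
  by have := mulr_ge0_le0 c0 (ltW p0); rewrite e ler10.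
have [p0|p0] := ltP 0 (phi 0).
  by rewrite pmulr_rgt0// in s01; exists M; split=> //; exact: pos.
have {}p0 : phi 0 < 0 by rewrite lt_neqAle phi0.
rewrite nmulr_rgt0// in s01; exists (SL2_opp M); split; [|exact: neg|exact: neg].
by rewrite -Mx; apply/PSL2_classP; right.
Qed.

Lemma angle_vecDpi (a : R) : angle_vec (a + pi) = - angle_vec a.
Proof. by apply/colP => i; rewrite !mxE cosDpi sinDpi; case: ifP. Qed.

(** Each pair of glued sides has one lift that respects directions, not only lines. As theta 8 -
    theta 0 is pi or -pi, the vector v 8 is - v 0, so the direction v 1 carried through all eight
    sides returns reversed. The product of the commutators is 1 or -1 by the surface relation, and 1
    would preserve the direction. *)
Theorem euler_lift e : e = 1 \/ e = -1 -> euler_number rho e ->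
  exists A B C D : SL2 R, [/\ [/\ PSL2_class A = rho (gen_a R), PSL2_class B = rho (gen_b R),
    PSL2_class C = rho (gen_c R) & PSL2_class D = rho (gen_d R)] &
    (comm A B * comm C D)%g = SL2_opp 1%g].
Proof.
move=> e1 [s [_ [theta [cth sth deg]]]].
(* [theta] is continuous only within [0, 8]; it is extended by constants to the line. *)
pose th t := theta (Num.max 0 (Num.min 8 t)).
have cth' : continuous th by apply: clamped_continuous cth.
have thE t : 0 <= t <= 8 -> th t = theta t.
  by move=> /andP[t0 t8]; rewrite /th (min_idPr t8) (max_idPr t0).
pose v k := angle_vec (th k).
have side k (h0 : (k <= 8)%N) (h3 : (k.+3 <= 8)%N) x0 x1 x2 x3 : k \in [:: 0; 1; 4; 5]%N ->
    k%:R = x0 -> x0 + 1 = x1 -> x0 + 2 = x2 -> x0 + 3 = x3 -> exists M : SL2 R,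
    [/\ PSL2_class M = rho (spoke_loop R h0 h3), same_ray (v x0) (val M *m v x3) &
      same_ray (v x1) (val M *m v x2)].
  move=> kin <- <- <- <-; have k5 : k%:R <= 5 :> R by rewrite ler_nat -(leq_add2r 3) addn3.
  have k0 : 0 <= k%:R :> R by [].
  have [|||M [Mx m0 m1]] := @lift_act (rho (spoke_loop R h0 h3)) (fun t => th (k%:R + t)) (fun t => th (k%:R + 3 - t)).
  - by apply: (continuous_compf (f := fun t : R => k%:R + t) cth'); cts.
  - by apply: (continuous_compf (f := fun t : R => k%:R + 3 - t) cth'); cts.
  - move=> t t01; apply: (flat_point_glue h0 h3 kin t01).
    move: (t01) => /andP[t0 t1].
    rewrite !thE; try (by apply/andP; split; lra).
    rewrite -!sth ?in_itv /=; try (by apply/andP; split; lra).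
    by congr s; apply/projP; constructor.
  exists M; split=> //; first by rewrite addr0 subr0 in m0.
  by rewrite (_ : k%:R + 2 = k%:R + 3 - 1); [exact: m1|ring].
have [|||||M0 [M0x m03 m12]] := @side 0%N isT isT 0 1 2 3; rewrite ?inE//; try lra.
have [|||||M1 [M1x m14 m23]] := @side 1%N isT isT 1 2 3 4; rewrite ?inE//; try lra.
have [|||||M4 [M4x m47 m56]] := @side 4%N isT isT 4 5 6 7; rewrite ?inE//; try lra.
have [|||||M5 [M5x m58 m67]] := @side 5%N isT isT 5 6 7 8; rewrite ?inE//; try lra.
have v8 : v 8 = - v 0.
  rewrite /v !thE; try (by rewrite ?lexx //; apply/andP; split; lra).
  move: deg; case: e1 => ->; rewrite ?mulrN1z ?mulr1z => deg.
    by rewrite -angle_vecDpi; congr angle_vec; lra.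
  by rewrite (_ : theta 0 = theta 8 + pi) ?angle_vecDpi ?opprK//; lra.
pose A := (M1^-1)%g; pose B := M0; pose C := (M5^-1)%g; pose D := M4.
have AE : PSL2_class A = rho (gen_a R).
  by rewrite /A PSL2_classV M1x -rhoV spoke_loopV.
have BE : PSL2_class B = rho (gen_b R) by rewrite /B M0x spoke_loop03.
have CE : PSL2_class C = rho (gen_c R).
  by rewrite /C PSL2_classV M5x -rhoV spoke_loopV /spoke_loop spoke8.
have DE : PSL2_class D = rho (gen_d R) by rewrite /D M4x -[gen_d R]invgK -spoke_loop74 spoke_loopV.
exists A, B, C, D; split=> //.
have pm : PSL2_class (comm A B * comm C D)%g = PSL2_class 1%g.
  by rewrite PSL2_classgM !PSL2_class_comm AE BE CE DE -!rho_comm -gmulfM surface_relation rho1.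
have /PSL2_classP[E|E] := pm; last exact: val_inj.
(* The relation conjugated by A, so that the chain of directions starts and ends at v 1. *)
exfalso; pose W := (B * (A^-1 * (B^-1 * (C * (D * (C^-1 * (D^-1 * A))))))%g)%g.
have W1 : W = 1%g.
  apply: (mulgI A); apply: (mulIg (A^-1)%g).
  rewrite mulg1 mulgV -[RHS](val_inj E) /W /comm !mulgA.
  by rewrite mulgK.
have r1 : same_ray (v 1) (- (val W *m v 1)).
  have s8 : same_ray (v 8) (val (C * (D * (C^-1 * (D^-1 * A))))%g *m v 1).
    apply: same_ray_step (same_rayV m58) _.
    apply: same_ray_step m56 _.
    apply: same_ray_step; first by rewrite (invgK M5); exact: m67.
    apply: same_ray_step (same_rayV m47) _; exact: same_rayV.
  have s3 : same_ray (v 3) (- (val (B^-1 * (C * (D * (C^-1 * (D^-1 * A)))))%g *m v 1)).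
    have := same_rayN (same_rayM (B^-1)%g s8); rewrite v8 mulmxN opprK mulmxA -val_SL2M.
    by apply: same_ray_trans; exact: same_rayV.
  have := same_rayM (B * A^-1)%g s3; rewrite mulmxN mulmxA -val_SL2M -mulgA.
  apply: same_ray_trans; apply: same_ray_step m12 _.
  by rewrite (invgK M1).
have [c c0] := r1; rewrite W1 mul1mx scalerN => /eqP; rewrite -addr_eq0 -{1}[v 1]scale1r -scalerDl.
rewrite scaler_eq0 (negbTE (angle_vec_neq0 _)) orbF => /eqP; lra.
Qed.

End boundary_holonomy.

(** * Lifted representations up to homeomorphism of the surface *)

Section relation.
Context (R : realType).
Local Notation G := (SL2 R).
Implicit Types a b c d : G.

Lemma SL2_oppM1 a b : (a * b)%g = SL2_opp 1%g -> a = SL2_opp (b^-1)%g.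
Proof. by move=> e; rewrite -[LHS](mulgK b) e SL2_mulNg mul1g. Qed.

Lemma SL2_opp_comm a b : (a * b)%g = SL2_opp 1%g -> (b * a)%g = SL2_opp 1%g.
Proof. by move/SL2_oppM1->; rewrite SL2_mulgN mulgV. Qed.

Lemma commV a b : ((comm a b)^-1)%g = comm b a.
Proof. by rewrite /comm !invgM !invgK !mulgA. Qed.

Lemma relation_reflect a b c d :
  (comm a b * comm c d)%g = SL2_opp 1%g -> (comm b a * comm d c)%g = SL2_opp 1%g.
Proof. by move/SL2_opp_comm => e; rewrite -(commV a b) -(commV c d) -invgM e SL2_invN invg1. Qed.

Lemma relation_handle a b c d : (comm a b * comm c d)%g = SL2_opp 1%g ->
  (comm a (d^-1 * a * b) * comm (d^-1 * a * c) d)%g = SL2_opp 1%g.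
Proof.
move=> e; transitivity (a * d^-1 * (comm a b * comm c d) * d * a^-1)%g.
  by rewrite /comm !invgM !invgK !mulgA !(mulgVK, mulgK).
by rewrite e !(SL2_mulgN, SL2_mulNg) mulg1 mulgVK mulgV.
Qed.

(** a conjugates b into - b. *)
Lemma tr_comm_opp a b : comm a b = SL2_opp 1%g -> tr b = 0.
Proof.
move=> e; have : (a * b * a^-1)%g = SL2_opp b.
  by rewrite -[LHS](mulgVK b) -/(comm a b) e SL2_mulNg mul1g.
by move/(congr1 (@tr R)); rewrite tr_conj trN => h; lra.
Qed.

(** The relation says that the conjugate of a by c is minus its conjugate by b. *)
Lemma tr_relation_opp a b c : (comm a b * comm c a)%g = SL2_opp 1%g -> tr a = 0.
Proof.
move=> e; have : (c * a * c^-1)%g = SL2_opp (b * a * b^-1)%g.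
  have e' : ((b * a^-1 * b^-1) * (c * a * c^-1))%g = SL2_opp 1%g.
    transitivity (a^-1 * (comm a b * comm c a) * a)%g; last by rewrite e SL2_mulgN mulg1 SL2_mulNg mulVg.
    by rewrite /comm !mulgA mulVg mul1g !mulgVK.
  by have := SL2_oppM1 (SL2_opp_comm e'); rewrite !invgM !invgK !mulgA.
by move/(congr1 (@tr R)); rewrite trN !tr_conj => h; lra.
Qed.

Lemma comm1g a : comm 1%g a = 1%g.
Proof. by rewrite /comm invg1 mul1g mulg1 mulgV. Qed.

End relation.

Section marked_representations.
Context (R : realType) (rho : {multiplicative fundamental_group R (base R) -> PSL2 R}).
Local Notation G := (SL2 R).

(** The sign of the relation is part of the data and is checked algebraically for each move, instead
    of being derived again from the Euler number of the composed representation. *)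
Definition marked (A B C D : G) : Prop :=
  (comm A B * comm C D)%g = SL2_opp 1%g /\ exists h : pointed_homeo (base R),
  [/\ PSL2_class A = rho (induced h (gen_a R)), PSL2_class B = rho (induced h (gen_b R)),
      PSL2_class C = rho (induced h (gen_c R)) & PSL2_class D = rho (induced h (gen_d R))].

Lemma induced_opp (k : pointed_homeo (base R)) (x y : fundamental_group R (base R)) :
  induced k x = y -> induced (homeo_opp k) y = x.
Proof. by move=> <-; rewrite inducedK. Qed.

Lemma marked_slide A B C D : marked A B C D -> marked (A * B)%g B C D.
Proof.
move=> [e [h [hA hB hC hD]]]; split; first by rewrite comm_slide.
have [k [ka kb kc kd]] := slide_homeo R; exists (homeo_comp h k).
by rewrite !induced_comp ka kb kc kd inducedM gmulfM PSL2_classgM hA hB.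
Qed.

Lemma marked_slideV A B C D : marked A B C D -> marked (A * B^-1)%g B C D.
Proof.
move=> [e [h [hA hB hC hD]]]; split; first by rewrite comm_slideV.
have [k [ka kb kc kd]] := slide_homeo R; exists (homeo_comp h (homeo_opp k)).
have ka' : induced k (gen_a R * (gen_b R)^-1)%g = gen_a R by rewrite inducedM inducedV ka kb mulgK.
rewrite !induced_comp (induced_opp ka') (induced_opp kb) (induced_opp kc) (induced_opp kd).
by rewrite inducedM inducedV gmulfM rhoV PSL2_classgM PSL2_classV hA hB.
Qed.

Lemma marked_reflect A B C D : marked A B C D -> marked B A D C.
Proof.
move=> [e [h [hA hB hC hD]]]; split; first exact: relation_reflect.
have [k [ka kb kc kd]] := reflect_homeo R; exists (homeo_comp h k).
by rewrite !induced_comp ka kb kc kd.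
Qed.

Lemma marked_swap A B C D : marked A B C D -> marked C D A B.
Proof.
move=> [e [h [hA hB hC hD]]]; split; first exact: SL2_opp_comm.
have [k [ka kb kc kd]] := rotate_homeo R; exists (homeo_comp h k).
by rewrite !induced_comp ka kb kc kd.
Qed.

(** The homeomorphism of [handle_homeo] is used backwards: its inverse multiplies b and c by d^-1
    a. *)
Lemma marked_handle A B C D : marked A B C D -> marked A (D^-1 * A * B)%g (D^-1 * A * C)%g D.
Proof.
move=> [e [h [hA hB hC hD]]]; split; first exact: relation_handle.
have [k [ka kb kc kd]] := handle_homeo R; exists (homeo_comp h (homeo_opp k)).
have kb' : induced k ((gen_d R)^-1 * gen_a R * gen_b R)%g = gen_b R.
  by rewrite !inducedM inducedV ka kb kd !mulgA mulgK mulVg mul1g.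
have kc' : induced k ((gen_d R)^-1 * gen_a R * gen_c R)%g = gen_c R.
  by rewrite !inducedM inducedV ka kc kd !mulgA mulgK mulVg mul1g.
rewrite !induced_comp (induced_opp ka) (induced_opp kb') (induced_opp kc') (induced_opp kd).
by rewrite !inducedM !inducedV !gmulfM !rhoV !PSL2_classgM !PSL2_classV hA hB hC hD.
Qed.

Lemma marked_opp A B C D : marked A B C D -> marked (SL2_opp A) B C D.
Proof.
move=> [e [h [hA hB hC hD]]]; split; first by rewrite commN.
by exists h; split=> //; rewrite -hA; apply/PSL2_classP; right.
Qed.

Hypothesis hyp : forall g, simple_closed_curve g -> rho g != 1%g -> 2 < abs_tr (rho g).

Lemma tr_simple h g (X : G) : simple_closed_curve g -> PSL2_class X = rho (induced h g) ->
  X <> 1%g -> X <> SL2_opp 1%g -> 2 < `|tr X|.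
Proof.
move=> sg Xg n1 nN; rewrite trE -abs_trE Xg; apply: hyp.
  exact: simple_closed_curve_induced.
apply/eqP; rewrite -Xg => /PSL2_classP[] e; [apply: n1|apply: nN]; exact: val_inj.
Qed.

(** A killed curve lifts to 1 or -1, of trace 2 or -2, and any other simple curve has a trace larger
    than 2 in absolute value. This weak form serves to exclude the killed curves below. *)
Lemma marked_tr_neq0 A B C D : marked A B C D -> tr A <> 0.
Proof.
move=> [_ [h [hA _ _ _]]] t0.
have := @tr_simple h _ A (simple_a R) hA; rewrite t0 normr0 => h0.
suff : 2 < 0 :> R by rewrite ltrn0.
by apply: h0 => e; move: t0; rewrite e ?trN tr1 => /eqP; rewrite ?oppr_eq0 pnatr_eq0.
Qed.

(** If A were 1 or -1, then [C, D] would be -1 and tr D would be 0. *)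
Lemma marked_tr A B C D : marked A B C D -> 2 < `|tr A|.
Proof.
move=> m; have := marked_tr_neq0 (marked_reflect (marked_swap m)).
case: (m) => e [h [hA _ _ _]] tD.
have bad : comm A B <> 1%g by move=> c1; apply/tD/(@tr_comm_opp _ C); rewrite -e c1 mul1g.
by apply: (tr_simple (simple_a R) hA) => AE; apply: bad; rewrite AE ?commN comm1g.
Qed.

(** If [C, D] were 1 or -1, one of the two commutators would be -1, and B or D would have trace
    0. *)
Lemma marked_tr_comm A B C D : marked A B C D -> 2 < `|tr (comm A B)|.
Proof.
move=> m; have tB := marked_tr_neq0 (marked_reflect m).
have tD := marked_tr_neq0 (marked_reflect (marked_swap m)).
case: (m) => e [h [hA hB hC hD]].
rewrite (SL2_oppM1 e) trN trV normrN; apply: (tr_simple (simple_cd R) (h := h)).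
- by rewrite PSL2_class_comm hC hD -rho_comm /comm !(inducedM, inducedV).
- by move=> c1; apply/tB/(@tr_comm_opp _ A); rewrite (SL2_oppM1 e) c1 invg1.
- by move=> c1; apply/tD/(@tr_comm_opp _ C).
Qed.

(** If D were A or - A, the relation would read [A, B] [C, A] = -1 and force tr A = 0. *)
Lemma marked_tr_bridge A B C D : marked A B C D -> 2 < `|tr (D^-1 * A)%g|.
Proof.
move=> m; have tA := marked_tr_neq0 m; case: (m) => e [h [hA hB hC hD]].
apply: (tr_simple (simple_da R) (h := h)).
- by rewrite PSL2_classgM PSL2_classV hA hD -rhoV -gmulfM inducedM inducedV.
- move=> c1; apply/tA/(@tr_relation_opp _ A B C); rewrite -[X in comm C X](mulVKg D) c1 mulg1.
  exact: e.
- move=> c1; apply/tA/(@tr_relation_opp _ A B C); rewrite -[X in comm C X](mulVKg D) c1.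
  by rewrite SL2_mulgN mulg1 commNr.
Qed.

Lemma marked_hyperbolic : hyperbolic_orbit marked.
Proof.
split.
- by move=> a b c d [].
- exact: marked_slide.
- exact: marked_slideV.
- exact: marked_reflect.
- exact: marked_swap.
- exact: marked_handle.
- exact: marked_opp.
- exact: marked_tr.
- exact: marked_tr_comm.
- exact: marked_tr_bridge.
Qed.

End marked_representations.

Theorem theorem5 (R : realType)
    (rho : {multiplicative fundamental_group R (base R) -> PSL2 R}) :
  euler_number rho 1 \/ euler_number rho (-1) ->
  exists gamma : fundamental_group R (base R),
    [/\ simple_closed_curve gamma, gamma != 1%g & abs_tr (rho gamma) <= 2].
Proof.
move=> eu; have [A [B [C [D [[hA hB hC hD] rel]]]]] : exists A B C D : SL2 R,
    [/\ [/\ PSL2_class A = rho (gen_a R), PSL2_class B = rho (gen_b R),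
    PSL2_class C = rho (gen_c R) & PSL2_class D = rho (gen_d R)] &
    (comm A B * comm C D)%g = SL2_opp 1%g].
  by case: eu; apply: euler_lift; [left|right].
apply: contrapT => none; apply: (hyperbolic_orbit_empty (marked_hyperbolic (rho := rho) _)) (A) (B) (C) (D) _.
  move=> g sg g1; rewrite ltNge; apply/negP => le; apply: none; exists g; split=> //.
  by apply: contra g1 => /eqP->; rewrite rho1.
by split=> //; exists (homeo_id (base R)); rewrite !induced_id.
Qed.
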